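(* Let $n\ge 2$, $p\in(-\infty,0)\cup(0,1)$, $K\in\mathcal{K}_o^n$, $f\in C(S^{n-1})$, and let $K_t$ be the logarithmic family of Wulff shapes generated by $h_K$ and $f$. Then $$\lim_{t\to 0}\frac{V(\mathrm{I}_pK_t)-V(\mathrm{I}_pK)}{t}=\operatorname{sgn}(p)\int_{S^{n-1}}f(u)\,d\mathcal{I}_p(K,u),$$ where $V$ denotes $n$-dimensional volume, $\mathrm{I}_p$ the $L_p$ intersection body and $\mathcal{I}_p(K,\cdot)$ the $p$-affine dual curvature measure of $K$.
   Context: A convex body is a compact convex subset of $\mathbb{R}^n$ with nonempty interior; $\mathcal{K}_o^n$ is the set of convex bodies containing the origin in their interiors. For $K\in\mathcal{K}_o^n$, the support function is $h_K(v)=\max\{x\cdot v: x\in K\}$, $v\in S^{n-1}$, and for a compact set $K$ star-shaped with respect to the origin the radial function is $\rho_K(x)=\max\{t\ge 0: tx\in K\}$, $x\in\mathbb{R}^n\setminus\{o\}$. A star body is a compact star-shaped set (with respect to the origin) whose radial function is continuous and positive on $S^{n-1}$. Spherical Lebesgue measure is denoted $du$, $dv$. The sign function is $\operatorname{sgn}(x)=x/|x|$ for $x\ne 0$. Logarithmic family of Wulff shapes: for $t$ in an interval $(-\delta,\delta)$, $\delta>0$, let $h_t\in C(S^{n-1})$ be given by $\log h_t(v)=\log h_K(v)+tf(v)$; then $K_t=\{x\in\mathbb{R}^n: x\cdot v\le h_t(v)\text{ for all }v\in S^{n-1}\}$. $L_p$ intersection body: for $p\in(-\infty,0)\cup(0,1)$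 and a body $K$ (star body, in particular $K\in\mathcal{K}_o^n$), $\mathrm{I}_pK$ is the star body with radial function $$\rho_{\mathrm{I}_pK}(x)=\Big(\frac{1-p}{2}\int_K|x\cdot y|^{-p}\,dy\Big)^{1/p},\qquad x\in\mathbb{R}^n\setminus\{o\}.$$ $q$-cosine transform: for $q>-1$ and $f\in C(S^{n-1})$, $T_qf(u)=\int_{S^{n-1}}f(v)|u\cdot v|^q\,dv$, $u\in S^{n-1}$. Reverse radial Gauss image: for $K\in\mathcal{K}_o^n$ and $\eta\subset S^{n-1}$, $\boldsymbol{\alpha}_K^*(\eta)=\bigcup_{v\in\eta}\{u\in S^{n-1}:\rho_K(u)\,u\cdot v=h_K(v)\}$. $p$-affine dual curvature measure: for $K\in\mathcal{K}_o^n$ and Borel $\eta\subset S^{n-1}$, $$\mathcal{I}_p(K,\eta)=\frac{1-p}{2|p|}\int_{\boldsymbol{\alpha}_K^*(\eta)}\rho_K^{n-p}(v)\,T_{-p}\rho_{\mathrm{I}_pK}^{n-p}(v)\,dv .$$ *)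

(* Defs.v *)
From HB Require Import structures.
From mathcomp Require Import all_boot all_order all_algebra.
From mathcomp Require Import all_classical all_reals all_analysis.
From mathcomp Require Import measurable_realfun.
Set Implicit Arguments. Unset Strict Implicit. Unset Printing Implicit Defensive.
Import Order.TTheory GRing.Theory Num.Theory numFieldNormedType.Exports.
Local Open Scope classical_set_scope.
Local Open Scope ring_scope.

(* R^n is 'rV[R]_n.  Its library topology comes from the sup norm, hence is the
   Euclidean one; its sigma-algebra is the Borel one. *)
Section borel_rV.
Context (R : realType) (n : nat).
Let G := @open 'rV[R]_n.

HB.instance Definition _ := @isMeasurable.Build (sigma_display G) 'rV[R]_n
  <<s G >> (@sigma_algebra0 _ setT G) (@sigma_algebraC _ G)
  (@sigma_algebra_bigcup _ setT G).

Lemma open_measurable_rV (U : set 'rV[R]_n) : open U -> measurable U.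
Proof. exact: sub_sigma_algebra. Qed.

Lemma measurable_coord (i : 'I_n) :
  measurable_fun [set: 'rV[R]_n] (fun v : 'rV[R]_n => v ord0 i).
Proof.
apply: (measurability _ (RGenOpens.measurableE R)).
move=> _ [_ [a [b ->] <-]]; rewrite setTI; apply: open_measurable_rV.
by move/continuousP: (@coord_continuous R 1 n ord0 i); apply;
  exact: interval_open.
Qed.

Lemma measurable_rV d (T : measurableType d) (f : T -> 'rV[R]_n) :
  (forall i, measurable_fun [set: T] (fun t => f t ord0 i)) ->
  measurable_fun [set: T] f.
Proof.
move=> mf; apply: (@measurability _ _ _ _ _ _ G) => //.
move=> _ [U oU <-]; rewrite setTI.
pose e (q : 'rV[rat]_n * nat) : R := q.2.+1%:R^-1.
pose c (q : 'rV[rat]_n * nat) : 'rV[R]_n := map_mx ratr q.1.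
have -> : f @^-1` U = \bigcup_(q : 'rV[rat]_n * nat)
    (if `[< ball (c q) (e q) `<=` U >] then
      \bigcap_(i : 'I_n) ((fun t => f t ord0 i) @^-1` (ball (c q ord0 i) (e q)))
     else set0).
  apply/seteqP; split=> [t Uft|t [q _]]; last first.
    case: asboolP => // qU fqt; apply: qU; split; first by rewrite invr_gt0.
    by move=> i j; rewrite ord1; exact: fqt.
  have [r r0 rU] : exists2 r : R, 0 < r & ball (f t) r `<=` U.
    by have /nbhs_ballP[r r0 rU] := open_nbhs_nbhs (conj oU Uft); exists r.
  have [k kr] : exists k : nat, k.+1%:R^-1 < r / 2 :> R.
    have [k _ /(_ k (leqnn k))] := 
      near_infty_natSinv_lt (PosNum (divr_gt0 r0 (ltr0n _ 2))).
    by exists k.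
  have k0 : (0 : R) < k.+1%:R^-1 by rewrite invr_gt0.
  have /choice[q qP] : forall i : 'I_n, exists q : rat,
      ratr q \in `]f t ord0 i - k.+1%:R^-1, f t ord0 i + k.+1%:R^-1[.
    by move=> i; apply: rat_in_itvoo; rewrite ltrBlDr -addrA ltrDl addr_gt0.
  have qb i : `|ratr (q i) - f t ord0 i| < k.+1%:R^-1.
    by have := qP i; rewrite in_itv/= ltr_distl.
  exists (\row_i q i, k) => //; case: asboolP => [_ i _/=|]; last first.
    case=> v [_ vb]; apply: rU; split => // i j; rewrite ord1.
    have := vb ord0 j; rewrite /c /= !mxE /ball/= => vbj.
    rewrite /ball/= (splitr r) (le_lt_trans (ler_distD (ratr (q j)) _ _))//.
    rewrite ltrD//; first by rewrite distrC (lt_trans (qb j)).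
    exact: lt_trans kr.
  by rewrite /ball/= /c !mxE; exact: qb.
apply: countable_bigcupT_measurable => // q.
case: ifP => _; last exact: measurable0.
apply: fin_bigcap_measurable => // i _; rewrite -[X in measurable X]setTI.
by apply: mf => //; apply: open_measurable; exact: ball_open.
Qed.

End borel_rV.

Section cons_measure.
Context (R : realType) (n : nat).
Variable mu : {sigma_finite_measure set 'rV[R]_n -> \bar R}.

Let cons_rV (p : R * 'rV[R]_n) : 'rV[R]_n.+1 := row_mx p.1%:M p.2.
Let uncons_rV (v : 'rV[R]_n.+1) : R * 'rV[R]_n :=
  (v ord0 ord0, @rsubmx _ 1 1 n v).

Let mcons : measurable_fun [set: measurableTypeR R * 'rV[R]_n] cons_rV.
Proof.
apply: measurable_rV => i.
case: (@fintype.splitP 1 n i) => [j|j] ij.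
  rewrite (_ : i = lshift n j); last exact/val_inj.
  rewrite (_ : (fun _ => _) = fst); first exact: measurable_fst.
  by apply/funext => p; rewrite /cons_rV (@row_mxEl _ 1 1 n) mxE (ord1 j) eqxx.
rewrite (_ : i = rshift 1 j); last exact/val_inj.
rewrite (_ : (fun _ => _) = (fun v : 'rV[R]_n => v ord0 j) \o snd).
  by apply: measurableT_comp; [exact: measurable_coord|exact: measurable_snd].
by apply/funext => p; rewrite /cons_rV (@row_mxEr _ 1 1 n).
Qed.

Let muncons : measurable_fun [set: 'rV[R]_n.+1]
  (uncons_rV : _ -> (measurableTypeR R * 'rV[R]_n)%type).
Proof.
apply/measurable_fun_pairP; split; first exact: measurable_coord.
apply: measurable_rV => i /=; rewrite (_ : (fun _ => _) =
  fun v : 'rV[R]_n.+1 => v ord0 (@rshift 1 n i)); first exact: measurable_coord.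
by apply/funext => v; rewrite /= mxE.
Qed.

(* the product measure lebesgue_measure \x mu carried to 'rV_n.+1 *)
Definition cons_measure := pushforward (lebesgue_measure \x mu)%E
  (fun p : R * 'rV[R]_n => row_mx p.1%:M p.2 : 'rV[R]_n.+1).

Let cons0 : cons_measure set0 = 0%E. Proof. exact: measure0. Qed.
Let cons_ge0 A : (0 <= cons_measure A)%E. Proof. exact: measure_ge0. Qed.
Let cons_sigma_additive : semi_sigma_additive cons_measure.
Proof. exact: (@measure_semi_sigma_additive _ _ _ [the {measure set _ -> \bar R} of
  pushforward (lebesgue_measure \x mu)%E cons_rV]). Qed.

HB.instance Definition _ := isMeasure.Build _ _ _ cons_measure
  cons0 cons_ge0 cons_sigma_additive.

Let cons_sigma_finite : sigma_finite setT cons_measure.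
Proof.
have /sigma_finiteP[F [FT ndF Foo]] := sigma_finiteT (@lebesgue_measure R).
have /sigma_finiteP[G [GT ndG Goo]] := sigma_finiteT mu.
exists (fun k => uncons_rV @^-1` (F k `*` G k)).
  rewrite -preimage_bigcup; apply/esym/seteqP; split => // v _ /=.
  have : [set: R] (uncons_rV v).1 by [].
  rewrite FT => -[i _ Fi].
  have : [set: 'rV[R]_n] (uncons_rV v).2 by [].
  rewrite GT => -[j _ Gj].
  exists (maxn i j) => //; split.
    by move: Fi; exact/subsetPset/ndF/leq_maxl.
  by move: Gj; exact/subsetPset/ndG/leq_maxr.
move=> k; have [mF Fk] := Foo k; have [mG Gk] := Goo k; split.
  by rewrite -[X in measurable X]setTI; apply: muncons => //; exact: measurableX.
rewrite (_ : cons_measure _ = (lebesgue_measure \x mu)%E (F k `*` G k)).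
  by rewrite product_measure1E// lte_mul_pinfty// ge0_fin_numE.
rewrite /cons_measure /pushforward -comp_preimage; congr (_ _).
rewrite (_ : _ \o _ = id)//.
apply/funext => -[x v]; rewrite /uncons_rV/=; congr pair.
  rewrite (_ : ord0 = lshift n (ord0 : 'I_1)); last exact/val_inj.
  by rewrite (@row_mxEl _ 1 1 n) mxE.
by rewrite (@row_mxKr _ 1 1 n).
Qed.

HB.instance Definition _ := Measure_isSigmaFinite.Build _ _ _ cons_measure
  cons_sigma_finite.

End cons_measure.

Fixpoint lebesgue_rV (R : realType) (n : nat) :
    {sigma_finite_measure set 'rV[R]_n -> \bar R} :=
  match n with
  | 0 => \d_(0 : 'rV[R]_0)
  | m.+1 => cons_measure (lebesgue_rV R m)
  end.

Section euclidean.
Context (R : realType) (n : nat).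
Implicit Types (x u v : 'rV[R]_n) (K A : set 'rV[R]_n).

Definition volume A : R := fine (lebesgue_rV R n A).

Definition dot x v : R := \sum_i x ord0 i * v ord0 i.

Definition enorm x : R := Num.sqrt (dot x x).

Definition sphere : set 'rV[R]_n := [set u | enorm u = 1].

Definition sgn x : 'rV[R]_n := (enorm x)^-1 *: x.

Lemma measurable_enorm : measurable_fun [set: 'rV[R]_n] enorm.
Proof.
have sqrt_m : measurable_fun [set: R] (@Num.sqrt R).
  exact: (continuous_measurable_fun (@sqrt_continuous R)).
apply: (measurableT_comp sqrt_m); apply: measurable_sum => i.
by apply: measurable_funM; exact: measurable_coord.
Qed.

Lemma measurable_sgn : measurable_fun [set: 'rV[R]_n] sgn.
Proof.
apply: measurable_rV => i.
rewrite (_ : (fun _ => _) = fun x => enorm x `^ (- 1) * x ord0 i).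
  apply: measurable_funM; last exact: measurable_coord.
  exact: (measurableT_comp (measurable_powR (- 1)) measurable_enorm).
by apply/funext => x; rewrite mxE powR_inv1// sqrtr_ge0.
Qed.

Let ball0 : set 'rV[R]_n := enorm @^-1` `]0, 1].

Let mball0 : measurable ball0.
Proof. by rewrite -[X in measurable X]setTI; exact: measurable_enorm. Qed.

(* Spherical Lebesgue measure: n times the volume of the cone
   { t u : u in A, 0 < t <= 1 }.  It is a measure on 'rV_n carried by the
   sphere. *)
Definition sphere_measure A : \bar R :=
  (n%:R%:E * lebesgue_rV R n [set x | A (sgn x) /\ (0 < enorm x <= 1)%R])%E.

Let msgn := measurable_sgn.

Let sphere_measureE : exists mu : {measure set 'rV[R]_n -> \bar R},
  sphere_measure = mu.
Proof.
have [mu muE] : exists mu : {measure set 'rV[R]_n -> \bar R},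
    mu = pushforward (mrestr (lebesgue_rV R n) mball0) sgn :> (set _ -> _).
  exists (measure_function_pushforward__canonical__measure_function_Measure
    (mrestr (lebesgue_rV R n) mball0) msgn); reflexivity.
exists (mscale (NngNum (ler0n R n)) mu : {measure set 'rV[R]_n -> \bar R}).
apply/funext => A; rewrite /sphere_measure /= /mscale muE.
by congr (_ * lebesgue_rV R n _)%E.
Qed.

Let sphere0 : sphere_measure set0 = 0%E.
Proof. by have [mu ->] := sphere_measureE; exact: measure0. Qed.

Let sphere_ge0 A : (0 <= sphere_measure A)%E.
Proof. by have [mu ->] := sphere_measureE; exact: measure_ge0. Qed.

Let sphere_sigma_additive : semi_sigma_additive sphere_measure.
Proof.
by have [mu ->] := sphere_measureE; exact: measure_semi_sigma_additive.
Qed.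

HB.instance Definition _ := isMeasure.Build _ _ _ sphere_measure
  sphere0 sphere_ge0 sphere_sigma_additive.

Definition convex_body K :=
  [/\ compact K, convex_set (K : set (convex_lmodType 'rV[R]_n)) &
      K° !=set0].

Definition convex_body_o K := convex_body K /\ K° 0.

(* For the bodies considered, the suprema in the next two definitions are
   attained. *)
Definition support_fun K v : R := sup [set dot x v | x in K].

Definition radial_fun K x : R := sup [set t | 0 <= t /\ K (t *: x)].

Definition wulff (h : 'rV[R]_n -> R) : set 'rV[R]_n :=
  [set x | forall v, sphere v -> dot x v <= h v].

Definition log_family K (f : 'rV[R]_n -> R) (t : R) : set 'rV[R]_n :=
  wulff (fun v => expR (ln (support_fun K v) + t * f v)).

(* the star-shaped set whose radial function on the sphere is rho *)
Definition star_of_radial (rho : 'rV[R]_n -> R) : set 'rV[R]_n :=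
  [set x | exists u t, [/\ sphere u, 0 <= t, t <= rho u & x = t *: u]].

(* powR gives 0 to a negative power the value 0 instead of +oo; for 0 < p this
   changes the integrands of Ip_radial and of cosine_transform only on the null
   set of the y (resp. v) orthogonal to x (resp. u). *)
Definition Ip_radial (p : R) K x : R :=
  ((1 - p) / 2 * \int[lebesgue_rV R n]_(y in K) (`|dot x y| `^ (- p))) `^ p^-1.

Definition Ip (p : R) K : set 'rV[R]_n := star_of_radial (Ip_radial p K).

Definition cosine_transform (q : R) (f : 'rV[R]_n -> R) u : R :=
  \int[sphere_measure]_(v in sphere) (f v * `|dot u v| `^ q).

Definition reverse_radial_gauss_image K (eta : set 'rV[R]_n) : set 'rV[R]_n :=
  \bigcup_(v in eta)
    [set u | sphere u /\ radial_fun K u * dot u v = support_fun K v].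

(* Defined on all subsets of 'rV_n and carried by the sphere.  The reverse radial
   Gauss image of a Borel set is spherically Lebesgue measurable but need not be
   Borel; as the integral of a nonnegative function is the supremum of the
   integrals of the Borel simple functions below it, the value is nevertheless
   the integral with respect to the completed measure. *)
Definition affine_dual_curvature_measure (p : R) K (eta : set 'rV[R]_n) :
    \bar R :=
  (((1 - p) / (2 * `|p|))%:E *
   \int[sphere_measure]_(v in reverse_radial_gauss_image K (eta `&` sphere))
     (radial_fun K v `^ (n%:R - p) *
      cosine_transform (- p)
        (fun u => radial_fun (Ip p K) u `^ (n%:R - p)) v)%:E)%E.

End euclidean.
Arguments sphere {R n}.

(* Main.v *)
(* In polar coordinates, with m = n - p and
   A_t(u) = int_S |u.v|^(-p) rho_(K_t)(v)^m dv,
     rho_(I_p K_t)(u)^p = (1 - p) / (2 m) A_t(u),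
     V(I_p K_t) = 1/n int_S rho_(I_p K_t)(u)^n du.
   The gauge of K is convex, so outside a null cone it is differentiable and K
   has a unique outer unit normal alpha(v) at the boundary point in direction v;
   there d/dt log rho_(K_t)(v) = f(alpha(v)) at t = 0.  As
   |log rho_(K_t) - log rho_K| <= |t| max |f|, dominated convergence
   differentiates first A_t and then V(I_p K_t).  Since |u.v|^(-p) is symmetric,
   Fubini's theorem turns the resulting double integral into the integral over v
   of f(alpha(v)) rho_K(v)^m T_(-p) rho_(I_p K)^m (v), i.e. the integral of f
   against the image under alpha of the density that defines I_p(K, .). *)

Require Import Defs.
From HB Require Import structures.
From mathcomp Require Import all_boot all_order all_algebra.
From mathcomp Require Import all_classical all_reals all_analysis.
From mathcomp Require Import measurable_realfun.
From mathcomp Require Import ring lra.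
Set Implicit Arguments. Unset Strict Implicit. Unset Printing Implicit Defensive.
Import Order.TTheory GRing.Theory Num.Theory numFieldNormedType.Exports.
Local Open Scope classical_set_scope.
Local Open Scope ring_scope.

(** * Polar coordinates *)

(** Two obstacles shape the proof. For [0 < p] the kernel [|u.v|^(-p)] is unbounded, so both
    differentiations and the exchange of integrals need bounds on its spherical integral, uniform in
    [u]: the upper bound dominates, the lower one permits division by [A_0] and the exponent [n/p],
    negative when [p] is. And the normal [alpha] is meaningful only off a Borel null cone, which is
    located through one-sided derivatives: by convexity they exist everywhere, and they are compared
    on one coordinate line at a time.

    Both differentiations are instances of one statement about integrals of [w y_t^a], where
    [|ln y_t| <= B |t|] and [ln y_t / t] converges: first [y_t = rho_(K_t) / rho_K] with [a = m],
    then [y_t = A_t / A_0] with [a = n/p]. The second ratio is a weighted mean of [m]-th powers of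
    the first, so it inherits the logarithmic bound, with [m B] for [B].

    The curvature measure stays a plain set function: its integral is evaluated from its values on
    Borel sets alone. For Borel [eta] the reverse radial Gauss image differs from a Borel set by a
    subset of the null cone. *)

Section real_integrals.
Context (R : realType).
Local Notation leb := (@lebesgue_measure R).
Implicit Types (a b c q : R) (F : R -> \bar R).

(** The image [P] of Lebesgue measure under the affine map, multiplied by [c], gives every half-open
    interval its length, hence is Lebesgue measure by uniqueness. *)
Lemma ge0_integral_leb_affine c b F : 0 < c -> measurable_fun setT F ->
  (forall x, (0 <= F x)%E) ->
  (\int[leb]_x F (c * x + b)%R = c^-1%:E * \int[leb]_x F x)%E.
Proof.
move=> c0 mF F0.
have mphi : @measurable_fun _ _ (measurableTypeR R) (measurableTypeR R) setT
    (fun x : R => c * x + b).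
  by apply: measurable_funD => //; apply: measurable_funM.
have ci0 : 0 <= c^-1 by rewrite invr_ge0 ltW.
pose k : {nonneg R} := NngNum ci0.
pose P : {measure set (measurableTypeR R) -> \bar R} :=
  measure_function_pushforward__canonical__measure_function_Measure leb mphi.
have PE A : P A = leb ((fun x => c * x + b) @^-1` A) by [].
have E A : measurable A -> P A = mscale k leb A.
  move=> mA; pose k' : {nonneg R} := NngNum (ltW c0).
  have lA : leb A = mscale k' P A.
    apply: lebesgue_measure_unique => //.
    move=> _ [[u v]] _ <-; pose X := `]u, v]%classic; change (leb X = c%:E * P X)%E.
    have -> : P X = leb `](u - b) / c, (v - b) / c]%classic.
      rewrite PE; congr (leb _).
      by apply/seteqP; split=> x /=; rewrite !in_itv/= ltr_pdivrMr// ler_pdivlMr//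
          ltrBlDr lerBrDr (mulrC c).
    rewrite /X !lebesgue_measure_itv/= !lte_fin ltr_pM2r ?invr_gt0//.
    rewrite ltrD2r; case: ifPn => uv; last by rewrite mule0.
    rewrite -!EFinD -EFinM; congr EFin; rewrite -mulrBl mulrC divfK ?gt_eqF//; ring.
  by rewrite /mscale/= lA /mscale/= muleA -EFinM mulVf ?gt_eqF// mul1e.
rewrite (_ : (\int[leb]_x _ = \int[P]_x F x)%E); last first.
  by have /= := @ge0_integral_pushforward _ _ _ _ R _ mphi leb setT F measurableT mF (fun x _ =>
      F0 x) => <-.
rewrite (@eq_measure_integral _ _ _ setT (mscale k leb)) ?ge0_integral_mscale//.
by move=> A mA _; exact: E.
Qed.

Lemma integral_powR_itv q a b : q != -1 -> 0 < a -> a < b ->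
  (\int[leb]_(x in `[a, b]) (x `^ q)%:E = ((b `^ (q + 1) - a `^ (q + 1)) / (q + 1))%:E)%E.
Proof.
move=> q1 a0 ab.
have q10 : q + 1 != 0 by rewrite addr_eq0.
pose G x : R := (q + 1)^-1 * x `^ (q + 1).
have dG (x : R) : 0 < x -> is_derive x 1 G (x `^ q).
  move=> x0; have dp : is_derive x 1 ((@powR R) ^~ (q + 1)) ((q + 1) * x `^ (q + 1 - 1)).
    exact: is_derive1_powR.
  have := is_deriveZ (q + 1)^-1 dp.
  move=> h; apply: is_derive_eq; by rewrite addrK /GRing.scale /= mulKf.
have cp r (x : R) : 0 < x -> {for x, continuous (fun y : R => y `^ r)}.
  move=> x0; apply: differentiable_continuous; apply/derivable1_diffP.
  by apply: derivable_powR; rewrite in_itv/= x0.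
have cG (x : R) : 0 < x -> {for x, continuous G}.
  move=> x0; apply: differentiable_continuous; apply/derivable1_diffP.
  by apply: ex_derive; exact: dG.
rewrite (@continuous_FTC2 _ _ G)//.
- by rewrite -EFinB /G; congr EFin; field.
- apply: continuous_in_subspaceT => x; rewrite inE/= in_itv/= => /andP[ax _].
  by apply: cp; exact: lt_le_trans ax.
- split.
  + move=> x; rewrite in_itv/= => /andP[ax _]; apply: ex_derive.
    by apply: dG; exact: lt_trans ax.
  + by apply: cvg_at_right_filter; exact: cG.
  + by apply: cvg_at_left_filter; apply: cG; exact: lt_trans ab.
- move=> x; rewrite in_itv/= => /andP[ax _]; rewrite derive1E.
  by apply: derive_val; apply: dG; exact: lt_trans ax.
Qed.

Let cvg_powR_nat c q : 0 < c -> 0 < q ->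
  (c / i.+2%:R) `^ q @[i --> \oo] --> (0 : R).
Proof.
move=> c0 q0; have /cvg_at_rightP := @powR_cvg0 R q q0; apply.
split=> [i|]; first by rewrite divr_gt0.
rewrite -(mulr0 c); apply: cvgMl_tmp.
have := @cvg_harmonic R; by rewrite -(cvg_shiftS (@harmonic R)).
Qed.

Lemma integral_powR_oc q b : -1 < q -> 0 <= b ->
  (\int[leb]_(x in `]0%R, b]) (x `^ q)%:E = (b `^ (q + 1) / (q + 1))%:E)%E.
Proof.
move=> q1; rewrite le_eqVlt => /predU1P[<-|b0].
  by rewrite set_itvoc0 integral_set0 powR0 ?mul0r// gt_eqF// -ltrBlDr sub0r.
have q10 : 0 < q + 1 by rewrite -ltrBlDr sub0r.
(* The index shift [i.+2] keeps the left endpoint strictly below [b], as [integral_powR_itv]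
   demands. *)
have U : `]0, b]%classic = \bigcup_i `[b / i.+2%:R, b]%classic :> set R.
  apply/seteqP; split=> x /=; rewrite in_itv/=; last first.
    move=> [i _/=]; rewrite in_itv/= => /andP[xi ->]; rewrite andbT.
    by rewrite (lt_le_trans _ xi)// divr_gt0.
  move=> /andP[x0 xb]; have [k _ /(_ k (leqnn k)) kb] :=
    near_infty_natSinv_lt (PosNum (divr_gt0 x0 b0)).
  exists k => //=; rewrite in_itv/= xb andbT.
  have := ltW kb; rewrite /= ler_pdivlMr// mulrC => kx; rewrite (le_trans _ kx)//.
  by rewrite ler_pM2l// lef_pV2 ?posrE// ler_nat.
have mp : measurable_fun [set: R] (EFin \o (@powR R ^~ q)).
  by apply/measurable_EFinP; exact: measurable_powR.
pose I i := (\int[leb]_(x in `[(b / i.+2%:R)%R, b]) (x `^ q)%:E)%E.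
have I1 : I i @[i --> \oo] --> (\int[leb]_(x in `]0%R, b]) (x `^ q)%:E)%E.
  rewrite U; apply: (@ge0_nondecreasing_set_cvg_integral _ (measurableTypeR R) R (fun i : nat =>
      `[b / i.+2%:R, b]%classic) (fun x => (x `^ q)%:E) leb) => //.
  + move=> i j ij; apply/subsetPset => x /=; rewrite !in_itv/= => /andP[xi ->].
    rewrite andbT (le_trans _ xi)// ler_pM2l// lef_pV2 ?posrE// ler_nat.
    by rewrite !ltnS.
  + by move=> i; exact: (@measurable_funTS _ _ _ _ _ _ mp).
  + by move=> i x _; rewrite /= lee_fin powR_ge0.
rewrite -(cvg_lim _ I1)//; apply/cvg_lim => //.
rewrite (_ : I = EFin \o
    (fun i => (b `^ (q + 1) - (b / i.+2%:R) `^ (q + 1)) / (q + 1))); last first.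
  apply/funext => i /=; rewrite /I integral_powR_itv ?divr_gt0//.
  - by rewrite gt_eqF.
  - by rewrite ltr_pdivrMr// ltr_pMr// ltr1n.
apply: cvg_EFin; first exact: nearW.
rewrite -[X in X / (q + 1)]subr0; apply: cvgMr_tmp; apply: cvgB; first exact: cvg_cst.
exact: cvg_powR_nat.
Qed.

Lemma integral_powR_cy q a : 0 < q -> 0 < a ->
  (\int[leb]_(x in `[a, +oo[) (x `^ (- q - 1))%:E = (a `^ (- q) / q)%:E)%E.
Proof.
move=> q0 a0.
have U : `[a, +oo[%classic = \bigcup_i `[a, a * i.+2%:R]%classic :> set R.
  apply/seteqP; split=> x /=; rewrite in_itv/= andbT; last first.
    by move=> [i _/=]; rewrite in_itv/= => /andP[].
  move=> ax; exists (Num.truncn (x / a)) => //=; rewrite in_itv/= ax/=.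
  rewrite mulrC -ler_pdivrMr// ltW// (lt_le_trans (truncnS_gt _))//.
  by rewrite ler_nat.
have mp : measurable_fun [set: R] (EFin \o (@powR R ^~ (- q - 1))).
  by apply/measurable_EFinP; exact: measurable_powR.
pose I i := (\int[leb]_(x in `[a, (a * i.+2%:R)%R]) (x `^ (- q - 1))%:E)%E.
have I1 : I i @[i --> \oo] --> (\int[leb]_(x in `[a, +oo[) (x `^ (- q - 1))%:E)%E.
  rewrite U; apply: (@ge0_nondecreasing_set_cvg_integral _ (measurableTypeR R) R (fun i : nat =>
      `[a, a * i.+2%:R]%classic) (fun x => (x `^ (- q - 1))%:E) leb) => //.
  + move=> i j ij; apply/subsetPset => x /=; rewrite !in_itv/= => /andP[-> xi].
    by rewrite (le_trans xi)// ler_pM2l// ler_nat !ltnS.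
  + by move=> i; exact: (@measurable_funTS _ _ _ _ _ _ mp).
  + by move=> i x _; rewrite /= lee_fin powR_ge0.
rewrite -(cvg_lim _ I1)//; apply/cvg_lim => //.
(* The subtracted term is the upper endpoint to the power [- q], in the shape that [cvg_powR_nat]
   expects. *)
rewrite (_ : I = EFin \o
    (fun i => (a `^ (- q) - (a^-1 / i.+2%:R) `^ q) / q)); last first.
  apply/funext => i /=; rewrite /I integral_powR_itv//; last 2 first.
  - by rewrite -subr_eq0 opprK subrK oppr_eq0 gt_eqF.
  - by rewrite ltr_pMr// ltr1n.
  rewrite subrK -invfM -(@powR_inv1 _ (a * i.+2%:R)) ?mulr_ge0 ?ltW// -powRrM mulN1r.
  by rewrite invrN mulrN -mulNr opprB.
apply: cvg_EFin; first exact: nearW.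
rewrite -[X in X / q]subr0; apply: cvgMr_tmp; apply: cvgB; first exact: cvg_cst.
by apply: cvg_powR_nat => //; rewrite invr_gt0.
Qed.

End real_integrals.

(** * Lebesgue measure on ['rV[R]_n], one coordinate at a time *)

Section lebesgue_rV_integrals.
Context (R : realType).
Local Notation leb := (@lebesgue_measure R).
Local Notation mu n := (lebesgue_rV R n).

Definition cons_rV n (s : R) (y : 'rV[R]_n) : 'rV[R]_n.+1 := row_mx s%:M y.

Lemma cons_rV0 n (s : R) (y : 'rV[R]_n) : cons_rV s y ord0 ord0 = s.
Proof.
have -> : ord0 = lshift n (ord0 : 'I_1) :> 'I_(1 + n) by exact/val_inj.
by rewrite /cons_rV (@row_mxEl _ 1 1 n) mxE eqxx.
Qed.

Lemma cons_rVS n (s : R) (y : 'rV[R]_n) (j : 'I_n) :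
  cons_rV s y ord0 (lift ord0 j) = y ord0 j.
Proof.
have -> : lift ord0 j = rshift 1 j :> 'I_(1 + n) by exact/val_inj.
by rewrite /cons_rV (@row_mxEr _ 1 1 n).
Qed.

Lemma cons_rVP n (x y : 'rV[R]_n.+1) : x ord0 ord0 = y ord0 ord0 ->
  (forall j, x ord0 (lift ord0 j) = y ord0 (lift ord0 j)) -> x = y.
Proof.
move=> xy0 xyS; apply/rowP => i; case: (unliftP ord0 i) => [j ->|->] //.
Qed.

Lemma cons_rV_delta n s (x : 'rV[R]_n) r (j : 'I_n) :
  cons_rV s (x + r *: delta_mx ord0 j) =
  cons_rV s x + r *: delta_mx ord0 (lift ord0 j).
Proof.
apply: cons_rVP => [|k]; first by rewrite [RHS]mxE !cons_rV0 !mxE eqxx/= mulr0 addr0.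
by rewrite [RHS]mxE !cons_rVS !mxE eqxx/= (inj_eq lift_inj).
Qed.

Lemma cons_rV_delta0 n s (y : 'rV[R]_n) :
  cons_rV 0 y + s *: delta_mx ord0 ord0 = cons_rV s y.
Proof.
apply: cons_rVP => [|k]; first by rewrite [LHS]mxE !cons_rV0 !mxE eqxx/= mulr1 add0r.
by rewrite [LHS]mxE !cons_rVS !mxE/= mulr0 addr0.
Qed.

Lemma measurable_cons_rV n :
  measurable_fun [set: measurableTypeR R * 'rV[R]_n] (fun p => cons_rV p.1 p.2).
Proof.
apply: measurable_rV => i; case: (unliftP ord0 i) => [j ->|->].
  rewrite (_ : (fun _ => _) = (fun v : 'rV[R]_n => v ord0 j) \o snd).
    by apply: measurableT_comp; [exact: measurable_coord|exact: measurable_snd].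
  by apply/funext => p; rewrite cons_rVS.
by rewrite (_ : (fun _ => _) = fst); [exact: measurable_fst|
  apply/funext => p; rewrite cons_rV0].
Qed.

Section succ.
Context (n : nat) (F : 'rV[R]_n.+1 -> \bar R).
Hypotheses (mF : measurable_fun setT F) (F0 : forall x, (0 <= F x)%E).

Let mFc : measurable_fun [set: measurableTypeR R * 'rV[R]_n] (fun p => F (cons_rV p.1 p.2)).
Proof. exact: (measurableT_comp mF (@measurable_cons_rV n)). Qed.

Let pushE : (\int[mu n.+1]_x F x =
  \int[leb \x mu n]_p F (cons_rV p.1 p.2))%E.
Proof.
exact: (@ge0_integral_pushforward _ _ _ _ R _ (@measurable_cons_rV n)
  (leb \x mu n)%E setT F measurableT mF (fun x _ => F0 x)).
Qed.

Lemma ge0_integral_rVS :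
  (\int[mu n.+1]_x F x = \int[leb]_s \int[mu n]_y F (cons_rV s y))%E.
Proof. by rewrite pushE (fubini_tonelli1 _ mFc). Qed.

Lemma ge0_integral_rVS_swap :
  (\int[mu n.+1]_x F x = \int[mu n]_y \int[leb]_s F (cons_rV s y))%E.
Proof. by rewrite pushE (fubini_tonelli2 _ mFc). Qed.

End succ.

Lemma measurable_scalel n (c : R) : measurable_fun setT (fun x : 'rV[R]_n => c *: x).
Proof.
apply: measurable_rV => i; under eq_fun do rewrite mxE.
by apply: measurable_funM => //; exact: measurable_coord.
Qed.

(** Induction on the dimension: the first coordinate contributes one factor [c^-1] by the affine
    change of variables, the others come from the induction hypothesis. *)
Lemma ge0_integral_rV_scale n (c : R) (F : 'rV[R]_n -> \bar R) : 0 < c ->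
  measurable_fun setT F -> (forall x, (0 <= F x)%E) ->
  (\int[mu n]_x F (c *: x) = (c ^- n)%:E * \int[mu n]_x F x)%E.
Proof.
move=> c0; elim: n => [|n IH] in F *; move=> mF F0.
  rewrite expr0 invr1 mul1e; apply: eq_integral => x _; congr F.
  by apply/rowP; case.
have mFc : measurable_fun [set: measurableTypeR R * 'rV[R]_n] (fun p => F (cons_rV p.1 p.2)).
  exact: (measurableT_comp mF (@measurable_cons_rV n)).
have scons s y : c *: cons_rV s y = cons_rV (c * s) (c *: y) :> 'rV_n.+1.
  by apply: cons_rVP => [|j]; rewrite mxE ?cons_rV0 ?cons_rVS // mxE.
rewrite (@ge0_integral_rVS n (fun x => F (c *: x)))//; last first.
  exact: (measurableT_comp mF (@measurable_scalel n.+1 c)).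
transitivity (\int[leb]_s ((c ^- n)%:E * (\int[mu n]_y F (cons_rV (c * s + 0)%R y))))%E.
  apply: eq_integral => s _; rewrite addr0 -IH//.
    by apply: eq_integral => y _; rewrite scons.
  exact: (measurableT_comp mFc (measurable_pair1 _)).
have mG : measurable_fun [set: R] (fun s => \int[mu n]_y F (cons_rV s y))%E.
  exact: (measurable_fun_fubini_tonelli_F _ mFc).
rewrite ge0_integralZl//.
- rewrite (@ge0_integral_leb_affine R c 0 (fun s => \int[mu n]_y F (cons_rV s y))%E)//.
    by rewrite muleA -EFinM -invfM -exprSr (@ge0_integral_rVS n F).
  by move=> s; apply: integral_ge0.
- rewrite (_ : (fun _ => _) = (fun s => \int[mu n]_y F (cons_rV s y))%E \o (fun s => c * s + 0))//.
  apply: (measurableT_comp mG).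
  have : measurable_fun [set: R] (fun s : R => c * s + 0) by apply: measurable_funD => //;
      apply: measurable_funM.
  exact.
- by move=> s _; exact: integral_ge0.
- by rewrite lee_fin invr_ge0 exprn_ge0// ltW.
Qed.

(** Tonelli, peeling off coordinates until the [i]-th is first. It reduces the nullity of points, of
    hyperplanes and of the points where the gauge is not differentiable to countability on lines. *)
Lemma lebesgue_rV_null_slices n (N : set 'rV[R]_n) (i : 'I_n) : measurable N ->
  (forall x, leb [set s | N (x + s *: delta_mx ord0 i)] = 0%E) -> mu n N = 0%E.
Proof.
elim: n => [|n IH] in N i *; first by case: i.
move=> mN sN.
have mI : measurable_fun setT (fun x => (\1_N x)%:E : \bar R).
  by apply/measurable_EFinP; exact: measurable_indic.
have I0 x : (0 <= (\1_N x)%:E :> \bar R)%E by rewrite lee_fin.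
rewrite -[N]setIT -integral_indic//.
have mcons1 s : measurable_fun setT (@cons_rV n s).
  exact: (measurableT_comp (@measurable_cons_rV n) (measurable_pair1 s)).
have mcons2 y : measurable_fun [set: measurableTypeR R] (fun s => @cons_rV n s y).
  exact: (measurableT_comp (@measurable_cons_rV n) (measurable_pair2 y)).
move: sN; case: (unliftP ord0 i) => [j ->|->] sN.
  rewrite (ge0_integral_rVS mI I0) integral0_eq// => s _.
  rewrite (_ : (fun _ => _) = (fun y => (\1_(cons_rV s @^-1` N) y)%:E)) //.
  have mNs : measurable (cons_rV s @^-1` N).
    by rewrite -[X in measurable X]setTI; exact: mcons1.
  rewrite integral_indic// setIT; apply: (IH _ j) => // x.
  rewrite -[RHS](sN (cons_rV s x)); congr (leb _).
  by apply/seteqP; split=> r /=; rewrite cons_rV_delta.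
rewrite (ge0_integral_rVS_swap mI I0) integral0_eq// => y _.
rewrite (_ : (fun _ => _) = (fun s => (\1_((fun s => cons_rV s y) @^-1` N) s)%:E)) //.
have mNs : measurable ((fun s => cons_rV s y : 'rV_n.+1) @^-1` N : set (measurableTypeR R)).
  by rewrite -[X in measurable X]setTI; exact: mcons2.
rewrite integral_indic// setIT -[RHS](sN (cons_rV 0 y)); congr (leb _).
by apply/seteqP; split=> r /=; rewrite cons_rV_delta0.
Qed.

End lebesgue_rV_integrals.

(** * Integration against the image of a measure with density *)

Section integral_density_pushforward.
Local Open Scope ereal_scope.
Context d1 d2 (X : measurableType d1) (Y : measurableType d2) (R : realType).
Variables (m : {measure set X -> \bar R}) (phi : X -> Y) (w : X -> R).
Hypotheses (mphi : measurable_fun setT phi) (mw : measurable_fun setT w).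
Hypothesis w0 : forall x, (0 <= w x)%R.
Variable nu : set Y -> \bar R.
Hypothesis nuE : forall A, measurable A -> nu A = \int[m]_(x in phi @^-1` A) (w x)%:E.

Import HBNNSimple.

Let mwE : measurable_fun setT (EFin \o w).
Proof. exact/measurable_EFinP. Qed.

Let w0E x : 0 <= (w x)%:E.
Proof. by rewrite lee_fin. Qed.

Let nu0 : nu set0 = 0.
Proof. by rewrite nuE// preimage_set0 integral_set0. Qed.

Let sintegral_density (h : {nnsfun Y >-> R}) :
  sintegral nu h = \int[m]_x ((h (phi x))%:E * (w x)%:E).
Proof.
have mpre r : measurable (phi @^-1` (h @^-1` [set r])).
  by rewrite -[X in measurable X]setTI; exact: mphi.
have m1 r : measurable_fun setT (fun x => (\1_(phi @^-1` (h @^-1` [set r])) x)%:E : \bar R).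
  by apply/measurable_EFinP; exact: measurable_indic.
transitivity (\sum_(r \in range h) \int[m]_x ((r * \1_(phi @^-1` (h @^-1` [set r]))
    x)%:E * (w x)%:E)).
  rewrite /sintegral -(fsbig_widen (range h) setT)//=; last first.
    by move=> r [_ rh] /=; rewrite preimage10// nu0 mule0.
  apply: eq_fsbigr => r /set_mem [y _ hr].
  rewrite nuE// integral_mkcond -ge0_integralZl//; last 3 first.
  - exact/(measurable_restrictT _ (mpre r))/measurable_funTS.
  - by move=> x _; apply: erestrict_ge0.
  - by rewrite lee_fin -hr.
  apply: eq_integral => x _; rewrite patchE indicE.
  by case: ifP => _; rewrite ?mulr1 ?mulr0 ?mul0e ?mule0.
rewrite -ge0_integral_fsum//; last 2 first.
- move=> r; apply: emeasurable_funM => //; apply/measurable_EFinP.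
  by apply: measurable_funM => //; exact: measurable_indic.
- move=> r x _; apply: mule_ge0 => //; rewrite lee_fin indicE.
  case: (boolP (x \in _)) => [/set_mem/= <-|_]; last by rewrite mulr0.
  by rewrite mulr1.
apply: eq_integral => x _; rewrite -ge0_mule_fsuml; last first.
  move=> r; rewrite lee_fin indicE.
  case: (boolP (x \in _)) => [/set_mem/= <-|_]; last by rewrite mulr0.
  by rewrite mulr1.
by congr (_ * _); rewrite [in RHS](fimfunE h) -fsumEFin.
Qed.

(** Since [nu] is a mere set function, monotone convergence is applied on the side of the measure
    [m], to simple functions composed with [phi]; simple functions pass between the two sides by
    [sintegral_density]. *)
Let sup_sintegral_density (g : Y -> \bar R) : measurable_fun setT g ->
  (forall y, 0 <= g y) ->
  ereal_sup [set sintegral nu h | h in [set h : {nnsfun Y >-> R} |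
    forall y, (h y)%:E <= g y]] = \int[m]_x (g (phi x) * (w x)%:E).
Proof.
move=> mg g0; have mgphi : measurable_fun setT (g \o phi) by exact: measurableT_comp.
apply/eqP; rewrite eq_le; apply/andP; split.
  apply: ge_ereal_sup => _ [h /= hg <-]; rewrite sintegral_density.
  apply: ge0_le_integral => //.
  - by move=> x _; apply: mule_ge0 => //; rewrite lee_fin.
  - apply: emeasurable_funM => //; apply/measurable_EFinP.
    exact: measurableT_comp.
  - exact: emeasurable_funM.
  - by move=> x _; apply: lee_wpmul2r.
pose h_ := nnsfun_approx measurableT mg.
have mh n : measurable_fun setT (fun x => ((h_ n \o phi) x)%:E : \bar R).
  by apply/measurable_EFinP; exact: measurableT_comp.
have -> : \int[m]_x (g (phi x) * (w x)%:E) =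
    limn (fun n => \int[m]_x ((h_ n (phi x))%:E * (w x)%:E)).
  rewrite -monotone_convergence//.
  - apply: eq_integral => x _; apply/esym/cvg_lim => //.
    have hx : ((h_ n (phi x))%:E @[n --> \oo] --> g (phi x))%E.
      by apply: (@cvg_nnsfun_approx _ _ _ _ measurableT g mg (fun y _ => g0 y)).
    exact: cvgeZr.
  - by move=> n; apply: emeasurable_funM => //; exact: mh.
  - by move=> n x _; apply: mule_ge0 => //; rewrite lee_fin.
  - move=> x _ a b ab; apply: lee_wpmul2r => //; rewrite lee_fin.
    exact/lefP/nd_nnsfun_approx.
apply: lime_le.
  apply: ereal_nondecreasing_is_cvgn => a b ab; apply: ge0_le_integral => //.
  - by move=> x _; apply: mule_ge0 => //; rewrite lee_fin.
  - by apply: emeasurable_funM => //; exact: mh.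
  - by apply: emeasurable_funM => //; exact: mh.
  - move=> x _; apply: lee_wpmul2r => //; rewrite lee_fin.
    exact/lefP/nd_nnsfun_approx.
apply: nearW => n; rewrite -sintegral_density; apply: ereal_sup_ubound.
exists (h_ n) => //= y; rewrite /h_ nnsfun_approxE.
exact: (@le_approx _ _ _ setT).
Qed.

(** The integral consults [nu] only at level sets of simple functions, which are measurable, so
    [nuE] determines it. This serves both [sphere_measure], with [phi] the map [sgn], and the
    curvature measure, with [phi] the normal map. *)
Lemma integral_density_pushforward (D : set Y) (f : Y -> \bar R) :
  measurable D -> measurable_fun D f ->
  \int[nu]_(y in D) f y = \int[m]_(x in phi @^-1` D) (f (phi x) * (w x)%:E).
Proof.
move=> mD mf; have mg : measurable_fun setT (f \_ D) by exact/(measurable_restrictT f mD).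
rewrite /integral !sup_sintegral_density//; last 2 first.
- exact: measurable_funeneg.
- exact: measurable_funepos.
rewrite [RHS]integral_mkcond [RHS]integralE.
have E x : ((fun x => f (phi x) * (w x)%:E) \_ (phi @^-1` D)) x =
    (f \_ D) (phi x) * (w x)%:E.
  rewrite !patchE (_ : (x \in phi @^-1` D) = (phi x \in D)); last first.
    by apply/idP/idP; rewrite !inE.
  by case: ifP => _; rewrite ?mul0e.
(* As [w] is nonnegative, multiplication by it commutes with taking positive and negative parts. *)
by congr (_ - _); apply: eq_integral => x _; rewrite ?funeposE ?funenegE E
  -?mulNe -[in RHS](mul0e (w x)%:E) !(muleC _ (w x)%:E) maxe_pMr.
Qed.

End integral_density_pushforward.

(** * Spherical measure as an image of Lebesgue measure *)

Section spherical_measure.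
Context (R : realType) (n : nat).
Local Notation leb := (@lebesgue_measure R).
Local Notation mu := (lebesgue_rV R n).
Local Notation sigma := (@sphere_measure R n).
Implicit Types (x y u v : 'rV[R]_n).

Definition punctured_ball : set 'rV[R]_n := [set x | 0 < enorm x <= 1].

Lemma enorm_ge0 x : 0 <= enorm x. Proof. exact: sqrtr_ge0. Qed.

Lemma dot_ge0 x : 0 <= dot x x.
Proof. by apply: sumr_ge0 => i _; rewrite -expr2 sqr_ge0. Qed.

Lemma enorm_eq0 x : (enorm x == 0) = (x == 0).
Proof.
rewrite sqrtr_eq0; apply/idP/idP => [|/eqP->]; last first.
  by rewrite /dot big1// => i _; rewrite mxE mul0r.
move=> h; have /eqP : dot x x = 0 by apply/eqP; rewrite eq_le h dot_ge0.
rewrite psumr_eq0 => [/allP x0|i _]; last by rewrite -expr2 sqr_ge0.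
apply/eqP/rowP => i; have := x0 i (mem_index_enum i).
by rewrite /= -expr2 sqrf_eq0 mxE => /eqP.
Qed.

Lemma enorm_gt0 x : (0 < enorm x) = (x != 0).
Proof. by rewrite lt_neqAle enorm_ge0 andbT eq_sym enorm_eq0. Qed.

Lemma dotZl a x y : dot (a *: x) y = a * dot x y.
Proof. by rewrite /dot mulr_sumr; apply: eq_bigr => i _; rewrite mxE mulrA. Qed.

Lemma dotC x y : dot x y = dot y x.
Proof. by apply: eq_bigr => i _; rewrite mulrC. Qed.

Lemma dotZr a x y : dot x (a *: y) = a * dot x y.
Proof. by rewrite dotC dotZl dotC. Qed.

Lemma enormZ a x : enorm (a *: x) = `|a| * enorm x.
Proof. by rewrite /enorm dotZl dotZr mulrA -expr2 sqrtrM ?sqr_ge0// sqrtr_sqr. Qed.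

Lemma sphere_sgn x : x != 0 -> sphere (sgn x).
Proof.
move=> x0; rewrite /sphere/= /sgn enormZ normfV ger0_norm ?enorm_ge0//.
by rewrite mulVf// enorm_eq0.
Qed.

Lemma sgn_id u : sphere u -> sgn u = u.
Proof. by rewrite /sphere/= /sgn => ->; rewrite invr1 scale1r. Qed.

Lemma sgnZ a x : 0 < a -> sgn (a *: x) = sgn x.
Proof.
move=> a0; rewrite /sgn enormZ gtr0_norm// invfM scalerA mulrAC mulVf ?gt_eqF//.
by rewrite mul1r.
Qed.

Lemma sgnE x : x = enorm x *: sgn x.
Proof.
have [->|x0] := eqVneq x 0; first by rewrite /sgn !scaler0.
by rewrite /sgn scalerA mulfV ?enorm_eq0// scale1r.
Qed.

Lemma sphere_neq0 u : sphere u -> u != 0.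
Proof.
by rewrite /sphere/= -enorm_eq0 => ->; rewrite oner_neq0.
Qed.

Lemma measurable_sphere : measurable (@sphere R n).
Proof.
rewrite (_ : sphere = @enorm R n @^-1` [set 1])//.
by rewrite -[X in measurable X]setTI; apply: measurable_enorm.
Qed.

Lemma measurable_punctured_ball : measurable punctured_ball.
Proof.
rewrite (_ : punctured_ball = @enorm R n @^-1` `]0, 1]%classic); last first.
  by apply/seteqP; split => x /=; rewrite in_itv.
by rewrite -[X in measurable X]setTI; apply: measurable_enorm.
Qed.

Lemma integral_sphere (D : set 'rV[R]_n) (h : 'rV[R]_n -> \bar R) :
  measurable D -> measurable_fun D h ->
  (\int[sigma]_(u in D) h u =
   \int[mu]_(x in @sgn R n @^-1` D) (h (sgn x) * (n%:R * \1_punctured_ball x)%:E))%E.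
Proof.
move=> mD mh.
apply: (@integral_density_pushforward _ _ _ _ R mu (@sgn R n)
  (fun x => n%:R * \1_punctured_ball x) _ _ _ sigma) => //.
- exact: measurable_sgn.
- by apply: measurable_funM => //; apply: measurable_indic; exact: measurable_punctured_ball.
- move=> A mA; have mS : measurable (@sgn R n @^-1` A).
    by rewrite -[X in measurable X]setTI; apply: measurable_sgn.
  under eq_integral do rewrite EFinM.
  have mB := measurable_punctured_ball.
  rewrite ge0_integralZl//; last first.
    by apply/measurable_EFinP; apply: measurable_funTS; exact: measurable_indic.

  rewrite integral_indic// /sphere_measure; congr (_ * mu _)%E.
  by apply/seteqP; split=> x /= [].
Qed.

End spherical_measure.

(** * The polar coordinates formula *)

Section polar.
Context (R : realType).
Local Notation leb := (@lebesgue_measure R).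
Local Notation sigma n := (@sphere_measure R n).
Local Notation mu n := (lebesgue_rV R n).

Lemma measurable_rV_set1 n (x : 'rV[R]_n) : measurable [set x].
Proof.
rewrite (_ : [set x] = (fun y : 'rV[R]_n => enorm (y - x)) @^-1` [set 0]).
  rewrite -[X in measurable X]setTI.
  have : measurable_fun setT (fun y : 'rV[R]_n => enorm (y - x)).
    apply: (measurableT_comp (@measurable_enorm R n)); apply: measurable_rV => i.
    under eq_fun do rewrite !mxE.
    by apply: measurable_funB => //; exact: measurable_coord.
  by apply.
apply/seteqP; split=> y /= => [->|/eqP]; first by apply/eqP; rewrite enorm_eq0 subrr.
by rewrite enorm_eq0 subr_eq0 => /eqP.
Qed.

Lemma lebesgue_rV_set1 n (x : 'rV[R]_n) : (0 < n)%N -> mu n [set x] = 0%E.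
Proof.
move=> n0; apply: (lebesgue_rV_null_slices (i := Ordinal n0)) => [|y];
    first exact: measurable_rV_set1.
apply: countable_lebesgue_measure0; apply: (@sub_countable _ _ _ [set (x - y) ord0 (Ordinal n0)]).
  apply: subset_card_le => s /= <-.
  by rewrite !mxE !eqxx/= mulr1 addrAC subrr add0r.
exact: countable1.
Qed.

Section polar_formula.
Context (n : nat) (F : 'rV[R]_n -> R).
Hypotheses (n0 : (0 < n)%N) (mF : measurable_fun setT F) (F0 : forall x, 0 <= F x).

Let N : R := n%:R.
Let w (x : 'rV[R]_n) : R := N * \1_(@punctured_ball R n) x.
Let pos (r : R) : R := \1_(`]0, +oo[%classic : set R) r.
Let g (u : 'rV[R]_n) := (\int[leb]_r (pos r * (F (r *: u) * r `^ (N - 1)))%:E)%E.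
(** The integrand of the spherical side after [r = q |x|]; [k2] arises from it by [y = q x],
    including the Jacobian [q^(-n)]. Indicators in place of restricted domains keep all integrals
    over whole spaces, ready for Tonelli. *)
Let k (x : 'rV[R]_n) (q : R) : R :=
  pos q * (F (q *: x) * (q `^ (N - 1) * (enorm x `^ N * w x))).
Let k2 (y : 'rV[R]_n) (q : R) : R :=
  pos q * (F y * (q `^ (- N - 1) * (enorm y `^ N *
    (N * (\1_([set z | 0 < z] : set R) (enorm y) * \1_([set z | 0 <= z] : set R) (q - enorm y)))))).

Let N0 : 0 < N. Proof. by rewrite ltr0n. Qed.

Let w0 x : 0 <= w x. Proof. by rewrite mulr_ge0. Qed.

Let k_ge0 x q : 0 <= k x q.
Proof. by rewrite !mulr_ge0 ?powR_ge0. Qed.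

Let k2_ge0 x q : 0 <= k2 x q.
Proof. by rewrite !mulr_ge0 ?powR_ge0. Qed.

Let mpos : measurable_fun [set: measurableTypeR R] pos.
Proof. by apply: measurable_indic. Qed.

Let mZ : measurable_fun [set: 'rV[R]_n * measurableTypeR R] (fun p => p.2 *: p.1).
Proof.
apply: measurable_rV => i; under eq_fun do rewrite mxE.
apply: measurable_funM; first exact: measurable_snd.
exact: (measurableT_comp (measurable_coord i) measurable_fst).
Qed.

Let menorm1 : measurable_fun [set: 'rV[R]_n * measurableTypeR R] (fun p => enorm p.1).
Proof. exact: (measurableT_comp (@measurable_enorm R n) measurable_fst). Qed.

Let mpow (a : R) : measurable_fun [set: 'rV[R]_n * measurableTypeR R] (fun p => p.2 `^ a).
Proof. exact: (measurableT_comp (measurable_powR a) measurable_snd). Qed.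

Let mpos2 : measurable_fun [set: 'rV[R]_n * measurableTypeR R] (fun p => pos p.2).
Proof. exact: (measurableT_comp mpos measurable_snd). Qed.

Let mFZ : measurable_fun [set: 'rV[R]_n * measurableTypeR R] (fun p => F (p.2 *: p.1)).
Proof. exact: (measurableT_comp mF mZ). Qed.

Let mw : measurable_fun setT w.
Proof.
apply: measurable_funM => //.
by apply: measurable_indic; exact: measurable_punctured_ball.
Qed.

Let mk : measurable_fun [set: 'rV[R]_n * measurableTypeR R] (fun p => (k p.1 p.2)%:E).
Proof.
apply/measurable_EFinP; apply: measurable_funM => //; apply: measurable_funM => //.
apply: measurable_funM => //; apply: measurable_funM.
  exact: (measurableT_comp (measurable_powR N) menorm1).
exact: (measurableT_comp mw measurable_fst).
Qed.

Let mk2 : measurable_fun [set: 'rV[R]_n * measurableTypeR R] (fun p => (k2 p.1 p.2)%:E).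
Proof.
apply/measurable_EFinP; apply: measurable_funM => //; apply: measurable_funM => //.
  exact: (measurableT_comp mF measurable_fst).
apply: measurable_funM => //; apply: measurable_funM.
  exact: (measurableT_comp (measurable_powR N) menorm1).
apply: measurable_funM => //; apply: measurable_funM.
  apply: (measurableT_comp _ menorm1); apply: measurable_indic.
  by rewrite -set_itv_o_infty.
have ms : measurable_fun [set: 'rV[R]_n * measurableTypeR R] (fun p => p.2 - enorm p.1).
  by apply: measurable_funB => //; exact: measurable_snd.
apply: (measurableT_comp _ ms); apply: measurable_indic.
by rewrite -set_itv_c_infty.
Qed.

Let mgk : measurable_fun [set: 'rV[R]_n * measurableTypeR R]
  (fun p => (pos p.2 * (F (p.2 *: p.1) * p.2 `^ (N - 1)))%:E).
Proof. by apply/measurable_EFinP; apply: measurable_funM => //; exact: measurable_funM. Qed.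

Let mg : measurable_fun setT g.
Proof.
apply: (measurable_fun_fubini_tonelli_F _ mgk) => p.
by rewrite lee_fin !mulr_ge0 ?powR_ge0.
Qed.

Let posE q : 0 < q -> pos q = 1.
Proof. by move=> q0; rewrite /pos indicE mem_set//= in_itv/= q0. Qed.

Let posN q : q <= 0 -> pos q = 0.
Proof. by move=> q0; rewrite /pos indicE memNset//= in_itv/= andbT; apply/negP; rewrite -leNgt. Qed.

Let gk x : (g (sgn x) * (w x)%:E = \int[leb]_q (k x q)%:E)%E.
Proof.
have [xB|xB] := pselect (punctured_ball x); last first.
  have wx : w x = 0 by rewrite /w indicE memNset// mulr0.
  rewrite wx mule0 integral0_eq// => q _.
  by rewrite /k wx !mulr0.
have a0 : 0 < enorm x by case/andP: xB.
have mgx y : measurable_fun [set: R] (fun r => (pos r * (F (r *: y) * r `^ (N - 1)))%:E).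
  exact: (measurableT_comp mgk (measurable_pair1 y)).
have gx0 y r : (0 <= (pos r * (F (r *: y) * r `^ (N - 1)))%:E)%E.
  by rewrite lee_fin !mulr_ge0 ?powR_ge0.
have /(congr1 (fun z => (enorm x)%:E * z)%E) := ge0_integral_leb_affine 0 a0 (mgx (sgn x))
    (gx0 (sgn x)).
rewrite muleA -EFinM mulfV ?gt_eqF// mul1e -/(g (sgn x)) => <-.
rewrite muleAC -EFinM -ge0_integralZl//; last 2 first.
- have := mgx (sgn x) => h.
  apply: (measurableT_comp h).
  have : measurable_fun [set: R] (fun q : R => enorm x * q + 0).
    by apply: measurable_funD => //; apply: measurable_funM.
  exact.
- by rewrite lee_fin mulr_ge0// ltW.
apply: eq_integral => q _; rewrite -EFinM; congr EFin.
rewrite addr0 /k.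
have [q0|q0] := leP q 0; first by rewrite !posN// ?mul0r ?mulr0// pmulr_rle0.
rewrite !posE ?mulr_gt0// !mul1r (mulrC (enorm x) q) -scalerA -sgnE.
rewrite powRM ?ltW// -(mulr_powRB1 (ltW a0) N0); ring.
Qed.

Let kk2 q : (\int[mu n]_x (k x q)%:E = \int[mu n]_y (k2 y q)%:E)%E.
Proof.
have [q0|q0] := leP q 0.
  by apply: eq_integral => x _; rewrite /k /k2 posN// !mul0r.
have mkq : measurable_fun setT (fun x : 'rV[R]_n => (k (q^-1 *: x) q)%:E).
  apply: (measurableT_comp (measurableT_comp mk (measurable_pair2 q))).
  exact: measurable_scalel.
have k0q x : (0 <= (k (q^-1 *: x) q)%:E)%E by rewrite lee_fin.
have := ge0_integral_rV_scale q0 mkq k0q.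
under eq_integral do rewrite scalerA mulVf ?gt_eqF// scale1r.
move=> ->; rewrite -ge0_integralZl//; last by rewrite lee_fin invr_ge0 exprn_ge0// ltW.
apply: eq_integral => y _; rewrite -EFinM; congr EFin.
rewrite /k /k2 posE// !mul1r scalerA mulfV ?gt_eqF// scale1r enormZ.
rewrite gtr0_norm ?invr_gt0// powRM ?invr_ge0 ?enorm_ge0 ?ltW//.
have -> : w (q^-1 *: y) = N * (\1_([set z | 0 < z] : set R) (enorm y)
    * \1_([set z | 0 <= z] : set R) (q - enorm y)).
  rewrite /w; congr (_ * _); rewrite !indicE -natrM mulnb; congr (nat_of_bool _)%:R.
  apply/idP/idP => [/set_mem|/andP[/set_mem/= y0 /set_mem/=]].
    rewrite /punctured_ball/= enormZ gtr0_norm ?invr_gt0// pmulr_rgt0 ?invr_gt0//.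
    rewrite mulrC ler_pdivrMr// mul1r => /andP[y0 yq].
    by apply/andP; split; apply/mem_set => //=; rewrite subr_ge0.
  rewrite subr_ge0 => yq; apply/mem_set; rewrite /punctured_ball/=.
  rewrite enormZ gtr0_norm ?invr_gt0// pmulr_rgt0 ?invr_gt0// y0.
  by rewrite mulrC ler_pdivrMr// mul1r.
have -> : q `^ (- N - 1) = q ^- n * (q `^ (N - 1) * q^-1 `^ N).
  rewrite -powR_mulrn ?ltW// -powRN -(powR_inv1 (ltW q0)) -powRrM.
  have qn0 : q != 0 by rewrite gt_eqF.
  rewrite -!powRD ?qn0 ?implybT//; congr (_ `^ _); rewrite -/N; ring.
ring.
Qed.

Let k2F y : (\int[leb]_q (k2 y q)%:E = (F y * \1_(~` [set 0]) y)%:E)%E.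
Proof.
have [->|y0] := eqVneq y 0.
  rewrite [in RHS]indicE memNset/=; last by move=> h; exact: h.
  rewrite mulr0 integral0_eq// => q _; rewrite /k2.
  have -> : enorm (0 : 'rV[R]_n) = 0 by apply/eqP; rewrite enorm_eq0.
  by rewrite powR0 ?gt_eqF// !(mul0r,mulr0).
have a0 : 0 < enorm y by rewrite enorm_gt0.
rewrite [in RHS]indicE mem_set/= ?mulr1; last exact/eqP.
transitivity ((F y * (enorm y `^ N * N))%:E *
   \int[leb]_(q in `[enorm y, +oo[) (q `^ (- N - 1))%:E)%E; last first.
  rewrite integral_powR_cy// -EFinM; congr EFin.
  by rewrite powRN; field; rewrite !gt_eqF// powR_gt0.
have mp : measurable_fun [set: R] (EFin \o (@powR R ^~ (- N - 1))).
  by apply/measurable_EFinP; exact: measurable_powR.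
rewrite -ge0_integralZl//=; last 3 first.
- exact: measurable_funTS.
- by move=> q _; rewrite lee_fin powR_ge0.
- by rewrite lee_fin !mulr_ge0// ?powR_ge0.
rewrite [RHS]integral_mkcond; apply: eq_integral => q _.
rewrite patchE mem_setE in_itv/= andbT /k2.
have -> : \1_([set z | 0 < z] : set R) (enorm y) = 1 :> R by rewrite indicE mem_set.
rewrite mul1r.
case: leP => [yq|yq].
  rewrite posE ?(lt_le_trans a0)// indicE mem_set/= ?subr_ge0//.
  rewrite -EFinM; congr EFin; ring.
rewrite indicE memNset/= ?(mulr0,mul0r)//.
by apply/negP; rewrite -ltNge subr_lt0.
Qed.

(** As [sphere_measure] is a cone measure, the right-hand side is an integral over [x] in the
    punctured unit ball and [r > 0]. The substitutions [r = q |x|] and [y = q x] turn it into the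
    integral of [F y] times [n |y|^n] times the integral of [q^(-n-1)] over [q >= |y|], and that
    factor is 1. *)
Lemma polar :
  (\int[mu n]_x (F x)%:E = \int[sigma n]_(u in sphere)
     \int[leb]_(r in `]0%R, +oo[) (F (r *: u) * r `^ (n%:R - 1))%:E)%E.
Proof.
transitivity (\int[sigma n]_(u in sphere) g u)%E; last first.
  apply: eq_integral => u _; rewrite [RHS]integral_mkcond; apply: eq_integral => r _.
  by rewrite patchE /pos indicE; case: ifP => _; rewrite ?mul0r ?mul1r.
rewrite integral_sphere; last 2 first.
- exact: measurable_sphere.
- exact: measurable_funTS.
rewrite [RHS]integral_mkcond.
transitivity (\int[mu n]_x \int[leb]_q (k x q)%:E)%E; last first.
  apply: eq_integral => x _; rewrite patchE; case: ifPn => [_|xS]; first by rewrite -gk.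
  rewrite -gk /w indicE memNset ?mulr0 ?mule0// => /andP[x0 _].
  move: xS; rewrite notin_setE; apply; apply: sphere_sgn.
  by rewrite -enorm_gt0.
have p0 p : (0 <= (k p.1 p.2)%:E)%E by rewrite lee_fin.
have p20 p : (0 <= (k2 p.1 p.2)%:E)%E by rewrite lee_fin.
apply: (etrans _ (esym (@fubini_tonelli _ _ _ _ R (mu n) leb _ mk p0))) => /=.
under [RHS]eq_integral do rewrite kk2.
apply: (etrans _ (@fubini_tonelli _ _ _ _ R (mu n) leb _ mk2 p20)) => /=.
under [RHS]eq_integral do rewrite k2F.
have m0 : measurable (~` [set (0 : 'rV[R]_n)]).
  rewrite (_ : ~` _ = (@enorm R n) @^-1` `]0, +oo[).
    by rewrite -[X in measurable X]setTI; apply: measurable_enorm.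
  by apply/seteqP; split=> x /=; rewrite in_itv/= andbT enorm_gt0 => /eqP.
(* The integrands differ at most at the origin, a null set because [0 < n]. *)
apply: ge0_ae_eq_integral => //.
- exact/measurable_EFinP.
- apply/measurable_EFinP; apply: measurable_funM => //; exact: measurable_indic.
- by move=> x _; rewrite lee_fin.
- by move=> x _; rewrite lee_fin mulr_ge0.
exists [set 0]; split => //.
- by rewrite -(setCK [set _]); exact: measurableC.
- exact: lebesgue_rV_set1.
- move=> x /=; apply: contra_notP => x0 _; congr EFin.
  by rewrite indicE mem_set ?mulr1.
Qed.

End polar_formula.
End polar.

(** * Negative powers of linear forms *)

Section cube.
Context (R : realType).
Local Notation leb := (@lebesgue_measure R).
Local Notation mu n := (lebesgue_rV R n).
Local Notation I11 := (`[(-1)%R, 1%R]%classic : set R).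

(** Contains the unit ball and, being a product, lets integrals over it be estimated coordinate by
    coordinate. *)
Definition cube n : set 'rV[R]_n := [set x | forall i, `|x ord0 i| <= 1].

Lemma cube_cons n s (y : 'rV[R]_n) :
  \1_(@cube n.+1) (cons_rV s y) = \1_I11 s * \1_(@cube n) y :> R.
Proof.
rewrite !indicE -natrM mulnb; congr (nat_of_bool _)%:R.
apply/idP/idP => [/set_mem c|/andP[/set_mem/= s1 /set_mem/= y1]].
  apply/andP; split; apply/mem_set => /=.
    by have := c ord0; rewrite cons_rV0 ler_norml in_itv.
  by move=> i; have := c (lift ord0 i); rewrite cons_rVS.
apply/mem_set => i; case: (unliftP ord0 i) => [j ->|->].
  by rewrite cons_rVS; exact: y1.
by rewrite cons_rV0 ler_norml; move: s1; rewrite in_itv.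
Qed.

Lemma measurable_cube n : measurable (@cube n).
Proof.
rewrite (_ : cube (n:=n) = \bigcap_(i : 'I_n) ((fun x : 'rV[R]_n => x ord0 i) @^-1` I11)).
  apply: fin_bigcap_measurable => // i _.
  by rewrite -[X in measurable X]setTI; apply: measurable_coord.
apply/seteqP; split=> x /= h i; first by move=> _; rewrite /= in_itv/= -ler_norml.
by have := h i Logic.I; rewrite /= in_itv/= -ler_norml.
Qed.

Let mcube n : measurable_fun setT (fun x => (\1_(@cube n) x)%:E : \bar R).
Proof. by apply/measurable_EFinP; apply: measurable_indic; exact: measurable_cube. Qed.

Let mI11 : measurable_fun [set: measurableTypeR R] (fun s => (\1_I11 s)%:E : \bar R).
Proof. by apply/measurable_EFinP; exact: measurable_indic. Qed.

Let leb_I11 : (\int[leb]_s (\1_I11 s)%:E = 2%:E)%E.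
Proof.
transitivity (leb I11); first by rewrite integral_indic// setIT.
rewrite lebesgue_measure_itv/= lte_fin ifT; last by lra.
by rewrite -EFinD; congr EFin; ring.
Qed.

Lemma lebesgue_rV_cube n : mu n (@cube n) = (2 ^+ n)%:E.
Proof.
rewrite -[@cube n]setIT -integral_indic//; last exact: measurable_cube.
elim: n => [|n IH].
  rewrite integral_dirac// diracE mem_set// mul1e indicE mem_set//.
  by case.
rewrite (ge0_integral_rVS (@mcube n.+1)); last by move=> x; rewrite lee_fin.
transitivity (\int[leb]_s ((2 ^+ n)%:E * (\1_I11 s)%:E))%E.
  apply: eq_integral => s _; rewrite -IH muleC -ge0_integralZl//.
  by apply: eq_integral => y _; rewrite cube_cons EFinM.
rewrite ge0_integralZl ?lee_fin ?exprn_ge0//.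
by rewrite leb_I11 -EFinM -exprSr.
Qed.

Section negative_power.
Context (q : R).
Hypotheses (q1 : -1 < q) (q0 : q < 0).

Let k (s : R) := (\1_(`]0%R, 1%R]%classic : set R) s * s `^ q)%:E.

Let mk : measurable_fun [set: R] k.
Proof.
apply/measurable_EFinP; apply: measurable_funM; last exact: measurable_powR.
exact: measurable_indic.
Qed.

Let k0 s : (0 <= k s)%E.
Proof. by rewrite lee_fin mulr_ge0// powR_ge0. Qed.

Let intk : (\int[leb]_s k s = ((q + 1)^-1)%:E)%E.
Proof.
have := integral_powR_oc q1 (@ler01 R); rewrite powR1 div1r => <-.
rewrite [RHS]integral_mkcond; apply: eq_integral => s _.
by rewrite /k patchE indicE; case: ifP; rewrite ?mul1r ?mul0r.
Qed.

Let intkN : (\int[leb]_s k (- s)%R <= ((q + 1)^-1)%:E)%E.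
Proof.
have -> : (\int[leb]_s k (- s)%R = \int[leb]_(s in `]-oo, 0%R]) k (- s)%R)%E.
  rewrite [RHS]integral_mkcond; apply: eq_integral => s _.
  rewrite patchE mem_setE in_itv/=; case: leP => // s0.
  rewrite /k indicE memNset/= ?mul0r// in_itv/= oppr_gt0.
  by move/andP => [/lt_trans/(_ s0)]; rewrite ltxx.
rewrite -ge0_integration_by_substitution0// -intk.
by apply: ge0_subset_integral => //; exact: measurable_funTS.
Qed.

(** What matters is uniformity in [b]. With [z = s + b / a], the power [|z|^q] is at most 1 plus its
    restrictions to [0 < z <= 1] and [0 < - z <= 1], because [q < 0]. The constant adds the length 2
    of [[-1, 1]] and [1 / (q + 1)] for each side of the singularity. *)
Lemma integral_affine_powR : exists2 C : R, 0 <= C & forall a b : R, a != 0 ->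
  (\int[leb]_s (\1_I11 s * `|s * a + b| `^ q)%:E <= (C * `|a| `^ q)%:E)%E.
Proof.
have q10 : 0 < q + 1 by rewrite -ltrBlDr sub0r.
exists (2 + (q + 1)^-1 + (q + 1)^-1) => [|a b a0].
  by rewrite !addr_ge0// invr_ge0 ltW.
have na0 : 0 < `|a| by rewrite normr_gt0.
have ms : measurable_fun [set: R] (fun s : R => 1 * s + b / a).
  by apply: measurable_funD => //; apply: measurable_funM.
have msN : measurable_fun [set: R] (fun s : R => k (- s)).
  have mN : measurable_fun [set: R] (fun s : R => - s) by exact: measurableT_comp.
  exact: (measurableT_comp mk mN).
have m1 : measurable_fun [set: R] (fun s : R => k (1 * s + b / a)).
  exact: (measurableT_comp mk ms).
have m2 : measurable_fun [set: R] (fun s : R => k (- (1 * s + b / a))).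
  exact: (measurableT_comp msN ms).
have le_pt s : ((\1_I11 s * `|s * a + b| `^ q)%:E <= (`|a| `^ q)%:E *
   ((\1_I11 s)%:E + k (1 * s + b / a)%R + k (- (1 * s + b / a))%R))%E.
  have -> : s * a + b = a * (1 * s + b / a) by field.
  set z := 1 * s + b / a; rewrite normrM powRM// /k -!EFinD -EFinM lee_fin.
  rewrite mulrCA ler_wpM2l ?powR_ge0//.
  have z1 : `|z| `^ q <= 1 + \1_(`]0%R, 1%R]%classic : set R) z * z `^ q +
      \1_(`]0%R, 1%R]%classic : set R) (- z) * (- z) `^ q.
    have [z1|z1] := leP 1 `|z|.
      apply: (@le_trans _ _ 1); last by rewrite -addrA lerDl addr_ge0// mulr_ge0// powR_ge0.
      by rewrite -(powRr0 `|z|) ler_powR// ltW.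
    have [zp|zn|<-] := ltgtP 0 z.
    - rewrite [X in 1 + X * _]indicE mem_set/= ?in_itv/= ?zp/= ?mul1r; last first.
        by rewrite (le_trans (ler_norm _))// ltW.
      by rewrite gtr0_norm// (addrC 1) -addrA lerDl addr_ge0// mulr_ge0// powR_ge0.
    - rewrite [X in _ + X * (- z) `^ q]indicE mem_set/= ?in_itv/= ?oppr_gt0 ?zn/= ?mul1r;
        last first.
        by rewrite -ltr0_norm// ltW.
      by rewrite ltr0_norm// addrC lerDl addr_ge0// mulr_ge0// powR_ge0.
    - by rewrite normr0 powR0 ?lt_eqF// !addr_ge0// mulr_ge0// powR_ge0.
  have [sI|sI] := boolP (s \in I11).
    have -> : \1_I11 s = 1 :> R by rewrite indicE sI.
    by rewrite mul1r; exact: z1.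
  have -> : \1_I11 s = 0 :> R by rewrite indicE (negbTE sI).
  rewrite mul0r add0r.
  by rewrite addr_ge0// mulr_ge0// powR_ge0.
apply: (@le_trans _ _ (\int[leb]_s ((`|a| `^ q)%:E *
   ((\1_I11 s)%:E + k (1 * s + b / a)%R + k (- (1 * s + b / a))%R)))%E).
  apply: ge0_le_integral => //.
  - apply/measurable_EFinP; apply: measurable_funM; first exact: measurable_indic.
    apply: (measurableT_comp (measurable_powR q)); apply: measurableT_comp => //.
    by apply: measurable_funD => //; apply: measurable_funM.
  - apply: measurable_funeM; apply: emeasurable_funD => //.
    exact: emeasurable_funD.
have mS : measurable_fun [set: R] (fun s =>
    (\1_I11 s)%:E + k (1 * s + b / a)%R + k (- (1 * s + b / a))%R)%E.
  by apply: emeasurable_funD => //; exact: emeasurable_funD.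
rewrite ge0_integralZl ?lee_fin ?powR_ge0//.
rewrite EFinM [leRHS]muleC; apply: lee_wpmul2l; first by rewrite lee_fin powR_ge0.
have mS' : measurable_fun [set: R] (fun s => (\1_I11 s)%:E + k (1 * s + b / a)%R)%E.
  exact: emeasurable_funD.
rewrite ge0_integralD//.
rewrite ge0_integralD// leb_I11 !EFinD.
rewrite (ge0_integral_leb_affine (b / a) (@ltr01 R) mk k0).
rewrite (@ge0_integral_leb_affine R 1 (b / a) (fun s => k (- s)) (@ltr01 R) msN (fun s => k0 _)).
by rewrite invr1 !mul1e; apply: leeD => //; rewrite intk.
- by move=> s _; rewrite adde_ge0// lee_fin.
- by move=> s _; rewrite !adde_ge0// lee_fin.
Qed.

Let dot_cons n s (y : 'rV[R]_n) (u : 'rV[R]_n.+1) :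
  dot (cons_rV s y) u = s * u ord0 ord0 + dot y (\row_j u ord0 (lift ord0 j)).
Proof.
rewrite /dot big_ord_recl cons_rV0; congr (_ + _); apply: eq_bigr => i _.
by rewrite cons_rVS mxE.
Qed.

(** The one-dimensional bound is spent on coordinate [i], and every other coordinate costs a factor
    2, the edge length. The shift [c] absorbs coordinates already fixed. The constant for [n.+1] is
    the sum of those for the two cases, [i] in the tail or [i] first. *)
Lemma integral_cube_powR n : exists2 C : R, 0 <= C &
  forall (u : 'rV[R]_n) (c : R) i, u ord0 i != 0 ->
  (\int[mu n]_x (\1_(@cube n) x * `|dot x u + c| `^ q)%:E <=
   (C * `|u ord0 i| `^ q)%:E)%E.
Proof.
have [C1 C10 C1P] := integral_affine_powR.
have mF m (u : 'rV[R]_m) (c : R) : measurable_fun setT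
    (fun x : 'rV[R]_m => (\1_(@cube m) x * `|dot x u + c| `^ q)%:E).
  apply/measurable_EFinP; apply: measurable_funM.
    by apply: measurable_indic; exact: measurable_cube.
  apply: (measurableT_comp (measurable_powR q)); apply: measurableT_comp => //.
  apply: measurable_funD => //; apply: measurable_sum => i.
  by apply: measurable_funM => //; exact: measurable_coord.
have F0 m (u : 'rV[R]_m) (c : R) x : (0 <= (\1_(@cube m) x * `|dot x u + c| `^ q)%:E)%E.
  by rewrite lee_fin mulr_ge0// powR_ge0.
elim: n => [|n [C C0 IH]]; first by exists 0 => // u c [].
exists (2 * C + 2 ^+ n * C1) => [|u c i].
  by rewrite addr_ge0// mulr_ge0// exprn_ge0.
case: (unliftP ord0 i) => [j ->|->] ui0.
  rewrite ge0_integral_rVS//.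
  apply: (@le_trans _ _ (\int[leb]_s ((C * `|u ord0 (lift ord0 j)| `^ q)%:E * (\1_I11 s)%:E))%E).
    apply: ge0_le_integral => //.
    - by move=> s _; exact: integral_ge0.
    - apply: (measurable_fun_fubini_tonelli_F (fun p => (\1_(@cube n.+1) (cons_rV p.1 p.2)
        * `|dot (cons_rV p.1 p.2) u + c| `^ q)%:E)) => //.
      exact: (measurableT_comp (mF _ _ _) (@measurable_cons_rV R n)).
    - exact: measurable_funeM.
    move=> s _; rewrite muleC.
    have := IH (\row_j u ord0 (lift ord0 j)) (s * u ord0 ord0 + c) j.
    rewrite mxE => /(_ ui0) le_s.
    apply: (@le_trans _ _ ((\1_I11 s)%:E * \int[mu n]_x (\1_(@cube n)
        x * `|dot x (\row_j u ord0 (lift ord0 j)) + (s * u ord0 ord0 + c)| `^ q)%:E)%E).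
      rewrite -ge0_integralZl// ?lee_fin//.
      rewrite le_eqVlt; apply/orP; left; apply/eqP; apply: eq_integral => y _.
      by rewrite cube_cons dot_cons -EFinM mulrA (addrC (s * _)) -addrA.
    by apply: lee_wpmul2l => //; rewrite lee_fin.
  rewrite ge0_integralZl//; last by rewrite lee_fin mulr_ge0// powR_ge0.
  rewrite leb_I11 -EFinM lee_fin mulrDl -mulrA (mulrC _ 2) lerDl.
  by rewrite !mulr_ge0 ?exprn_ge0 ?powR_ge0.
rewrite ge0_integral_rVS_swap//.
apply: (@le_trans _ _ (\int[mu n]_y ((C1 * `|u ord0 ord0| `^ q)%:E * (\1_(@cube n) y)%:E))%E).
  apply: ge0_le_integral => //.
  - by move=> y _; exact: integral_ge0.
  - apply: (@measurable_fun_fubini_tonelli_G _ _ (measurableTypeR R) 'rV[R]_n R leb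
      (fun p => (\1_(@cube n.+1) (cons_rV p.1 p.2) * `|dot (cons_rV p.1 p.2) u + c| `^ q)%:E))
          => //.
    exact: (measurableT_comp (mF _ _ _) (@measurable_cons_rV R n)).
  - exact: measurable_funeM.
  move=> y _; rewrite muleC.
  have le_y := C1P (u ord0 ord0) (dot y (\row_j u ord0 (lift ord0 j)) + c) ui0.
  apply: (@le_trans _ _ ((\1_(@cube n)
      y)%:E * \int[leb]_s (\1_I11 s * `|s * u ord0 ord0 + (dot y (\row_j u ord0 (lift ord0 j))
      + c)| `^ q)%:E)%E).
    rewrite -ge0_integralZl// ?lee_fin//.
    - rewrite le_eqVlt; apply/orP; left; apply/eqP; apply: eq_integral => s _.
      by rewrite cube_cons dot_cons -EFinM mulrCA mulrA addrA.
    - apply/measurable_EFinP; apply: measurable_funM; first exact: measurable_indic.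
      apply: (measurableT_comp (measurable_powR q)); apply: measurableT_comp => //.
      by apply: measurable_funD => //; apply: measurable_funM.
  by apply: lee_wpmul2l => //; rewrite lee_fin.
rewrite ge0_integralZl//; last by rewrite lee_fin mulr_ge0// powR_ge0.
have mc := @measurable_cube n.
rewrite integral_indic// setIT [X in (_ * X)%E](lebesgue_rV_cube n).
rewrite -EFinM lee_fin mulrAC (mulrC C1) mulrDl lerDr.
by rewrite !mulr_ge0 ?exprn_ge0 ?powR_ge0.
Qed.

End negative_power.
End cube.

(** * Homogeneous functions on star-shaped sets *)

Section star_integral.
Context (R : realType) (n : nat).
Local Notation leb := (@lebesgue_measure R).
Local Notation sigma := (@sphere_measure R n).
Local Notation mu := (lebesgue_rV R n).
Implicit Types (u v x y : 'rV[R]_n).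

Lemma ler_coord_enorm x i : `|x ord0 i| <= enorm x.
Proof.
rewrite -sqrtr_sqr ler_sqrt ?dot_ge0// /dot (bigD1 i)//= expr2 lerDl.
by apply: sumr_ge0 => j _; rewrite -expr2 sqr_ge0.
Qed.

Lemma punctured_ball_sub_cube : @punctured_ball R n `<=` @cube R n.
Proof. by move=> x /andP[_ x1] i; rewrite (le_trans (ler_coord_enorm _ _)). Qed.

Lemma sphere_measure_fin : fin_num_fun sigma.
Proof.
move=> A mA; rewrite /sphere_measure ge0_fin_numE; last by rewrite mule_ge0.
rewrite lte_mul_pinfty//; apply: (@le_lt_trans _ _ (mu (@cube R n))); last first.
  by rewrite [X in (X < _)%E](lebesgue_rV_cube R n) ltry.
apply: le_measure.
- rewrite inE (_ : [set x | _] = (@sgn R n @^-1` A) `&` @punctured_ball R n)//.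
  apply: measurableI; last exact: measurable_punctured_ball.
  by rewrite -[X in measurable X]setTI; apply: measurable_sgn.
- by rewrite inE; exact: measurable_cube.
- by move=> x /= [_]; exact: punctured_ball_sub_cube.
Qed.

HB.instance Definition _ := Measure_isFinite.Build _ _ _ sigma sphere_measure_fin.

(** On the ray through [u] the integral is that of [r^(n+s-1)] over []0, rho u]]. Used with powers
    of [|dot u x|] on the unit ball and on the body, and with [G = 1] for the volume of the
    intersection body. *)
Lemma integral_star (A : set 'rV[R]_n) (rho G : 'rV[R]_n -> R) (s : R) :
  (0 < n)%N -> measurable A ->
  (forall u r, sphere u -> 0 < r -> A (r *: u) <-> r <= rho u) ->
  (forall u, 0 <= rho u) -> measurable_fun setT G -> (forall x, 0 <= G x) ->
  (forall r x, 0 < r -> G (r *: x) = r `^ s * G x) -> 0 < n%:R + s ->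
  (\int[mu]_(x in A) (G x)%:E =
   \int[sigma]_(u in sphere) (G u * (rho u `^ (n%:R + s) / (n%:R + s)))%:E)%E.
Proof.
move=> n0 mA Arho rho0 mG G0 Gs ns0.
rewrite integral_mkcond.
transitivity (\int[mu]_x (\1_A x * G x)%:E)%E.
  apply: eq_integral => x _; rewrite patchE indicE.
  by case: ifP => _; rewrite ?mul1r ?mul0r.
rewrite polar//; last 2 first.
- by apply: measurable_funM => //; exact: measurable_indic.
- by move=> x; rewrite mulr_ge0.
apply: eq_integral => u /set_mem Su.
have s1 : -1 < n%:R + s - 1 by rewrite ltrBrDr addNr.
rewrite EFinM -[in RHS](subrK 1 (n%:R + s)) -integral_powR_oc// -ge0_integralZl//; last 3 first.
- apply/measurable_EFinP; apply: measurable_funTS; exact: measurable_powR.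
- by move=> r _; rewrite lee_fin powR_ge0.
- by rewrite lee_fin.
rewrite [LHS]integral_mkcond [RHS]integral_mkcond; congr (integral _ _ _).
apply/funext => r.
rewrite !patchE !mem_setE !in_itv/= andbT; case: ltP => //= r0.
have -> : \1_A (r *: u) = (r <= rho u)%R%:R :> R.
  rewrite indicE; congr (nat_of_bool _)%:R; apply/idP/idP => [/set_mem|] h.
    exact/(Arho u r Su r0).
  by apply/mem_set/(Arho u r Su r0).
case: (r <= rho u); last by rewrite !mul0r.
rewrite mul1r Gs// -EFinM; congr EFin; rewrite [_ * G u]mulrC -mulrA -powRD;
    last by apply/implyP => _; rewrite gt_eqF.
by congr (_ * _ `^ _); ring.
Qed.

Lemma dot_sphere_le u v : sphere u -> sphere v -> `|dot u v| <= n%:R.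
Proof.
move=> u1 v1; rewrite /dot (le_trans (ler_norm_sum _ _ _))//.
rewrite -[X in _ <= X%:R]card_ord -sumr_const ler_sum// => i _.
by rewrite normrM mulr_ile1 ?normr_ge0// (le_trans (ler_coord_enorm _ _))// ?u1 ?v1.
Qed.

(** Otherwise [u_i^2 <= |u_i| < 1/n] for all [i], and the squares sum to less than 1. It makes the
    bound of [integral_cube_powR] uniform over the sphere. *)
Lemma sphere_coord_ge u : sphere u -> exists i, n%:R^-1 <= `|u ord0 i|.
Proof.
move=> u1; apply: contrapT => /forallNP h.
have d1 : dot u u = 1 by rewrite -(sqr_sqrtr (dot_ge0 u)) -/(enorm u) u1 expr1n.
have [n0|n0] := posnP n.
  by move: d1; rewrite /dot big1 => [/eqP|i _]; [rewrite eq_sym oner_eq0|have := ltn_ord i;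
      rewrite [X in (_ < X)%N]n0 ltn0].
have : dot u u < \sum_(i < n) n%:R^-1.
  apply: ltr_sum => [|i _].
    by apply/hasP; exists (Ordinal n0); rewrite ?mem_index_enum.
  have := h i; move/negP; rewrite -ltNge => hi.
  rewrite -expr2 -real_normK ?num_real// expr2 (le_lt_trans _ hi)//.
  by rewrite ler_piMr// (le_trans (ler_coord_enorm _ _))// u1.
by rewrite d1 sumr_const card_ord -[n%:R^-1 *+ n]mulr_natr mulVf ?ltxx// pnatr_eq0 -lt0n.
Qed.

Lemma lebesgue_rV_hyperplane0 u : sphere u -> mu [set x | dot u x = 0] = 0%E.
Proof.
move=> u1; have [i ui] := sphere_coord_ge u1.
have n0 : (0 < n)%N by exact: leq_ltn_trans (ltn_ord i).
have ui0 : u ord0 i != 0 by rewrite -normr_gt0 (lt_le_trans _ ui)// invr_gt0 ltr0n.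
apply: (lebesgue_rV_null_slices (i := i)) => [|x].
  have : measurable_fun setT (dot u).
    apply: measurable_sum => j; apply: measurable_funM => //.
    exact: measurable_coord.
  by move=> /(_ measurableT [set 0] (measurable_set1 _)); rewrite setTI.
apply: countable_lebesgue_measure0.
apply: (@sub_countable _ _ _ [set - dot u x / u ord0 i]); last exact: countable1.
apply: subset_card_le => s /=.
have -> : dot u (x + s *: delta_mx ord0 i) = dot u x + s * u ord0 i.
  rewrite /dot; under eq_bigr do rewrite !mxE mulrDr.
  rewrite big_split/=; congr (_ + _); rewrite (bigD1 i)//= eqxx mulr1 mulrC.
  by rewrite big1 ?addr0// => j ji; rewrite (negbTE ji) !mulr0.
by move/eqP; rewrite addrC addr_eq0 => /eqP <-; rewrite mulfK.
Qed.

Lemma sphere_measure_hyperplane0 u : sphere u -> sigma [set v | dot u v = 0] = 0%E.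
Proof.
move=> u1; rewrite /sphere_measure [X in (_ * X)%E](_ : _ = 0%E) ?mule0//.
apply/eqP; rewrite eq_le measure_ge0 andbT -(lebesgue_rV_hyperplane0 u1).
have mH : measurable [set x | dot u x = 0].
  have : measurable_fun setT (dot u).
    apply: measurable_sum => j; apply: measurable_funM => //.
    exact: measurable_coord.
  by move=> /(_ measurableT [set 0] (measurable_set1 _)); rewrite setTI.
apply: le_measure; rewrite ?inE//.
  rewrite (_ : [set x | _] = (@sgn R n @^-1` [set x | dot u x = 0]) `&` @punctured_ball R n)//.
  apply: measurableI; last exact: measurable_punctured_ball.
  by rewrite -[X in measurable X]setTI; apply: measurable_sgn.
move=> x /= [ux _]; rewrite (sgnE x) dotZr ux mulr0//.
Qed.

(** The cube shrunk by the factor [n] lies in the unit ball, so the ball has volume at least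
    [2^n / n^n]; were the sphere null, the punctured ball would be null too. *)
Lemma sphere_measure_gt0 : (0 < n)%N -> (0 < sigma sphere)%E.
Proof.
move=> n0; rewrite lt0e measure_ge0 andbT; apply/eqP => s0.
have n0R : 0 < n%:R :> R by rewrite ltr0n.
have mB := @measurable_punctured_ball R n.
have muB : mu (@punctured_ball R n) = 0%E.
  move: s0; rewrite /sphere_measure => /eqP; rewrite mule_eq0 eqe gt_eqF//= => /eqP.
  congr (mu _ = _); apply/seteqP; split=> x /= => [[]//|xB]; split=> //.
  by apply: sphere_sgn; rewrite -enorm_gt0; case/andP: xB.
have mc := @measurable_cube R n.
have mI : measurable_fun setT (fun x : 'rV[R]_n => (\1_(@cube R n) x)%:E : \bar R).
  by apply/measurable_EFinP; exact: measurable_indic.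
have := ge0_integral_rV_scale n0R mI (fun x => ler0n _ _).
rewrite [in X in _ = X]integral_indic// setIT [X in (_ * X)%E](lebesgue_rV_cube R n).
have m0 : measurable [set (0 : 'rV[R]_n)] by exact: measurable_rV_set1.
have : (\int[mu]_x (\1_(@cube R n) (n%:R *: x))%:E <=
    \int[mu]_x (\1_(@punctured_ball R n `|` [set 0]) x)%:E)%E.
  apply: ge0_le_integral => //.
  - exact: (measurableT_comp mI (@measurable_scalel R n n%:R)).
  - by apply/measurable_EFinP; apply: measurable_indic; exact: measurableU.
  move=> x _; rewrite lee_fin !indicE ler_nat.
  case: (boolP (_ \in @cube R n)) => // /set_mem cx.
  rewrite mem_set//; have [->|x0] := eqVneq x 0; [by right|left].
  rewrite /punctured_ball/= enorm_gt0 x0/= -sqrtr1 ler_sqrt//.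
  rewrite (@le_trans _ _ (\sum_(i < n) n%:R^-1))//; last first.
    by rewrite sumr_const card_ord -[n%:R^-1 *+ n]mulr_natr mulVf// gt_eqF.
  apply: ler_sum => i _; have := cx i; rewrite mxE normrM gtr0_norm//.
  rewrite mulrC -ler_pdivlMr// div1r => xi.
  rewrite -expr2 -real_normK ?num_real// expr2.
  apply: (le_trans (ler_pM _ _ xi xi)) => //.
  by rewrite ler_piMl ?invf_le1 ?ler1n ?invr_ge0 ?ler0n.
have mU : measurable (@punctured_ball R n `|` [set 0]) by exact: measurableU.
rewrite [leRHS]integral_indic// setIT.
have mU0 : mu (@punctured_ball R n `|` [set 0]) = 0%E.
  apply/eqP; rewrite eq_le measure_ge0 andbT (le_trans (measureU2 _ _ _))//.
  by rewrite [X in (X + _)%E](muB) add0e [X in (X <= _)%E](lebesgue_rV_set1 (0 : 'rV[R]_n) n0).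
rewrite [leRHS]mU0 => h1 h2; move: h1; rewrite h2 -EFinM lee_fin leNgt mulr_gt0//.
  by rewrite invr_gt0 exprn_gt0.
Qed.

End star_integral.

(** * Spherical integrals of powers of [|u.v|], bounded uniformly in [u] *)

Section cosine_bounds.
Context (R : realType) (n : nat).
Local Notation sigma := (@sphere_measure R n).
Local Notation mu := (lebesgue_rV R n).
Implicit Types (u v x y : 'rV[R]_n).
Hypothesis n0 : (0 < n)%N.

Lemma measurable_dot u : measurable_fun setT (dot u).
Proof.
apply: measurable_sum => j; apply: measurable_funM => //.
exact: measurable_coord.
Qed.

Lemma measurable_dot_powR (q : R) u :
  measurable_fun setT (fun v => `|dot u v| `^ q).
Proof.
apply: (measurableT_comp (measurable_powR q)); apply: measurableT_comp => //.
exact: measurable_dot.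
Qed.

Let mdotE (q : R) u : measurable_fun setT (fun v => (`|dot u v| `^ q)%:E : \bar R).
Proof. apply/measurable_EFinP; exact: measurable_dot_powR. Qed.

(** For [q < 0], homogeneity moves the integral to the unit ball, which lies in the cube; there
    [integral_cube_powR] applies with a coordinate of size at least [1/n]. *)
Lemma sphere_measure_dot_powR_le (q : R) : -1 < q -> exists2 C : R, 0 <= C &
  forall u, sphere u -> (\int[sigma]_(v in sphere) (`|dot u v| `^ q)%:E <= C%:E)%E.
Proof.
move=> q1; have mS := @measurable_sphere R n.
have [q0|q0] := leP 0 q.
  exists (n%:R `^ q * fine (sigma sphere)) => [|u u1].
    by rewrite mulr_ge0 ?powR_ge0// fine_ge0.
  apply: (@le_trans _ _ (\int[sigma]_(v in sphere) (n%:R `^ q)%:E)%E).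
    apply: ge0_le_integral => //.
    - exact/measurable_funTS.
    - move=> v v1; rewrite lee_fin ge0_ler_powR ?nnegrE ?normr_ge0 ?ler0n//.
      exact: dot_sphere_le.
  by rewrite integral_cst// EFinM fineK// fin_num_measure.
have [C C0 CP] := integral_cube_powR q1 q0 n.
have nq0 : 0 < n%:R + q.
  have : 1 <= n%:R :> R by rewrite ler1n.
  by lra.
exists ((n%:R + q) * (C * n%:R^-1 `^ q)) => [|u u1].
  by rewrite mulr_ge0 ?(ltW nq0)// mulr_ge0 ?powR_ge0.
pose A : set 'rV[R]_n := [set x | enorm x <= 1].
have mA : measurable A.
  rewrite (_ : A = @enorm R n @^-1` `]-oo, 1]%classic); last first.
    by apply/seteqP; split => x /=; rewrite in_itv.
  by rewrite -[X in measurable X]setTI; apply: measurable_enorm.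
have := @integral_star R n A (cst 1) (fun x => `|dot u x| `^ q) q n0 mA.
rewrite /cst powR1 div1r => starE.
have {}starE : (\int[mu]_(x in A) (`|dot u x| `^ q)%:E =
    ((n%:R + q)^-1)%:E * \int[sigma]_(v in sphere) (`|dot u v| `^ q)%:E)%E.
  rewrite starE//.
  - rewrite -ge0_integralZl//.
    + by apply: eq_integral => v _; rewrite -EFinM mulrC.
    + exact/measurable_funTS.
    + by rewrite lee_fin invr_ge0 ltW.
  - move=> v r v1 r0; rewrite /A/= enormZ v1 mulr1 gtr0_norm//.
  - exact: measurable_dot_powR.
  - by move=> r x r0; rewrite dotZr normrM powRM// gtr0_norm.
have := CP u 0.
have [i ui] := sphere_coord_ge u1.
have ui0 : 0 < `|u ord0 i| by rewrite (lt_le_trans _ ui)// invr_gt0 ltr0n.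
rewrite normr_gt0 in ui0.
move=> /(_ i ui0) le1.
have le2 : (\int[mu]_(x in A) (`|dot u x| `^ q)%:E <= (C * n%:R^-1 `^ q)%:E)%E.
  apply: (@le_trans _ _ (C * `|u ord0 i| `^ q)%:E); last first.
    have E (y : R) : y `^ q = (y `^ (- q))^-1 by rewrite powRN invrK.
    rewrite lee_fin ler_wpM2l// (E n%:R^-1) (E `|u ord0 i|).
    rewrite lef_pV2 ?posrE ?powR_gt0 ?invr_gt0 ?ltr0n ?normr_gt0//.
    by apply: ge0_ler_powR; rewrite ?nnegrE ?oppr_ge0 ?invr_ge0 ?ler0n ?normr_ge0 ?(ltW q0).
  apply: le_trans le1; rewrite integral_mkcond; apply: ge0_le_integral => //.
  - by move=> x _; apply: erestrict_ge0 => y _; rewrite lee_fin powR_ge0.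
  - by apply/(measurable_restrictT _ mA); exact/measurable_funTS.
  - apply/measurable_EFinP; apply: measurable_funM.
      by apply: measurable_indic; exact: measurable_cube.
    under eq_fun do rewrite addr0 dotC.
    exact: measurable_dot_powR.
  move=> x _; rewrite patchE addr0 dotC; case: ifPn => [/set_mem xA|_].
    rewrite indicE mem_set ?mul1r// => j.
    exact: le_trans (ler_coord_enorm _ _) xA.
  by rewrite lee_fin mulr_ge0// powR_ge0.
have nqE : (0 <= (n%:R + q)%:E)%E by rewrite lee_fin ltW.
move: le2; rewrite starE => /(lee_wpmul2l nqE).
by rewrite muleA -!EFinM mulfV ?gt_eqF// mul1e.
Qed.

(* Integrate [1 <= e |u.v|^(-1/2) + k |u.v|^q]: small values of [|u.v|] are
   absorbed by the first term, whose integral is bounded uniformly in [u]. *)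
Lemma sphere_measure_dot_powR_ge (q : R) : exists2 c : R, 0 < c &
  forall u, sphere u -> (c%:E <= \int[sigma]_(v in sphere) (`|dot u v| `^ q)%:E)%E.
Proof.
have mS := @measurable_sphere R n.
have h1 : -1 < - 2^-1 :> R by lra.
have [C C0 CP] := sphere_measure_dot_powR_le h1.
have sfin : sigma sphere \is a fin_num by rewrite fin_num_measure.
pose s := fine (sigma sphere); have s0 : 0 < s.
  by rewrite fine_gt0// sphere_measure_gt0// -ge0_fin_numE.
(* This gives [e * C <= s / 2], so the singular term uses at most half of the mass [s]. Then
   [d = e^2] is the threshold below which [e x^(-1/2) >= 1], and of the two summands of [k] the
   first serves [0 <= q] with [x > d], the second [q < 0] with [x <= n]. *)
pose e := s / (2 * (C + 1)).
have C1 : 0 < C + 1 by rewrite ltr_wpDl.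
have e0 : 0 < e by rewrite divr_gt0// mulr_gt0.
pose d := e `^ 2.
have d0 : 0 < d by rewrite powR_gt0.
pose k := d `^ (- q) + n%:R `^ (- q).
have nR : 0 < n%:R :> R by rewrite ltr0n.
have k0 : 0 < k by rewrite addr_gt0// powR_gt0.
have key (x : R) : 0 < x -> x <= n%:R -> 1 <= e * x `^ (- 2^-1) + k * x `^ q.
  move=> x0 xn; have [xd|dx] := leP x d.
    apply: (@le_trans _ _ (e * x `^ (- 2^-1))); last first.
      by rewrite lerDl mulr_ge0 ?powR_ge0// ltW.
    rewrite powRN ler_pdivlMr ?powR_gt0// mul1r.
    have -> : e = d `^ 2^-1 by rewrite /d -powRrM mulfV// powRr1// ltW.
    by apply: ge0_ler_powR; rewrite ?nnegrE ?invr_ge0 ?(ltW x0) ?(ltW d0).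
  apply: (@le_trans _ _ (k * x `^ q)); last first.
    by rewrite lerDr mulr_ge0 ?powR_ge0// ltW.
  rewrite mulrDl; have [q0|q0] := leP 0 q.
    apply: (@le_trans _ _ (d `^ (- q) * x `^ q)); last first.
      by rewrite lerDl mulr_ge0 ?powR_ge0.
    rewrite powRN mulrC ler_pdivlMr ?powR_gt0// mul1r.
    by apply: ge0_ler_powR; rewrite ?nnegrE ?(ltW x0) ?(ltW d0) ?(ltW dx).
  apply: (@le_trans _ _ (n%:R `^ (- q) * x `^ q)); last first.
    by rewrite lerDr mulr_ge0 ?powR_ge0.
  rewrite -[in x `^ q](opprK q) [x `^ _]powRN ler_pdivlMr ?powR_gt0// mul1r.
  by apply: ge0_ler_powR; rewrite ?nnegrE ?oppr_ge0 ?(ltW x0) ?(ltW q0) ?ler0n.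
exists (s / 2 / k) => [|u u1]; first by rewrite !divr_gt0.
have : (\int[sigma]_(v in sphere) (cst 1 v) <=
    \int[sigma]_(v in sphere) (e%:E * (`|dot u v| `^ (- 2^-1))%:E + k%:E * (`|dot u v| `^ q)%:E))%E.
  apply: ae_ge0_le_integral => //.
  - by move=> v _; rewrite adde_ge0// mule_ge0// lee_fin ?powR_ge0// ltW.
  - by apply: measurable_funTS; apply: emeasurable_funD; apply: measurable_funeM.
  (* On this hyperplane the powers take default values, for instance 0 for [0^(-1/2)], so the
     pointwise bound [key] is available only off it. *)
  exists [set v | dot u v = 0]; split.
  - have := @measurable_dot u.
    by move=> /(_ measurableT [set 0] (measurable_set1 _)); rewrite setTI.
  - exact: sphere_measure_hyperplane0.
  move=> v /=; apply: contra_notP => /eqP uv v1; rewrite -!EFinM -EFinD lee_fin key//.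
    by rewrite normr_gt0.
  exact: dot_sphere_le.
have -> : (\int[sigma]_(v in sphere) (cst 1 v) = s%:E)%E.
  by rewrite integral_cst// mul1e; apply/esym/fineK.
rewrite ge0_integralD//; last 4 first.
- by move=> v _; rewrite mule_ge0// lee_fin ?powR_ge0// ltW.
- by apply: measurable_funTS; apply: measurable_funeM.
- by move=> v _; rewrite mule_ge0// lee_fin ?powR_ge0// ltW.
- by apply: measurable_funTS; apply: measurable_funeM.
rewrite !ge0_integralZl//; last 4 first.
- exact: measurable_funTS.
- by rewrite lee_fin ltW.
- exact: measurable_funTS.
- by rewrite lee_fin ltW.
move=> le1; have := CP u u1 => le2.
have [->|] := eqVneq (\int[sigma]_(v in sphere) (`|dot u v| `^ q)%:E)%E +oo%E.
  by rewrite leey.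
rewrite -ltey => Iq; have Iq0 : (0 <= \int[sigma]_(v in sphere) (`|dot u v| `^ q)%:E)%E.
  by apply: integral_ge0 => v _; rewrite lee_fin powR_ge0.
have Iqf : (\int[sigma]_(v in sphere) (`|dot u v| `^ q)%:E \is a fin_num)%E.
  by rewrite ge0_fin_numE.
move: le1; rewrite -(fineK Iqf) -EFinM.
move=> /le_trans/(_ (leeD (lee_wpmul2l _ le2) (lexx _))).
rewrite lee_fin (ltW e0) => /(_ isT); rewrite -EFinM -EFinD !lee_fin => le1.
rewrite ler_pdivrMr//.
have eC : e * C <= s / 2.
  rewrite /e invfM mulrA -[leRHS]mulr1 -[leLHS]mulrA ler_wpM2l ?divr_ge0 ?ltW//.
  by rewrite ltr_pdivrMl// mulr1 ltrDl.
rewrite mulrC; lra.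
Qed.

End cosine_bounds.

(** * Star bodies and Wulff shapes *)

Section euclidean_topology.
Context (R : realType) (n : nat).
Implicit Types (u v x y : 'rV[R]_n) (A K : set 'rV[R]_n).

Lemma dotDl x y v : dot (x + y) v = dot x v + dot y v.
Proof. by rewrite /dot -big_split; apply: eq_bigr => i _; rewrite mxE mulrDl. Qed.

Lemma dot_le x v : `|dot x v| <= n%:R * (enorm x * enorm v).
Proof.
rewrite /dot (le_trans (ler_norm_sum _ _ _))// mulr_natl.
rewrite -[X in _ *+ X]card_ord -sumr_const ler_sum// => i _.
by rewrite normrM ler_pM// ler_coord_enorm.
Qed.

Lemma enorm_le_coord x (M : R) : 0 <= M -> (forall i, `|x ord0 i| <= M) ->
  enorm x <= n%:R * M.
Proof.
move=> M0 xM; rewrite -[leRHS]ger0_norm ?mulr_ge0// -sqrtr_sqr ler_sqrt ?sqr_ge0//.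
apply: (@le_trans _ _ (n%:R * M ^+ 2)).
  rewrite mulr_natl -[X in _ *+ X]card_ord -sumr_const ler_sum// => i _.
  by rewrite -expr2 -real_normK ?num_real// lerXn2r ?nnegrE.
rewrite exprMn ler_wpM2r ?sqr_ge0// expr2 -natrM ler_nat.
by case: (n) => // m; rewrite leq_pmulr.
Qed.

Lemma enormN x : enorm (- x) = enorm x.
Proof. by rewrite -scaleN1r enormZ normrN1 mul1r. Qed.

Lemma ball_coord x y (e : R) : 0 < e -> ball x e y <->
  forall i, `|x ord0 i - y ord0 i| < e.
Proof.
move=> e0; split=> [[_ h] i|h]; first exact: (h ord0 i).
by split=> // i j; rewrite ord1; exact: h.
Qed.

Lemma continuous_sum_rV (g : 'I_n -> 'rV[R]_n -> R) :
  (forall i, continuous (g i)) -> continuous (fun x => \sum_i g i x).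
Proof.
move=> gc; have cs (s : seq 'I_n) : continuous (fun y : 'rV[R]_n => \sum_(i <- s) g i y).
  elim: s => [|i s IH] y.
    rewrite (_ : (fun _ => _) = cst 0); first exact: cst_continuous.
    by apply/funext => z; rewrite big_nil.
  rewrite (_ : (fun _ => _) = g i \+ (fun z : 'rV[R]_n => \sum_(j <- s) g j z)).
    by apply: continuousD; [exact: gc|exact: IH].
  by apply/funext => z; rewrite big_cons.
exact: cs.
Qed.

Lemma continuous_dotl v : continuous (fun x : 'rV[R]_n => dot x v).
Proof.
apply: continuous_sum_rV => i x.
by apply: continuousM; [exact: coord_continuous|exact: cst_continuous].
Qed.

Lemma continuous_enorm : continuous (@enorm R n).
Proof.
move=> x; apply: continuous_comp; last exact: sqrt_continuous.
by apply: continuous_sum_rV => i {}x; apply: continuousM; exact: coord_continuous.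
Qed.

Lemma closed_sphere : closed (@sphere R n).
Proof.
rewrite (_ : sphere = @enorm R n @^-1` [set 1])//.
by apply: closed_comp => [x _|]; [exact: continuous_enorm|exact: closed_eq].
Qed.

Lemma compact_sphere : compact (@sphere R n).
Proof.
apply: bounded_closed_compact; last exact: closed_sphere.
exists 1; split => // M M1 x x1 /=; rewrite -[leLHS]/(mx_norm x) mx_normrE; apply/bigmax_leP.
split=> [|[i j] _ /=]; first by rewrite ltW// (lt_trans ltr01).
by rewrite ord1 (le_trans (ler_coord_enorm x j))// x1 ltW.
Qed.

Lemma compact_enorm_bounded A : compact A ->
  exists2 M : R, 0 < M & forall x, A x -> enorm x <= M.
Proof.
move=> /compact_bounded[M [_ AM]]; pose M' := `|M| + 1.
have M'0 : 0 < M' by rewrite ltr_wpDl.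
exists (n%:R * M' + 1) => [|x Ax]; first by rewrite ltr_wpDl// mulr_ge0// ltW.
have MM' : M < M' by rewrite (le_lt_trans (ler_norm _))// ltrDl.
have := AM M' MM' x Ax => /=; rewrite -[leLHS]/(mx_norm x) mx_normrE => /bigmax_leP[_ xM].
rewrite (le_trans (enorm_le_coord (ltW M'0) _)) ?lerDl// => i.
exact: (xM (ord0, i)).
Qed.

Lemma interior0_ball A : A° 0 -> exists2 r : R, 0 < r & forall x, enorm x <= r -> A x.
Proof.
move=> /nbhs_ballP[e /= e0 eA]; exists (e / 2); first by rewrite divr_gt0.
move=> x xe; apply: eA; apply/ball_coord => // i.
rewrite mxE sub0r normrN (le_lt_trans (ler_coord_enorm _ _))// (le_lt_trans xe)//.
by rewrite ltr_pdivrMr// ltr_pMr// ltr1n.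
Qed.

Lemma closed_measurable_rV A : closed A -> measurable A.
Proof.
move=> cA; rewrite -(setCK A); apply: measurableC.
by apply: open_measurable_rV; exact: closed_openC.
Qed.

End euclidean_topology.

Section star_bodies.
Context (R : realType) (n : nat).
Implicit Types (u v x y : 'rV[R]_n) (A : set 'rV[R]_n).

(** The common ground of [K] and its Wulff shapes: a closed star-shaped set with explicit inner
    radius [r] and outer radius [M]. *)
Record star_body A (r M : R) : Prop := StarBody {
  star_body_closed : closed A;
  star_body_shrink : forall x t, A x -> 0 <= t <= 1 -> A (t *: x);
  star_body_r : 0 < r;
  star_body_ball : forall x, enorm x <= r -> A x;
  star_body_bounded : forall x, A x -> enorm x <= M }.

(** True of every set: the set of admissible [t] is empty or all of [[0, +oo[], and [sup] defaults
    to 0 in both cases. *)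
Lemma radial_fun0 A : radial_fun A 0 = 0.
Proof.
rewrite /radial_fun; have [A0|A0] := pselect (A 0); last first.
  rewrite (_ : [set t | _] = set0) ?sup0// -subset0 => t /= [_].
  by rewrite scaler0.
apply: sup_out; rewrite /has_sup => -[_ [x xub]].
have : `|x| + 1 <= x by apply: xub => /=; rewrite scaler0; split => //; rewrite addr_ge0.
by rewrite leNgt (le_lt_trans (ler_norm _))// ltrDl.
Qed.

Section radial.
Context A (r M : R) (sA : star_body A r M).

Let r0 := star_body_r sA.

Let has_sup_radial x : x != 0 -> has_sup [set t | 0 <= t /\ A (t *: x)].
Proof.
move=> x0; split.
  exists 0 => /=; split=> //; rewrite scale0r; apply: (star_body_ball sA).
  by rewrite (_ : enorm 0 = 0) ?(ltW r0)//; apply/eqP; rewrite enorm_eq0.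
exists (M / enorm x) => t /= [t0 /(star_body_bounded sA)].
by rewrite enormZ ger0_norm// ler_pdivlMr// enorm_gt0.
Qed.

(** Star-shapedness puts all multiples below the supremum in [A], and closedness adds the supremum
    itself. *)
Lemma radial_funP x t : x != 0 -> 0 <= t -> A (t *: x) <-> t <= radial_fun A x.
Proof.
move=> x0 t0; split=> [At|tle].
  by apply: ub_le_sup; [case: (has_sup_radial x0)|].
set s := radial_fun A x in tle.
have lts a : 0 <= a -> a < s -> A (a *: x).
  move=> a0 /(sup_gt (has_sup_radial x0).1) [b /= [b0 Ab] ab].
  have b0' : 0 < b by exact: le_lt_trans ab.
  have bn0 : b != 0 by rewrite gt_eqF.
  rewrite -[a](divfK bn0) -scalerA; apply: (star_body_shrink sA) => //.
  by rewrite divr_ge0//= ler_pdivrMr// mul1r ltW.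
move: tle; rewrite le_eqVlt => /predU1P[->|]; last exact: lts.
have s0 : 0 <= s.
  by apply: ub_le_sup; [case: (has_sup_radial x0)|case: (has_sup_radial x0).1 => z /= [z0 Az];
      split=> //; rewrite scale0r -(scale0r (z *: x)); apply: (star_body_shrink sA) => //;
      rewrite lexx ler01].
move: s0; rewrite le_eqVlt => /predU1P[<-|s0].
  rewrite scale0r; apply: (star_body_ball sA).
  by rewrite (_ : enorm 0 = 0) ?(ltW r0)//; apply/eqP; rewrite enorm_eq0.
apply: contrapT => nA.
have /nbhs_ballP[e /= e0 eA] : nbhs (s *: x) (~` A).
  by apply: open_nbhs_nbhs; split => //; exact: closed_openC (star_body_closed sA).
have nx0 : 0 < enorm x by rewrite enorm_gt0.
(* Stepping back by [d] along the ray stays in [A], as [0 <= s - d < s], yet inside the [e]-ball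
   around [s *: x] that misses [A]. *)
pose d := Num.min s (e / (2 * enorm x)).
have d0 : 0 < d by rewrite lt_min s0 divr_gt0// mulr_gt0.
have ds : d <= s by rewrite ge_min lexx.
apply: (eA ((s - d) *: x)).
  apply/ball_coord => // i; rewrite !mxE -mulrBl subKr normrM gtr0_norm//.
  apply: (@le_lt_trans _ _ (e / (2 * enorm x) * enorm x)).
    by rewrite ler_pM// ?(ltW d0)// ?ler_coord_enorm// ge_min lexx orbT.
  by rewrite invfM mulrA divfK ?gt_eqF// ltr_pdivrMr// ltr_pMr// ltr1n.
by apply: lts; rewrite ?subr_ge0// ltrBlDr ltrDl.
Qed.

Lemma radial_fun_ge0 x : 0 <= radial_fun A x.
Proof.
have [->|x0] := eqVneq x 0; first by rewrite radial_fun0.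
apply/(radial_funP x0 (lexx 0)); rewrite scale0r; apply: (star_body_ball sA).
by rewrite (_ : enorm 0 = 0) ?(ltW r0)//; apply/eqP; rewrite enorm_eq0.
Qed.

Lemma radial_fun_bounds u : sphere u -> r <= radial_fun A u <= M.
Proof.
move=> u1; have u0 := sphere_neq0 u1; apply/andP; split.
  apply/(radial_funP u0 (ltW r0)); apply: (star_body_ball sA).
  by rewrite enormZ u1 mulr1 ger0_norm// ltW.
have /(radial_funP u0 (radial_fun_ge0 u)) := lexx (radial_fun A u).
move=> /(star_body_bounded sA); rewrite enormZ u1 mulr1.
exact: le_trans (ler_norm _).
Qed.

Lemma radial_fun_gt0 x : x != 0 -> 0 < radial_fun A x.
Proof.
move=> x0; have nx0 : 0 < enorm x by rewrite enorm_gt0.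
have rx : 0 < r / enorm x by rewrite divr_gt0.
apply: (lt_le_trans rx); apply/(radial_funP x0 (ltW rx)).
apply: (star_body_ball sA).
by rewrite enormZ gtr0_norm// divfK ?gt_eqF.
Qed.

Lemma radial_funZ a x : 0 < a -> radial_fun A (a *: x) = a^-1 * radial_fun A x.
Proof.
move=> a0; have [->|x0] := eqVneq x 0; first by rewrite scaler0 radial_fun0 mulr0.
have ax0 : a *: x != 0 by rewrite scaler_eq0 negb_or gt_eqF.
have ia0 : 0 <= a^-1 by rewrite invr_ge0 ltW.
apply/eqP; rewrite eq_le; apply/andP; split.
  rewrite mulrC ler_pdivlMr//.
  apply/(radial_funP x0); first by rewrite mulr_ge0 ?radial_fun_ge0// ltW.
  rewrite -scalerA; apply/(radial_funP ax0) => //; exact: radial_fun_ge0.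
apply/(radial_funP ax0); first by rewrite mulr_ge0 ?radial_fun_ge0.
rewrite scalerA mulrAC mulVf ?gt_eqF// mul1r; apply/(radial_funP x0) => //.
exact: radial_fun_ge0.
Qed.

Lemma measurable_radial_fun : measurable_fun setT (radial_fun A).
Proof.
apply: (measurability _ (RGenCInfty.measurableE R)) => //.
move=> _ [_ [c ->] <-]; rewrite setTI.
have [c0|c0] := leP c 0.
  rewrite (_ : _ @^-1` _ = setT)//; apply/seteqP; split => // x _ /=.
  by rewrite in_itv/= andbT (le_trans c0)// radial_fun_ge0.
rewrite (_ : _ @^-1` _ = (fun x => c *: x) @^-1` A `&` ~` [set 0]).
  apply: measurableI; last by apply: measurableC; exact: measurable_rV_set1.
  rewrite -[X in measurable X]setTI; apply: (measurable_scalel c) => //.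
  exact: closed_measurable_rV (star_body_closed sA).
apply/seteqP; split=> x /=; rewrite in_itv/= andbT.
  move=> cx; have x0 : x != 0.
    by apply: contraTneq cx => ->; rewrite radial_fun0 -ltNge.
  by split; [apply/(radial_funP x0 (ltW c0))|exact/eqP].
by move=> [Ax /eqP x0]; apply/(radial_funP x0 (ltW c0)).
Qed.

End radial.
End star_bodies.

Section within_continuity.
Context (R : realType) (n : nat).
Implicit Types (D : set 'rV[R]_n) (f : 'rV[R]_n -> R).

Lemma closed_within_preimage D f (C : set R) : closed D ->
  {within D, continuous f} -> closed C -> closed (D `&` f @^-1` C).
Proof.
move=> cD /continuous_closedP fc cC; have := fc _ cC.
by move=> /closed_subspaceP[V cV VE]; rewrite setIC -VE; exact: closedI.
Qed.

Lemma measurable_fun_within_continuous D f : closed D ->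
  {within D, continuous f} -> measurable_fun D f.
Proof.
move=> cD fc; apply: (measurability _ (RGenCInfty.measurableE R)) => //.
move=> _ [_ [c ->] <-]; apply: closed_measurable_rV.
by apply: closed_within_preimage => //; exact: interval_closed.
Qed.

Lemma within_continuous_bounded D f : compact D -> {within D, continuous f} ->
  exists2 B : R, 0 <= B & forall x, D x -> `|f x| <= B.
Proof.
move=> cD fc; have /compact_bounded[B [_ fB]] := continuous_compact fc cD.
exists (`|B| + 1) => [|x Dx]; first by rewrite addr_ge0.
apply: fB; last by exists x.
by rewrite (le_lt_trans (ler_norm _))// ltrDl.
Qed.

(** The image is closed and misses 0, hence misses a ball around 0. [D] may be empty, as may the set
    of normals to which this is applied. *)
Lemma compact_positive_lower_bound D f : compact D -> continuous f ->
  (forall x, D x -> 0 < f x) -> exists2 e : R, 0 < e & forall x, D x -> e <= f x.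
Proof.
move=> cD fc f0; have fcD : {within D, continuous f} by exact: continuous_subspaceT.
have := continuous_compact fcD cD.
move=> /(compact_closed (@Rhausdorff R)) /closed_openC oC.
have /nbhs_ballP[e /= e0 eC] : nbhs (0 : R) (~` (f @` D)).
  apply: open_nbhs_nbhs; split=> //= -[x Dx fx0].
  by have := f0 x Dx; rewrite fx0 ltxx.
exists e => // x Dx; rewrite leNgt; apply/negP => fe.
apply: (eC (f x)); last by exists x.
by rewrite /ball/= sub0r normrN gtr0_norm// f0.
Qed.

Lemma enorm_lipschitz_continuous f (L : R) : 0 <= L ->
  (forall x y, `|f x - f y| <= L * enorm (x - y)) -> continuous f.
Proof.
move=> L0 fL x A /nbhs_ballP[e /= e0 eA]; apply/nbhs_ballP.
pose S := L * n%:R + 1; have S0 : 0 < S by rewrite ltr_wpDl// mulr_ge0.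
exists (e / S) => /=; first by rewrite divr_gt0.
move=> y /ball_coord xy; apply: eA; rewrite /ball/= (le_lt_trans (fL _ _))//.
have eS : 0 < e / S by rewrite divr_gt0.
apply: (@le_lt_trans _ _ (L * (n%:R * (e / S)))).
  apply: ler_wpM2l => //; apply: enorm_le_coord; first exact: ltW.
  by move=> i; rewrite !mxE ltW// xy.
by rewrite !mulrA ltr_pdivrMr// /S mulrDr mulr1 [ltLHS]mulrC ltrDl.
Qed.

End within_continuity.

(** * Support function and radii of the Wulff shapes *)

Section support_function.
Context (R : realType) (n : nat) (K : set 'rV[R]_n) (r M : R).
Hypothesis sK : star_body K r M.
Implicit Types (u v w x y : 'rV[R]_n).
Local Notation h := (support_fun K).

Let r0 := star_body_r sK.

Lemma star_body0 : K 0.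
Proof.
apply: (star_body_ball sK).
by rewrite (_ : enorm 0 = 0) ?(ltW r0)//; apply/eqP; rewrite enorm_eq0.
Qed.

Lemma star_body_M_ge0 : 0 <= M.
Proof. exact: le_trans (enorm_ge0 _) (star_body_bounded sK star_body0). Qed.

Let dot_bounded x w : K x -> dot x w <= n%:R * (M * enorm w).
Proof.
move=> Kx; rewrite (le_trans (ler_norm _))// (le_trans (dot_le _ _))//.
by rewrite ler_wpM2l// ler_wpM2r ?enorm_ge0// (star_body_bounded sK).
Qed.

Let hs w : has_sup [set dot x w | x in K].
Proof.
split; first by exists (dot 0 w); exists 0 => //; exact: star_body0.
by exists (n%:R * (M * enorm w)) => _ [x Kx <-]; exact: dot_bounded.
Qed.

Lemma dot_le_support x w : K x -> dot x w <= h w.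
Proof. by move=> Kx; apply: ub_le_sup; [case: (hs w)|exists x]. Qed.

Lemma support_le c w : (forall x, K x -> dot x w <= c) -> h w <= c.
Proof. by move=> xc; apply: ge_sup; [case: (hs w)|move=> _ [x Kx <-]; exact: xc]. Qed.

Lemma support_ge w : sphere w -> r <= h w.
Proof.
move=> w1; have d1 : dot w w = 1 by rewrite -(sqr_sqrtr (dot_ge0 w)) -/(enorm w) w1 expr1n.
rewrite -[r]mulr1 -d1 -dotZl; apply: dot_le_support; apply: (star_body_ball sK).
by rewrite enormZ w1 mulr1 ger0_norm// ltW.
Qed.

Lemma support_gt0 w : sphere w -> 0 < h w.
Proof. by move=> w1; exact: lt_le_trans (support_ge w1). Qed.

Lemma support_le_bound w : sphere w -> h w <= n%:R * M.
Proof.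
by move=> w1; apply: support_le => x Kx; rewrite -[M]mulr1 -[X in M * X]w1 dot_bounded.
Qed.

Lemma continuous_support : continuous h.
Proof.
have M0 := star_body_M_ge0.
have hle w w' : h w <= h w' + n%:R * M * enorm (w - w').
  apply: support_le => x Kx.
  have -> : dot x w = dot x w' + dot x (w - w').
    by rewrite dotC (dotC x w') (dotC x (w - w')) -dotDl addrC subrK.
  by rewrite lerD ?dot_le_support// -mulrA dot_bounded.
apply: (@enorm_lipschitz_continuous _ _ _ (n%:R * M)); first by rewrite mulr_ge0.
move=> w w'; rewrite ler_norml lerBlDl hle andbT lerBrDl.
have := hle w' w; rewrite -enormN opprB; lra.
Qed.

Section log_family.
Context (f : 'rV[R]_n -> R) (B : R).
Hypotheses (n0 : (0 < n)%N) (B0 : 0 <= B) (fB : forall u, sphere u -> `|f u| <= B).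

Lemma log_familyP t x : log_family K f t x <->
  forall w, sphere w -> dot x w <= h w * expR (t * f w).
Proof.
by split=> Kx w w1; have := Kx w w1; rewrite expRD lnK// posrE support_gt0.
Qed.

Let expR_tf t w : `|t| <= 1 -> sphere w ->
  expR (- B) <= expR (t * f w) <= expR B.
Proof.
move=> t1 w1; rewrite !ler_expR -ler_norml normrM.
by rewrite -[leRHS]mul1r ler_pM// fB.
Qed.

(** The radii combine [r <= h <= n M] on the sphere with [exp(-B) <= exp(t f) <= exp(B)]; the
    divisor [n] of the inner radius comes from [dot_le]. The outer bound tests [x] against the
    normal [sgn x]. *)
Lemma star_body_log_family t : `|t| <= 1 ->
  star_body (log_family K f t) (r * expR (- B) / n%:R) (n%:R * M * expR B).
Proof.
move=> t1; have nR : 0 < n%:R :> R by rewrite ltr0n.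
have nR0 : n%:R != 0 :> R by rewrite gt_eqF.
split.
- rewrite (_ : log_family K f t = \bigcap_(w in sphere)
      ((fun x => dot x w) @^-1` `]-oo, (h w * expR (t * f w))])).
    apply: closed_bigI => w w1; apply: closed_comp.
      by move=> x _; exact: continuous_dotl.
    exact: interval_closed.
  by apply/seteqP; split=> x /=; rewrite log_familyP => xw w w1;
    have := xw w w1; rewrite /= in_itv.
- move=> x s /log_familyP Kx /andP[s0 s1]; apply/log_familyP => w w1.
  rewrite dotZl; have hw : 0 <= h w * expR (t * f w).
    by rewrite mulr_ge0 ?expR_ge0// ltW// support_gt0.
  have [xw|xw] := leP 0 (dot x w).
    by rewrite (le_trans _ (Kx w w1))// ler_piMl.
  by rewrite (le_trans _ hw)// mulr_ge0_le0// ltW.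
- by rewrite divr_gt0// mulr_gt0// expR_gt0.
- move=> x xr; apply/log_familyP => w w1.
  rewrite (le_trans (ler_norm _))// (le_trans (dot_le _ _))// w1 mulr1.
  apply: (@le_trans _ _ (r * expR (- B))).
    by rewrite -[leRHS](divfK nR0) mulrC ler_wpM2r.
  rewrite ler_pM ?expR_ge0 ?(ltW r0)//; first exact: support_ge.
  by case/andP: (expR_tf t1 w1).
- move=> x /log_familyP Kx; have [->|x0] := eqVneq x 0.
    rewrite (_ : enorm 0 = 0) ?mulr_ge0 ?star_body_M_ge0 ?expR_ge0//.
    by apply/eqP; rewrite enorm_eq0.
  have w1 := sphere_sgn x0; have := Kx _ w1.
  rewrite {1}(sgnE x) dotZl.
  have -> : dot (sgn x) (sgn x) = 1.
    by rewrite -(sqr_sqrtr (dot_ge0 (sgn x))) -/(enorm (sgn x)) w1 expr1n.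
  rewrite mulr1 => /le_trans; apply.
  rewrite ler_pM ?expR_ge0 ?(ltW (support_gt0 _))//; first exact: support_le_bound.
  by case/andP: (expR_tf t1 w1).
Qed.

End log_family.
End support_function.

Lemma convex_body_star_body (R : realType) n (K : set 'rV[R]_n) :
  convex_body_o K -> exists r M, star_body K r M.
Proof.
move=> [[cK convK _] K0].
have [r r0 rK] := interior0_ball K0.
have [M M0 KM] := compact_enorm_bounded cK.
have K00 : K 0.
  by apply: rK; rewrite (_ : enorm 0 = 0) ?(ltW r0)//; apply/eqP; rewrite enorm_eq0.
exists r, M; split => //; first by apply: compact_closed => //; exact: norm_hausdorff.
move=> x t Kx /andP[t0 t1].
have := convK x 0 (Itv01 t0 t1) (mem_set Kx) (mem_set K00).
by rewrite inE /conv/= scaler0 addr0.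
Qed.

Lemma convex_body_convex (R : realType) n (K : set 'rV[R]_n) x y (t : R) :
  convex_body K -> 0 <= t <= 1 -> K x -> K y -> K (t *: x + (1 - t) *: y).
Proof.
move=> [_ + _] /andP[t0 t1] Kx Ky => /(_ x y (Itv01 t0 t1)).
by rewrite !inE; apply.
Qed.

(** * Differentiability of the gauge *)

Section gauge.
Context (R : realType) (n : nat) (K : set 'rV[R]_n) (r M : R).
Hypothesis sK : star_body K r M.
Hypothesis cK : forall x y t, 0 <= t <= 1 -> K x -> K y -> K (t *: x + (1 - t) *: y).
Implicit Types (u v w x y e : 'rV[R]_n).

(** The Minkowski functional; at the origin [radial_fun] is 0 and the convention [0^-1 = 0] gives
    the right value. *)
Definition gauge (A : set 'rV[R]_n) x : R := (radial_fun A x)^-1.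
Local Notation g := (gauge K).

Lemma gauge0 : g 0 = 0.
Proof. by rewrite /gauge radial_fun0 invr0. Qed.

Lemma gauge_gt0 x : x != 0 -> 0 < g x.
Proof. by move=> x0; rewrite invr_gt0 (radial_fun_gt0 sK). Qed.

Lemma gaugeZ a x : 0 <= a -> g (a *: x) = a * g x.
Proof.
rewrite le_eqVlt => /predU1P[<-|a0]; first by rewrite scale0r gauge0 mul0r.
by rewrite /gauge (radial_funZ sK)// invfM invrK.
Qed.

Lemma gauge_le1 x : K x -> g x <= 1.
Proof.
move=> Kx; have [->|x0] := eqVneq x 0; first by rewrite gauge0.
rewrite invf_le1 ?(radial_fun_gt0 sK)//.
by apply/(radial_funP sK x0 ler01); rewrite scale1r.
Qed.

Lemma gauge_normalized x : x != 0 -> K ((g x)^-1 *: x).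
Proof.
move=> x0; rewrite invrK; apply/(radial_funP sK x0) => //.
exact: radial_fun_ge0 sK _.
Qed.

(** [(x + y) / (g x + g y)] is the convex combination of the points [x / g x] and [y / g y] of [K]
    with weights proportional to [g x] and [g y]. *)
Lemma gaugeD x y : g (x + y) <= g x + g y.
Proof.
have [->|x0] := eqVneq x 0; first by rewrite add0r gauge0 add0r.
have [->|y0] := eqVneq y 0; first by rewrite addr0 gauge0 addr0.
have gx0 := gauge_gt0 x0; have gy0 := gauge_gt0 y0.
have s0 : 0 < g x + g y by rewrite addr_gt0.
have /gauge_le1 : K (((g x + g y)^-1) *: (x + y)).
  have t01 : 0 <= g x / (g x + g y) <= 1.
    by rewrite divr_ge0 ?(ltW s0) ?(ltW gx0)//= ler_pdivrMr// mul1r lerDl ltW.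
  have := cK t01 (gauge_normalized x0) (gauge_normalized y0).
  rewrite !scalerA mulrAC mulfV ?gt_eqF// mul1r.
  have -> : (1 - g x / (g x + g y)) * (g y)^-1 = (g x + g y)^-1.
    by field; rewrite !gt_eqF.
  by rewrite -scalerDr.
by rewrite gaugeZ ?invr_ge0 ?(ltW s0)// mulrC ler_pdivrMr// mul1r.
Qed.

Lemma measurable_gauge : measurable_fun setT g.
Proof.
rewrite (_ : g = (fun x => radial_fun K x `^ (- 1))).
  exact: (measurableT_comp (measurable_powR (- 1)) (measurable_radial_fun sK)).
by apply/funext => x; rewrite powR_inv1// (radial_fun_ge0 sK).
Qed.

(* By homogeneity, [gauge_incr x e l] is the difference quotient of the gauge at
   [x] in the direction [e] with step [1 / l]. *)
Definition gauge_incr x e (l : R) := g (l *: x + e) - l * g x.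

(** The one-sided directional derivative: the quotients decrease in [l], so their limit is an
    infimum. Integer [l] make it a limit of a sequence, hence measurable in [x]. *)
Definition gauge_deriv x e : R := inf (range (fun k : nat => gauge_incr x e k%:R)).

Lemma gauge_incr_noninc x e l l' : 0 <= l -> l <= l' ->
  gauge_incr x e l' <= gauge_incr x e l.
Proof.
move=> l0 ll'; have d0 : 0 <= l' - l by rewrite subr_ge0.
have := gaugeD (l *: x + e) ((l' - l) *: x).
rewrite gaugeZ// addrAC -scalerDl (addrC l) subrK /gauge_incr => h; lra.
Qed.

Lemma gauge_incr_ge x e l : 0 <= l -> - g (- e) <= gauge_incr x e l.
Proof.
move=> l0; have := gaugeD (l *: x + e) (- e).
by rewrite addrK gaugeZ// /gauge_incr => h; lra.
Qed.

Let incr_lb x e : has_lbound (range (fun k : nat => gauge_incr x e k%:R)).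
Proof. by exists (- g (- e)) => _ [k _ <-]; exact: gauge_incr_ge. Qed.

Lemma gauge_deriv_le x e l : 0 <= l -> gauge_deriv x e <= gauge_incr x e l.
Proof.
move=> l0; pose k := (Num.truncn l).+1.
apply: (@le_trans _ _ (gauge_incr x e k%:R)).
  by apply: ge_inf; [exact: incr_lb|exists k].
by apply: gauge_incr_noninc => //; rewrite ltW// truncnS_gt.
Qed.

Lemma le_gauge_deriv x e c : (forall l, 0 <= l -> c <= gauge_incr x e l) ->
  c <= gauge_deriv x e.
Proof.
move=> h; apply: lb_le_inf; first by exists (gauge_incr x e 0); exists 0%N.
by move=> _ [k _ <-]; exact: h.
Qed.

(** The increment of [e + e'] at [l = m + m] splits, by subadditivity of the gauge, into the
    increments of [e] and of [e'] at [m]. *)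
Lemma gauge_derivD x e e' :
  gauge_deriv x (e + e') <= gauge_deriv x e + gauge_deriv x e'.
Proof.
rewrite -lerBlDr; apply: le_gauge_deriv => l l0.
rewrite lerBlDr -lerBlDl; apply: le_gauge_deriv => l' l'0.
rewrite lerBlDl; pose m := Num.max l l'.
have m0 : 0 <= m by rewrite le_max l0.
apply: (@le_trans _ _ (gauge_incr x (e + e') (m + m))).
  by apply: gauge_deriv_le; rewrite addr_ge0.
have h1 : gauge_incr x e m <= gauge_incr x e l.
  by apply: gauge_incr_noninc => //; rewrite le_max lexx.
have h2 : gauge_incr x e' m <= gauge_incr x e' l'.
  by apply: gauge_incr_noninc => //; rewrite le_max lexx orbT.
rewrite (le_trans _ (lerD h1 h2))// /gauge_incr.
have := gaugeD (m *: x + e) (m *: x + e').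
by rewrite addrACA -scalerDl => h; lra.
Qed.

Lemma gauge_derivZ x e s : 0 <= s -> gauge_deriv x (s *: e) <= s * gauge_deriv x e.
Proof.
rewrite le_eqVlt => /predU1P[<-|s0].
  rewrite mul0r scale0r (le_trans (gauge_deriv_le _ _ (lexx 0)))//.
  by rewrite /gauge_incr scale0r addr0 gauge0 mul0r subr0.
rewrite mulrC -ler_pdivrMr//; apply: le_gauge_deriv => l l0.
rewrite ler_pdivrMr//.
have sl0 : 0 <= s * l by rewrite mulr_ge0// ltW.
rewrite (le_trans (gauge_deriv_le _ _ sl0))//.
rewrite /gauge_incr -scalerA -scalerDr gaugeZ ?(ltW s0)//.
by rewrite le_eqVlt; apply/orP; left; apply/eqP; ring.
Qed.

Lemma gauge_deriv0 x : 0 <= gauge_deriv x 0.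
Proof. by apply: le_gauge_deriv => l l0; rewrite /gauge_incr addr0 gaugeZ// subrr. Qed.

Lemma gauge_deriv_self x : gauge_deriv x (- x) <= - g x.
Proof.
by rewrite (le_trans (gauge_deriv_le _ _ ler01))// /gauge_incr scale1r subrr gauge0 mul1r sub0r.
Qed.

Lemma gauge_deriv_le_gauge x y : gauge_deriv x y <= g y.
Proof.
by rewrite (le_trans (gauge_deriv_le _ _ (lexx 0)))// /gauge_incr scale0r add0r mul0r subr0.
Qed.

Lemma measurable_gauge_deriv e : measurable_fun setT (gauge_deriv^~ e).
Proof.
apply: (@measurable_fun_cvg _ _ _ _ (fun k x => gauge_incr x e k%:R)) => [k|x _].
  apply: measurable_funB; last by apply: measurable_funM => //; exact: measurable_gauge.
  apply: (measurableT_comp measurable_gauge); apply: measurable_rV => i.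
  under eq_fun do rewrite !mxE.
  apply: measurable_funD => //; apply: measurable_funM => //.
  exact: measurable_coord.
apply: nonincreasing_cvgn; last exact: incr_lb.
by move=> i j ij; apply: gauge_incr_noninc; rewrite ?ler_nat.
Qed.

Local Notation basis i := (delta_mx ord0 i : 'rV[R]_n).

Definition gauge_grad x : 'rV[R]_n := \row_i gauge_deriv x (basis i).

(** [- gauge_deriv x (- e)] is the left derivative in direction [e], so this is where the [i]-th
    partial derivative fails to exist. *)
Let singular i := [set x | gauge_deriv x (basis i) + gauge_deriv x (- basis i) != 0].

Definition gauge_singular : set 'rV[R]_n := \bigcup_(i in [set: 'I_n]) singular i.

Lemma gauge_deriv_opp_ge x e : 0 <= gauge_deriv x e + gauge_deriv x (- e).
Proof. by rewrite (le_trans (gauge_deriv0 x))// -(subrr e) gauge_derivD. Qed.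

Let measurable_singular i : measurable (singular i).
Proof.
have : measurable_fun setT (fun x => gauge_deriv x (basis i) + gauge_deriv x (- basis i)).
  by apply: measurable_funD; exact: measurable_gauge_deriv.
move=> /(_ measurableT (~` [set 0]) (measurableC (measurable_set1 _))).
rewrite setTI; congr measurable.
by apply/seteqP; split=> x /= /eqP.
Qed.

Lemma measurable_gauge_singular : measurable gauge_singular.
Proof. by apply: fin_bigcup_measurable => // i _; exact: measurable_singular. Qed.

(* On a line in direction [e], the intervals between the left and the right
   derivatives of a convex function are disjoint, so only countably many of
   them are nonempty. *)
Lemma countable_line_singular x e :
  countable [set s | gauge_deriv (x + s *: e) e + gauge_deriv (x + s *: e) (- e) != 0].
Proof.
set S := [set s | _].
have lt_lr s : S s -> - gauge_deriv (x + s *: e) (- e) < gauge_deriv (x + s *: e) e.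
  by move=> Ss; rewrite -subr_gt0 opprK lt_def Ss gauge_deriv_opp_ge.
have /choice[q qP] : forall s, exists q : rat, S s ->
    - gauge_deriv (x + s *: e) (- e) < ratr q < gauge_deriv (x + s *: e) e.
  move=> s; have [Ss|nSs] := pselect (S s); last by exists 0.
  have [q] := rat_in_itvoo (lt_lr s Ss).
  by rewrite in_itv/= => h; exists q.
have disj s s' : s < s' ->
    gauge_deriv (x + s *: e) e <= - gauge_deriv (x + s' *: e) (- e).
  (* For this [l], adding [e] to [l *: (x + s *: e)] gives [l *: (x + s' *: e)]: both derivatives
     are compared with the difference quotient between the two points. *)
  move=> ss'; pose l := (s' - s)^-1.
  have l0 : 0 <= l by rewrite invr_ge0 subr_ge0 ltW.
  have ls : l * (s' - s) = 1 by rewrite mulVf// subr_eq0 gt_eqF.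
  have h1 := gauge_deriv_le (x + s *: e) e l0.
  have h2 := gauge_deriv_le (x + s' *: e) (- e) l0.
  have e1 : l *: (x + s *: e) + e = l *: (x + s' *: e).
    rewrite !scalerDr !scalerA -addrA; congr (_ + _).
    by rewrite -[X in _ + X = _]scale1r -scalerDl -ls; congr (_ *: _); ring.
  have e2 : l *: (x + s' *: e) - e = l *: (x + s *: e) by rewrite -e1 addrK.
  move: h1 h2; rewrite /gauge_incr e1 e2 !gaugeZ// => h1 h2; lra.
apply/countable_injP; exists (pickle \o q) => s s' /set_mem Ss /set_mem Ss'.
move=> /= /(pcan_inj pickleK) qq.
have /andP[q1 q2] := qP _ Ss; have /andP[q1' q2'] := qP _ Ss'.
case: (ltgtP s s') => // /disj h.
  by have := lt_trans (lt_le_trans q2 h) q1'; rewrite qq ltxx.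
by have := lt_trans (lt_le_trans q2' h) q1; rewrite qq ltxx.
Qed.

Let singular_null i : lebesgue_rV R n (singular i) = 0%E.
Proof.
apply: (lebesgue_rV_null_slices (i := i)) => [|x]; first exact: measurable_singular.
by apply: countable_lebesgue_measure0; exact: countable_line_singular.
Qed.

Lemma lebesgue_gauge_singular : lebesgue_rV R n gauge_singular = 0%E.
Proof.
apply/(negligibleP _ measurable_gauge_singular).
apply: (@negligibleS _ _ _ (lebesgue_rV R n)
    (\bigcup_k [set x | exists i : 'I_n, i = k :> nat /\ singular i x])).
  by move=> x [i _ ix]; exists (i : nat) => //=; exists i.
apply: negligible_bigcup => k; have [kn|nk] := ltnP k n; last first.
  apply: (negligibleS _ (negligible_set0 _)) => x /= [i [ik _]].
  by move: nk; rewrite -ik leqNgt ltn_ord.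
apply: (@negligibleS _ _ _ _ (singular (Ordinal kn))).
  by move=> x /= [i [ik]]; rewrite (_ : i = Ordinal kn)//; exact/val_inj.
by exists (singular (Ordinal kn)); split => //; exact: singular_null.
Qed.

Lemma gauge_deriv_scale a x e : 0 < a -> gauge_deriv (a *: x) e = gauge_deriv x e.
Proof.
move=> a0; have an0 : a != 0 by rewrite gt_eqF.
have E l : gauge_incr (a *: x) e l = gauge_incr x e (a * l).
  by rewrite /gauge_incr gaugeZ ?(ltW a0)// scalerA mulrA (mulrC l).
apply/eqP; rewrite eq_le; apply/andP; split; apply: le_gauge_deriv => l l0.
  rewrite -[l](mulVKf an0) -E; apply: gauge_deriv_le.
  by rewrite mulr_ge0// invr_ge0 ltW.
by rewrite E; apply: gauge_deriv_le; rewrite mulr_ge0// ltW.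
Qed.

(** By [gauge_deriv_scale] the singular set is a cone, so it contains the truncated cone over its
    trace on the sphere. *)
Lemma sphere_gauge_singular : @sphere_measure R n gauge_singular = 0%E.
Proof.
rewrite /sphere_measure [X in (_ * X)%E](_ : _ = 0%E) ?mule0//.
apply/eqP; rewrite eq_le measure_ge0 andbT -lebesgue_gauge_singular.
have mN := measurable_gauge_singular.
apply: le_measure; rewrite ?inE//.
  rewrite (_ : [set x | _] = (@sgn R n @^-1` gauge_singular) `&` @punctured_ball R n)//.
  apply: measurableI; last exact: measurable_punctured_ball.
  by rewrite -[X in measurable X]setTI; apply: measurable_sgn.
move=> x /= [[i _ /= ix] /andP[x0 _]]; exists i => //=.
by move: ix; rewrite /singular/= /sgn !gauge_deriv_scale// invr_gt0.
Qed.

(** * Supporting functionals at a regular point *)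

Section regular_point.
Context x (xreg : ~ gauge_singular x).

Let deriv_opp i : gauge_deriv x (- basis i) = - gauge_deriv x (basis i).
Proof.
apply/eqP; rewrite -addr_eq0 addrC; apply/negPn/negP => ix.
by apply: xreg; exists i.
Qed.

Let dot_basis v i : dot v (basis i) = v ord0 i.
Proof.
rewrite /dot (bigD1 i)//= mxE !eqxx/= mulr1 big1 ?addr0// => j ji.
by rewrite mxE (negbTE ji) andbF mulr0.
Qed.

Let deriv_basis i s : gauge_deriv x (s *: basis i) <= s * gauge_deriv x (basis i).
Proof.
have [s0|s0] := leP 0 s; first exact: gauge_derivZ.
rewrite -[s in s *: _]opprK scaleNr -scalerN.
rewrite (le_trans (gauge_derivZ _ _ _)) ?oppr_ge0 ?(ltW s0)//.
by rewrite deriv_opp mulrNN.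
Qed.

(** Regularity makes the directional derivative homogeneous along each axis for both signs;
    subadditivity then sums over the coordinates of [y]. *)
Let deriv_le_grad y : gauge_deriv x y <= dot (gauge_grad x) y.
Proof.
have -> : y = \sum_i y ord0 i *: basis i.
  by rewrite {1}(row_sum_delta y).
have -> : dot (gauge_grad x) (\sum_i y ord0 i *: basis i) =
    \sum_i y ord0 i * gauge_deriv x (basis i).
  rewrite -row_sum_delta /dot; apply: eq_bigr => i _.
  by rewrite mxE mulrC.
elim: (index_enum _) => [|i s IH].
  by rewrite !big_nil (le_trans (gauge_deriv_le_gauge _ _))// gauge0.
by rewrite !big_cons (le_trans (gauge_derivD _ _ _))// lerD.
Qed.

(** The partial derivatives alone control all directions: [deriv_le_grad] at [- y] together with [0
    <= gauge_deriv x y + gauge_deriv x (- y)] puts the linear form below the directional derivative,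
    hence below the gauge. *)
Lemma gauge_grad_le y : dot (gauge_grad x) y <= g y.
Proof.
have h1 : 0 <= gauge_deriv x y + gauge_deriv x (- y).
  by rewrite (le_trans (gauge_deriv0 x))// -(subrr y) gauge_derivD.
have h2 := deriv_le_grad (- y); have h3 := gauge_deriv_le_gauge x y.
have h4 : dot (gauge_grad x) (- y) = - dot (gauge_grad x) y.
  by rewrite -scaleN1r dotZr mulN1r.
lra.
Qed.

Lemma gauge_grad_self : dot (gauge_grad x) x = g x.
Proof.
apply/eqP; rewrite eq_le gauge_grad_le/=.
have h1 : 0 <= gauge_deriv x x + gauge_deriv x (- x).
  by rewrite (le_trans (gauge_deriv0 x))// -(subrr x) gauge_derivD.
have h2 := deriv_le_grad x; have h3 := gauge_deriv_self x.
lra.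
Qed.

(** A supporting functional is below the directional derivative along every [basis i] and its
    opposite; at a regular point these two bounds coincide. *)
Lemma gauge_grad_unique (l : 'rV[R]_n) : (forall y, dot l y <= g y) ->
  dot l x = g x -> l = gauge_grad x.
Proof.
move=> lg lx; have key e : dot l e <= gauge_deriv x e.
  apply: le_gauge_deriv => s s0; rewrite /gauge_incr -lx.
  have := lg (s *: x + e); rewrite dotC dotDl dotZl !(dotC _ l) => h; lra.
apply/rowP => i; rewrite mxE; apply/eqP; rewrite eq_le.
have h1 := key (basis i); have h2 := key (- basis i).
move: h1 h2; rewrite deriv_opp -[- basis i]scaleN1r dotZr mulN1r dot_basis => -> /=.
by rewrite lerN2.
Qed.

End regular_point.

End gauge.

(** * Radial derivative of the logarithmic family *)

Lemma dnbhs0P (R : realType) (P : R -> Prop) (d : R) : 0 < d ->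
  (forall t, t != 0 -> `|t| < d -> P t) -> \forall t \near 0^', P t.
Proof.
move=> d0 H; apply/nbhs_ballP; exists d => //= t.
by rewrite /ball/= sub0r normrN => td t0; exact: H.
Qed.

Section normal_map.
Context (R : realType) (n : nat) (K : set 'rV[R]_n) (r M : R).
Hypothesis sK : star_body K r M.
Hypothesis cK : forall x y t, 0 <= t <= 1 -> K x -> K y -> K (t *: x + (1 - t) *: y).
Implicit Types (u v w x y : 'rV[R]_n).
Local Notation g := (gauge K).
Local Notation h := (support_fun K).
Local Notation rho := (radial_fun K).

(** The radial Gauss map, given as a total measurable function; only its values at regular
    directions carry meaning. *)
Definition normal_map (A : set 'rV[R]_n) x := sgn (gauge_grad A x).
Local Notation alpha := (normal_map K).

Lemma measurable_normal_map : measurable_fun setT alpha.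
Proof.
apply: (measurableT_comp (@measurable_sgn R n)); apply: measurable_rV => i.
under eq_fun do rewrite mxE.
exact: (measurable_gauge_deriv sK cK).
Qed.

Lemma radial_dot_le v w : v != 0 -> rho v * dot v w <= h w.
Proof.
move=> v0; rewrite -dotZl; apply: (dot_le_support sK).
apply/(radial_funP sK v0) => //; exact: radial_fun_ge0 sK _.
Qed.

Section regular_direction.
Context v (v1 : sphere v) (vreg : ~ gauge_singular K v).

Let v0 := sphere_neq0 v1.
Let L := gauge_grad K v.
Let Lle y : dot L y <= g y := gauge_grad_le sK cK vreg y.
Let Lv : dot L v = g v := gauge_grad_self sK cK vreg.

Let L0 : L != 0.
Proof.
apply/eqP => L0; have := gauge_gt0 sK v0.
by rewrite -Lv L0 /dot big1 ?ltxx// => i _; rewrite mxE mul0r.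
Qed.

Lemma sphere_normal_map : sphere (alpha v).
Proof. exact: sphere_sgn. Qed.

Lemma normal_mapP : rho v * dot v (alpha v) = h (alpha v).
Proof.
apply/eqP; rewrite eq_le (radial_dot_le _ v0)/=; apply: (support_le sK) => x Kx.
have nL : 0 < (enorm L)^-1 by rewrite invr_gt0 enorm_gt0.
rewrite !dotZr !(dotC _ L) -/L Lv mulrCA ler_wpM2l ?(ltW nL)//.
by rewrite /gauge mulfV ?gt_eqF ?(radial_fun_gt0 sK)// (le_trans (Lle x))// (gauge_le1 sK).
Qed.

(** Such a [w], divided by [h w], is a linear form below the gauge and equal to it at [v], hence is
    the gradient. *)
Lemma normal_map_unique w : sphere w -> rho v * dot v w = h w -> w = alpha v.
Proof.
move=> w1 hw; have hw0 := support_gt0 sK w1.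
have LE : (h w)^-1 *: w = L.
  apply: (gauge_grad_unique vreg) => [y|].
    have [->|y0] := eqVneq y 0.
      by rewrite gauge0 dotC /dot big1// => i _; rewrite mxE mul0r.
    rewrite dotZl mulrC ler_pdivrMr//.
    have := dot_le_support sK w (gauge_normalized sK y0).
    by rewrite dotZl (dotC _ w) mulrC ler_pdivrMr ?(gauge_gt0 sK)// mulrC.
  have rv0 := radial_fun_gt0 sK v0.
  rewrite dotZl -hw (dotC w) /gauge invfM -mulrA mulVf ?mulr1//.
  by apply: contraTneq hw0 => vw0; rewrite -hw vw0 mulr0 ltxx.
by rewrite /normal_map -/L -LE sgnZ ?invr_gt0// sgn_id.
Qed.

Section envelope.
Context (f : 'rV[R]_n -> R) (B : R).
Hypotheses (n0 : (0 < n)%N) (B0 : 0 <= B) (fB : forall u, sphere u -> `|f u| <= B).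

(** The single constraint with normal [alpha v] suffices, since [K] attains its support value there
    at [rho v *: v]. *)
Lemma log_family_radial_le t : `|t| <= 1 ->
  radial_fun (log_family K f t) v <= rho v * expR (t * f (alpha v)).
Proof.
move=> t1; have sKt := star_body_log_family sK n0 fB t1.
have rt0 := radial_fun_ge0 sKt v.
have /(radial_funP sKt v0 rt0) := lexx (radial_fun (log_family K f t) v).
move=> /(log_familyP sK)/(_ _ sphere_normal_map).
rewrite dotZl -normal_mapP mulrAC ler_pM2r//.
have := support_gt0 sK sphere_normal_map.
by rewrite -normal_mapP pmulr_rgt0// (radial_fun_gt0 sK).
Qed.

Let in_log_family t s : `|t| <= 1 -> 0 <= s ->
  (forall w, sphere w -> 0 < dot v w -> s * dot v w <= h w * expR (t * f w)) ->
  s <= radial_fun (log_family K f t) v.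
Proof.
move=> t1 s0 H; have sKt := star_body_log_family sK n0 fB t1.
apply/(radial_funP sKt v0 s0)/(log_familyP sK) => w w1; rewrite dotZl.
have [vw|vw] := ltP 0 (dot v w); first exact: H.
rewrite (@le_trans _ _ 0) ?mulr_ge0_le0//.
by rewrite mulr_ge0 ?expR_ge0// ltW// (support_gt0 sK).
Qed.

Lemma log_family_radial_ge t : `|t| <= 1 ->
  rho v * expR (- (`|t| * B)) <= radial_fun (log_family K f t) v.
Proof.
have rv0 := radial_fun_ge0 sK v.
move=> t1; apply: in_log_family => // [|w w1 vw]; first by rewrite mulr_ge0 ?expR_ge0.
rewrite mulrAC ler_pM ?expR_ge0//; first by rewrite mulr_ge0// ltW.
- exact: radial_dot_le.
rewrite ler_expR lerNl -mulNr (le_trans (ler_norm _))// normrM normrN.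
by rewrite ler_wpM2l// fB.
Qed.

(* Only the normals [w] with [f w <= f (alpha v) - e] could violate the bound;
   they form a compact set avoiding [alpha v], on which [h w - rho v * v.w] has a
   positive lower bound. *)
Lemma log_family_radial_right e : {within sphere, continuous f} -> 0 < e ->
  exists2 d : R, 0 < d <= 1 & forall t, 0 < t < d ->
    rho v * expR (t * (f (alpha v) - e)) <= radial_fun (log_family K f t) v.
Proof.
move=> fc e0; pose C := sphere `&` f @^-1` `]-oo, (f (alpha v) - e)].
have rv0 := radial_fun_ge0 sK v.
have cC : compact C.
  apply: (subclosed_compact _ (@compact_sphere R n)); last by move=> w [].
  by apply: closed_within_preimage => //; exact: closed_sphere.
pose psi w := h w - rho v * dot v w.
have cpsi : continuous psi.
  move=> w; apply: continuousB; first exact: (continuous_support sK).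
  apply: continuousM; first exact: cst_continuous.
  rewrite (_ : dot v = (fun w => dot w v)); first exact: continuous_dotl.
  by apply/funext => z; rewrite dotC.
have psi0 w : C w -> 0 < psi w.
  move=> [w1 /=]; rewrite in_itv/= => fw; rewrite subr_gt0 lt_neqAle radial_dot_le// andbT.
  apply/eqP => /(normal_map_unique w1) wE; move: fw; rewrite wE; lra.
have [eta eta0 etaP] := compact_positive_lower_bound cC cpsi psi0.
(* [H] bounds [h] on the sphere, whence [(h w - eta) (1 + eta / H) <= h w]; [a] bounds the
   differences of values of [f], and [t < d] keeps the exponential of [t a] below [1 + eta / H]. *)
pose H := n%:R * M + 1.
have H0 : 0 < H by rewrite ltr_wpDl// mulr_ge0// (star_body_M_ge0 sK).
pose a := 2 * B + 1; have a0 : 0 < a by rewrite ltr_wpDl// mulr_ge0.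
pose d := Num.min 1 (ln (1 + eta / H) / a).
have eH : 0 < eta / H by rewrite divr_gt0.
exists d; first by rewrite lt_min ltr01 divr_gt0 ?ln_gt0 ?ltrDl//= ge_min lexx.
move=> t /andP[t0]; rewrite lt_min => /andP[t1 tl].
apply: in_log_family => [||w w1 vw]; first by rewrite gtr0_norm// ltW.
  by rewrite mulr_ge0 ?expR_ge0.
have hw0 := support_gt0 sK w1.
have rvw : 0 <= rho v * dot v w by rewrite mulr_ge0// ltW.
have [fw|fw] := leP (f (alpha v) - e) (f w).
  rewrite mulrAC ler_pM ?expR_ge0//; first exact: radial_dot_le.
  by rewrite ler_expR ler_wpM2l// ltW.
have /etaP : C w by split => //=; rewrite in_itv/= ltW.
rewrite /psi lerBrDr => etaw.
have ta : expR (t * (f (alpha v) - e) - t * f w) <= 1 + eta / H.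
  rewrite -[leRHS]lnK ?posrE ?addr_gt0// ler_expR.
  move: tl; rewrite ltr_pdivlMr// => /ltW; apply: le_trans.
  rewrite -mulrBr ler_wpM2l ?(ltW t0)//.
  have := fB w1; have := fB sphere_normal_map; rewrite !ler_norml /a; lra.
have -> : t * (f (alpha v) - e) = t * (f (alpha v) - e) - t * f w + t * f w by rewrite subrK.
rewrite expRD mulrAC mulrA ler_wpM2r ?expR_ge0//.
apply: (@le_trans _ _ ((h w - eta) * (1 + eta / H))).
  by apply: ler_pM => //; rewrite lerBrDl.
have hH : h w <= H by rewrite (le_trans (support_le_bound sK w1))// lerDl.
have : h w * (eta / H) <= eta.
  by rewrite mulrA ler_pdivrMr// mulrC ler_wpM2l// ltW.
have : 0 <= eta * (eta / H) by rewrite mulr_ge0// ltW.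
lra.
Qed.

End envelope.

(** Reduces lower bounds for [t < 0] to those for [t > 0]. *)
Lemma log_family_opp (f : 'rV[R]_n -> R) t :
  log_family K (fun u => - f u) (- t) = log_family K f t.
Proof. by rewrite /log_family; congr wulff; apply/funext => u; rewrite mulrNN. Qed.

Section log_radial.
Context (f : 'rV[R]_n -> R) (B : R).
Hypotheses (n0 : (0 < n)%N) (B0 : 0 <= B) (fB : forall u, sphere u -> `|f u| <= B).

Let quotient_gt0 t : `|t| <= 1 -> 0 < radial_fun (log_family K f t) v / rho v.
Proof.
move=> t1; rewrite divr_gt0 ?(radial_fun_gt0 sK)//.
by rewrite (radial_fun_gt0 (star_body_log_family sK n0 fB t1)).
Qed.

Lemma ln_log_family_radial_le t : `|t| <= 1 ->
  ln (radial_fun (log_family K f t) v / rho v) <= t * f (alpha v).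
Proof.
move=> t1; rewrite -[leRHS]expRK ler_ln ?posrE ?expR_gt0 ?quotient_gt0//.
rewrite ler_pdivrMr ?(radial_fun_gt0 sK)// mulrC.
exact: log_family_radial_le n0 fB _ t1.
Qed.

Lemma ln_log_family_radial_ge t c : `|t| <= 1 ->
  rho v * expR c <= radial_fun (log_family K f t) v ->
  c <= ln (radial_fun (log_family K f t) v / rho v).
Proof.
move=> t1 tc; rewrite -[leLHS]expRK ler_ln ?posrE ?expR_gt0 ?quotient_gt0//.
by rewrite ler_pdivlMr ?(radial_fun_gt0 sK)// mulrC.
Qed.

Lemma ln_log_family_radial_bound t : `|t| <= 1 ->
  `|ln (radial_fun (log_family K f t) v / rho v)| <= B * `|t|.
Proof.
move=> t1; rewrite ler_norml; apply/andP; split.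
  rewrite mulrC; apply: ln_log_family_radial_ge => //.
  exact: log_family_radial_ge.
rewrite (le_trans (ln_log_family_radial_le t1))// (le_trans (ler_norm _))//.
by rewrite normrM mulrC ler_wpM2r//; apply: fB; exact: sphere_normal_map.
Qed.

(** For either sign of [t] the logarithm is at most [t f(alpha v)]; [log_family_radial_right] bounds
    it below within [|t| e], applied to [f] for [t > 0] and to [- f] at [- t] for [t < 0]. *)
Lemma ln_log_family_radial_cvg : {within sphere, continuous f} ->
  ln (radial_fun (log_family K f t) v / rho v) / t @[t --> 0^'] --> f (alpha v).
Proof.
move=> fc; have fNB u : sphere u -> `|- f u| <= B by rewrite normrN; exact: fB.
have fNc : {within sphere, continuous (fun u => - f u)}.
  by move=> u; apply: continuousN; exact: fc.
apply/cvgrPdist_le => e e0.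
have [d /andP[d0 d1] dP] := log_family_radial_right n0 B0 fB fc e0.
have [d' /andP[d'0 d'1] d'P] := log_family_radial_right n0 B0 fNB fNc e0.
apply: (@dnbhs0P _ _ (Num.min d d')); first by rewrite lt_min d0.
move=> t t0; rewrite lt_min => /andP[td td'].
have t1 : `|t| <= 1 by rewrite (le_trans (ltW td)).
have h1 := ln_log_family_radial_le t1.
move: t0; rewrite neq_lt => /orP[t0|t0].
  have te : t * e < 0 by rewrite nmulr_rlt0.
  have tN : 0 < - t < d' by rewrite oppr_gt0 t0/= -ltr0_norm.
  have := d'P _ tN; rewrite log_family_opp => /(ln_log_family_radial_ge t1) h2.
  rewrite distrC ler_distl; apply/andP; split.
    by rewrite ler_ndivlMr//; lra.
  by rewrite ler_ndivrMr//; lra.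
have te : 0 < t * e by rewrite mulr_gt0.
have tP : 0 < t < d by rewrite t0/= -[t]gtr0_norm.
have := dP _ tP => /(ln_log_family_radial_ge t1) h2.
rewrite distrC ler_distl; apply/andP; split.
  by rewrite ler_pdivlMr//; lra.
by rewrite ler_pdivrMr//; lra.
Qed.

End log_radial.

End regular_direction.
End normal_map.

(** * Differentiation under the integral sign *)

Section derivative_of_exponential.
Context (R : realType).
Implicit Types (x a b l B : R) (th : R -> R).

Lemma expR_sub1_le x : `|expR x - 1| <= `|x| * expR `|x|.
Proof.
have h1 := expR_ge1Dx x; have h2 := expR_ge1Dx (- x).
have [x0|x0] := leP 0 x.
  rewrite !ger0_norm//; last by lra.
  have : expR x * (1 + - x) <= 1.
    by rewrite (le_trans (ler_wpM2l (expR_ge0 x) h2))// -expRD subrr expR0.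
  lra.
have x1 : expR x <= 1 by rewrite -expR0 ler_expR ltW.
rewrite ler0_norm ?subr_le0//.
apply: (@le_trans _ _ (`|x| * 1)).
  by rewrite ltr0_norm//; lra.
by rewrite ler_wpM2l// -expR0 ler_expR.
Qed.

Lemma expR_sub1_sub_le x : `|expR x - 1 - x| <= x ^+ 2 * expR `|x|.
Proof.
have h1 := expR_ge1Dx x; have h2 := expR_ge1Dx (- x).
have : expR x * (1 + - x) <= 1.
  by rewrite (le_trans (ler_wpM2l (expR_ge0 x) h2))// -expRD subrr expR0.
rewrite ger0_norm; last by lra.
move=> h3; apply: (@le_trans _ _ (x * (expR x - 1))); first by lra.
rewrite (le_trans (ler_norm _))// normrM -real_normK ?num_real// expr2 -mulrA.
by rewrite ler_wpM2l// expR_sub1_le.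
Qed.

Section quotient.
Context (th : R -> R) (a B : R).
Hypotheses (B0 : 0 <= B) (thB : forall t, `|t| <= 1 -> `|th t| <= B * `|t|).

Let C := `|a| * B * expR (`|a| * B).

Let ath t : `|t| <= 1 -> `|a * th t| <= `|a| * B * `|t|.
Proof. by move=> t1; rewrite normrM -mulrA ler_wpM2l// thB. Qed.

Let exp_ath t : `|t| <= 1 -> expR `|a * th t| <= expR (`|a| * B).
Proof.
move=> t1; rewrite ler_expR (le_trans (ath t1))// ler_piMr//.
by rewrite mulr_ge0.
Qed.

Lemma expR_quotient_bound t : t != 0 -> `|t| <= 1 ->
  `|(expR (a * th t) - 1) / t| <= C.
Proof.
move=> t0 t1; rewrite normrM normfV ler_pdivrMr ?normr_gt0//.
rewrite (le_trans (expR_sub1_le _))// /C mulrAC.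
by rewrite ler_pM ?expR_ge0 ?ath ?exp_ath.
Qed.

(** The linear term gives the limit; by [expR_sub1_sub_le] the remainder is of order [t^2] before
    the division. *)
Lemma cvg_expR_quotient l : th t / t @[t --> 0^'] --> l ->
  (expR (a * th t) - 1) / t @[t --> 0^'] --> a * l.
Proof.
move=> thl0; have thl : a * (th t / t) @[t --> 0^'] --> a * l by exact: cvgMl_tmp.
have rest0 : (expR (a * th t) - 1 - a * th t) / t @[t --> 0^'] --> 0.
  pose E := (`|a| * B) ^+ 2 * expR (`|a| * B).
  have E0 : 0 <= E by rewrite mulr_ge0 ?sqr_ge0 ?expR_ge0.
  apply/cvgrPdist_le => e e0.
  have E1 : 0 < E + 1 by rewrite ltr_wpDl.
  apply: (@dnbhs0P _ _ (Num.min 1 (e / (E + 1)))); first by rewrite lt_min ltr01 divr_gt0.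
  move=> t t0; rewrite lt_min => /andP[/ltW t1 te].
  rewrite sub0r normrN normrM normfV ler_pdivrMr ?normr_gt0//.
  rewrite (le_trans (expR_sub1_sub_le _))//.
  have h : (a * th t) ^+ 2 * expR `|a * th t| <= E * `|t| ^+ 2.
    have -> : E * `|t| ^+ 2 = (`|a| * B * `|t|) ^+ 2 * expR (`|a| * B) by rewrite /E; ring.
    rewrite ler_pM ?sqr_ge0 ?expR_ge0 ?exp_ath//.
    by rewrite -real_normK ?num_real// lerXn2r ?nnegrE ?ath// !mulr_ge0.
  rewrite (le_trans h)// expr2 mulrA ler_wpM2r//.
  move: te; rewrite ltr_pdivlMr// => /ltW; apply: le_trans.
  by rewrite mulrC ler_wpM2l// lerDl.
rewrite -[a * l]addr0 (_ : (fun t => (expR (a * th t) - 1) / t) =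
  (fun t => a * (th t / t) + (expR (a * th t) - 1 - a * th t) / t)); last first.
  by apply/funext => t; rewrite mulrA -mulrDl [in RHS]addrC subrK.
exact: cvgD.
Qed.

End quotient.

(** Squeeze by [(y - 1) / y <= ln y <= y - 1]. It brings the derivative of [A_t] into the
    logarithmic form that the second differentiation takes as input. *)
Lemma cvg_ln_quotient (y : R -> R) l : (forall t, `|t| <= 1 -> 0 < y t) ->
  (y t - 1) / t @[t --> 0^'] --> l -> ln (y t) / t @[t --> 0^'] --> l.
Proof.
move=> y0 yl.
have y1 : y t @[t --> 0^'] --> (1 : R).
  have : t * ((y t - 1) / t) + 1 @[t --> 0^'] --> 0 * l + 1.
    apply: cvgD; last exact: cvg_cst.
    apply: cvgM => //; exact: nbhs_dnbhs.
  rewrite mul0r add0r; apply: cvg_trans; apply: near_eq_cvg.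
  apply: (@dnbhs0P _ _ 1) => // t t0 _.
  by rewrite mulrC divfK// subrK.
have yl' : ((y t - 1) / t) / y t @[t --> 0^'] --> l.
  rewrite -[l]mulr1 -[X in _ * X]invr1; apply: cvgM => //.
  by apply: cvgV => //; rewrite oner_neq0.
apply/cvgrPdist_le => e e0.
move/cvgrPdist_le : yl => /(_ _ e0) yl; move/cvgrPdist_le : yl' => /(_ _ e0) yl'.
near=> t.
have t0 : t != 0 by near: t; apply: (@dnbhs0P _ _ 1).
have t1 : `|t| <= 1 by near: t; apply: (@dnbhs0P _ _ 1) => // s _ /ltW.
have h1 : `|l - (y t - 1) / t| <= e by near: t.
have h2 : `|l - (y t - 1) / t / y t| <= e by near: t.
have yt := y0 t t1.
have l1 : ln (y t) <= y t - 1.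
  by have := @le_ln1Dx _ (y t - 1); rewrite addrCA subrr addr0; apply; lra.
have l2 : (y t - 1) / y t <= ln (y t).
  have iy : 0 < (y t)^-1 by rewrite invr_gt0.
  have : ln (y t)^-1 <= (y t)^-1 - 1.
    by have := @le_ln1Dx _ ((y t)^-1 - 1); rewrite addrCA subrr addr0; apply; lra.
  by rewrite lnV ?posrE// mulrBl mulfV ?gt_eqF// mul1r; lra.
move: h1 h2; rewrite !ler_distlC (mulrAC _ t^-1) => /andP[a1 a2] /andP[b1 b2].
move: t0; rewrite neq_lt => /orP[t0|t0]; apply/andP; split.
- by rewrite (le_trans a1)// ler_nM2r ?invr_lt0.
- by rewrite (le_trans _ b2)// ler_nM2r ?invr_lt0.
- by rewrite (le_trans b1)// ler_pM2r ?invr_gt0.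
- by rewrite (le_trans _ a2)// ler_pM2r ?invr_gt0.
Unshelve. all: by end_near. Qed.

Lemma powR_expR (y a : R) : 0 < y -> y `^ a = expR (a * ln y).
Proof. by move=> y0; rewrite /powR gt_eqF. Qed.

(** The power is monotone in a direction set by the sign of [a]; the sum covers both, as is wanted
    for exponents divided by [p]. *)
Lemma powR_le_add_bounds (x lo hi a : R) : 0 < lo -> lo <= x -> x <= hi ->
  x `^ a <= lo `^ a + hi `^ a.
Proof.
move=> lo0 lx xh; have x0 : 0 < x by exact: lt_le_trans lx.
have hi0 : 0 < hi by exact: lt_le_trans xh.
have [a0|a0] := leP 0 a.
  apply: (@le_trans _ _ (hi `^ a)); last by rewrite lerDr powR_ge0.
  by apply: ge0_ler_powR; rewrite ?nnegrE ?(ltW x0) ?(ltW hi0).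
apply: (@le_trans _ _ (lo `^ a)); last by rewrite lerDl powR_ge0.
have E (z : R) : z `^ a = (z `^ (- a))^-1 by rewrite powRN invrK.
rewrite (E x) (E lo) lef_pV2 ?posrE ?powR_gt0//.
by apply: ge0_ler_powR; rewrite ?nnegrE ?oppr_ge0 ?(ltW x0) ?(ltW lo0) ?(ltW a0).
Qed.

(** * Differentiating integrals of [w y_t^a] *)

Section integral.
Context d (T : measurableType d) (mu : {measure set T -> \bar R}) (D : set T).
Context (w : T -> R) (y : R -> T -> R) (b : T -> R) (a B : R).
Hypotheses (mD : measurable D) (iw : mu.-integrable D (EFin \o w)).
Hypotheses (my : forall t, `|t| <= 1 -> measurable_fun D (y t)).
Hypotheses (mb : measurable_fun D b) (B0 : 0 <= B).
Hypothesis y0 : forall t (x : T), D x -> `|t| <= 1 -> 0 < y t x.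
Hypothesis yB : forall t (x : T), D x -> `|t| <= 1 -> `|ln (y t x)| <= B * `|t|.
Hypothesis yb : forall x : T, D x -> ln (y t x) / t @[t --> 0^'] --> b x.

Let C := `|a| * B * expR (`|a| * B).

Let mw : measurable_fun D w.
Proof. by apply/measurable_EFinP; exact: measurable_int iw. Qed.

Let myp t : `|t| <= 1 -> measurable_fun D (fun x : T => y t x `^ a).
Proof. by move=> t1; exact: (measurableT_comp (measurable_powR a) (my t1)). Qed.

Let q t (x : T) := (y t x `^ a - 1) / t.

Let mq t : `|t| <= 1 -> measurable_fun D (q t).
Proof.
move=> t1; apply: measurable_funM; last exact: measurable_cst.
by apply: measurable_funB; [exact: myp|exact: measurable_cst].
Qed.

Let q_bound t (x : T) : D x -> t != 0 -> `|t| <= 1 -> `|q t x| <= C.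
Proof.
move=> Dx t0 t1; rewrite /q powR_expR ?y0//.
apply: (@expR_quotient_bound (fun t => ln (y t x)) a B) => // s s1.
exact: yB.
Qed.

Let q_cvg (x : T) : D x -> q t x @[t --> 0^'] --> a * b x.
Proof.
move=> Dx; have := @cvg_expR_quotient (fun t => ln (y t x)) a B B0 (fun t t1 => yB Dx t1) _ (yb Dx).
apply: cvg_trans; apply: near_eq_cvg; apply: (@dnbhs0P _ _ 1) => // t _ /ltW t1.
by rewrite /q powR_expR ?y0.
Qed.

Let iwC : mu.-integrable D (EFin \o (fun x : T => C * `|w x|)).
Proof.
have := integrableZl mD C (integrable_norm iw).
by apply: eq_integrable => // x _ /=; rewrite EFinM.
Qed.

Let iwq t : t != 0 -> `|t| <= 1 -> mu.-integrable D (EFin \o (fun x : T => w x * q t x)).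
Proof.
move=> t0 t1; apply: le_integrable iwC => //.
  by apply/measurable_EFinP; apply: measurable_funM => //; exact: mq.
move=> x Dx /=; rewrite lee_fin normrM mulrC [leRHS]ger0_norm.
  by rewrite ler_wpM2r// q_bound.
by rewrite mulr_ge0// (le_trans _ (q_bound Dx t0 t1)).
Qed.

Lemma integrable_mul_powR t : t != 0 -> `|t| <= 1 ->
  mu.-integrable D (EFin \o (fun x : T => w x * y t x `^ a)).
Proof.
move=> t0 t1; have := integrableD mD iw (integrableZl mD t (iwq t0 t1)).
apply: eq_integrable => // x _ /=.
rewrite -EFinM -EFinD /q; congr EFin; field.
by [].
Qed.

(** The bound [B |t|] on the logarithm forces [y 0 = 1] and bounds the difference quotients of the
    power by [C], so [C |w|] dominates. The statement is applied to the ratio of radial functions,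
    then to the ratio of kernel integrals. *)
Lemma deriv_integral_powR :
  mu.-integrable D (EFin \o (fun x : T => w x * (a * b x))) /\
  ((\int[mu]_(x in D) (w x * y t x `^ a) - \int[mu]_(x in D) w x) / t)
    @[t --> 0^'] --> \int[mu]_(x in D) (w x * (a * b x)).
Proof.
(* Dominated convergence concerns sequences. The harmonic sequence yields integrability of the
   limit; an arbitrary sequence tending to 0 is shifted by [N] to have modulus at most 1. *)
have seq_cvg (u : R^nat) : (forall k, u k != 0 /\ `|u k| <= 1) -> u k @[k --> \oo] --> 0 ->
    mu.-integrable D (EFin \o (fun x : T => w x * (a * b x))) /\
    (\int[mu]_(x in D) (w x * q (u k) x)) @[k --> \oo] -->
      \int[mu]_(x in D) (w x * (a * b x)).
  move=> u1 u0.
  have [] := @dominated_convergence _ T R mu D mD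
    (fun k (x : T) => (w x * q (u k) x)%:E) (fun x : T => (w x * (a * b x))%:E) (fun x : T =>
        (C * `|w x|)%:E).
  - move=> k; apply/measurable_EFinP; apply: measurable_funM => //.
    by apply: mq; case: (u1 k).
  - apply/measurable_EFinP; apply: measurable_funM => //.
    by apply: measurable_funM.
  - apply: aeW => x Dx; apply: cvg_EFin; first exact: nearW.
    apply: cvgMl_tmp; move/cvgr_dnbhsP : (q_cvg Dx) => /(_ u).
    by apply; split => // k; case: (u1 k).
  - exact: iwC.
  - apply: aeW => x k Dx; have [uk0 uk1] := u1 k.
    by rewrite lee_fin normrM mulrC ler_wpM2r// q_bound.
  move=> il _ cvgI; split => //.
  apply: fine_cvg; rewrite fineK ?integrable_fin_num//.
have il : mu.-integrable D (EFin \o (fun x : T => w x * (a * b x))).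
  have [] // := seq_cvg (@harmonic R); last exact: cvg_harmonic.
  move=> k; rewrite /harmonic gt_eqF//= ger0_norm// invf_le1// ler1n//.
split => //; apply/cvgr_dnbhsP => u [u0 ucvg].
have [N _ uN] : \forall k \near \oo, `|u k| <= 1.
  by move/cvgrPdist_le : ucvg => /(_ 1 ltr01); apply: filterS => k; rewrite sub0r normrN.
rewrite -(cvg_shiftn N).
have [] := seq_cvg (fun k => u (k + N)%N).
- by move=> k; split; [exact: u0|apply: uN => /=; rewrite leq_addl].
- by rewrite (cvg_shiftn N).
move=> _; apply: cvg_trans; apply: near_eq_cvg; apply: nearW => k /=.
have uk0 := u0 (k + N)%N.
have uk1 : `|u (k + N)%N| <= 1 by apply: uN => /=; rewrite leq_addl.
rewrite -RintegralB//; last exact: integrable_mul_powR.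
rewrite -RintegralZr//; last first.
  have := integrableB mD (integrable_mul_powR uk0 uk1) iw.
  by apply: eq_integrable => // x _ /=; rewrite EFinB.
by apply: eq_Rintegral => x _; rewrite /q; ring.
Qed.

End integral.

End derivative_of_exponential.

(** * Volume of the intersection body *)

Section star_of_radial.
Context (R : realType) (n : nat) (rho : 'rV[R]_n -> R).
Hypothesis rho0 : forall u, 0 <= rho u.
Implicit Types u : 'rV[R]_n.

Lemma star_of_radialP u t : sphere u -> 0 < t -> star_of_radial rho (t *: u) <-> t <= rho u.
Proof.
move=> u1 t0; split=> [[v [s [v1 s0 sv tu]]]|tu]; last first.
  by exists u, t; split => //; exact: ltW.
have ts : t = s.
  have := congr1 (@enorm R n) tu.
  by rewrite !enormZ u1 v1 !mulr1 gtr0_norm// ger0_norm.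
have tn0 : t != 0 by rewrite gt_eqF.
by move: tu sv; rewrite -ts => /(scalerI tn0) ->.
Qed.

Lemma radial_star_of_radial u : sphere u -> radial_fun (star_of_radial rho) u = rho u.
Proof.
move=> u1; rewrite /radial_fun (_ : [set t | _] = `[0, rho u]%classic).
  by rewrite sup_itv// bnd_simp.
apply/seteqP; split=> t /=; rewrite in_itv/=.
  move=> [t0 tu]; rewrite t0/=; have [->|tn0] := eqVneq t 0; first exact: rho0.
  by apply/(star_of_radialP u1) => //; rewrite lt_def tn0.
move=> /andP[t0 tu]; split => //.
by exists u, t.
Qed.

Lemma measurable_star_of_radial : (0 < n)%N -> measurable_fun setT rho ->
  measurable (star_of_radial rho).
Proof.
move=> n0 mrho.
have [u0 u01] : exists u, @sphere R n u.
  exists (sgn (delta_mx ord0 (Ordinal n0))); apply: sphere_sgn.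
  apply/eqP => /rowP/(_ (Ordinal n0)); rewrite !mxE !eqxx/= => /eqP.
  by rewrite oner_eq0.
rewrite (_ : star_of_radial rho = [set 0] `|`
    ([set x | enorm x <= rho (sgn x)] `&` ~` [set 0])).
  apply: measurableU; first exact: measurable_rV_set1.
  apply: measurableI; last by apply: measurableC; exact: measurable_rV_set1.
  have : measurable_fun setT (fun x : 'rV[R]_n => rho (sgn x) - enorm x).
    apply: measurable_funB; last exact: measurable_enorm.
    exact: (measurableT_comp mrho (@measurable_sgn R n)).
  move=> /(_ measurableT `[0, +oo[%classic (measurable_itv _)); rewrite setTI.
  congr measurable; apply/seteqP; split=> x /=; rewrite in_itv/= andbT subr_ge0//.
apply/seteqP; split=> x.
  have [->|x0] := eqVneq x 0; first by left.
  rewrite {1}(sgnE x) => /star_of_radialP; rewrite enorm_gt0 => xs.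
  by right; split; [apply: xs => //; exact: sphere_sgn|exact/eqP].
move=> [->|[/= xs /eqP x0]].
  by exists u0, 0; split => //; rewrite scale0r.
by rewrite (sgnE x); apply/star_of_radialP; rewrite ?enorm_gt0//; exact: sphere_sgn.
Qed.

End star_of_radial.

(** * Intersection body and kernel integral in polar coordinates *)

Section intersection_body.
Context (R : realType) (n : nat) (p : R).
Hypotheses (n0 : (0 < n)%N) (p0 : p != 0) (p1 : p < 1).
Local Notation sigma := (@sphere_measure R n).
Local Notation mu := (lebesgue_rV R n).
Local Notation m := (n%:R - p).
Implicit Types (u v x : 'rV[R]_n) (A : set 'rV[R]_n).

Lemma dimB_gt0 : 0 < m.
Proof.
by rewrite subr_gt0 (lt_le_trans p1)// ler1n.
Qed.

Let Np1 : -1 < - p. Proof. by rewrite ltrN2. Qed.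

Definition radial_kernel A u v : R := `|dot u v| `^ (- p) * radial_fun A v `^ m.

Lemma radial_kernel_ge0 A u v : 0 <= radial_kernel A u v.
Proof. by rewrite mulr_ge0 ?powR_ge0. Qed.

Lemma measurable_dot2_powR (q : R) : measurable_fun [set: 'rV[R]_n * 'rV[R]_n]
  (fun z => `|dot z.1 z.2| `^ q).
Proof.
apply: (measurableT_comp (measurable_powR q)); apply: measurableT_comp => //.
apply: measurable_sum => i; apply: measurable_funM.
  exact: (measurableT_comp (measurable_coord i) measurable_fst).
exact: (measurableT_comp (measurable_coord i) measurable_snd).
Qed.

Section body.
Context A (r M : R) (sA : star_body A r M).

Let r0 := star_body_r sA.
Let M0 := star_body_M_ge0 sA.

Lemma measurable_radial_kernel u : measurable_fun setT (radial_kernel A u).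
Proof.
apply: measurable_funM; first exact: measurable_dot_powR.
exact: (measurableT_comp (measurable_powR m) (measurable_radial_fun sA)).
Qed.

Lemma radial_powR_bounds v : sphere v ->
  r `^ m <= radial_fun A v `^ m <= M `^ m.
Proof.
move=> v1; have /andP[rv vM] := radial_fun_bounds sA v1.
have m0 := ltW dimB_gt0.
by rewrite !ge0_ler_powR ?nnegrE ?(ltW r0)// ?(radial_fun_ge0 sA).
Qed.

Let mS := @measurable_sphere R n.

Lemma integrable_radial_kernel u : sphere u ->
  sigma.-integrable sphere (EFin \o radial_kernel A u).
Proof.
move=> u1; apply/integrableP; split.
  by apply/measurable_EFinP; apply: measurable_funTS; exact: measurable_radial_kernel.
have [C C0 CP] := sphere_measure_dot_powR_le n0 Np1.
apply: (@le_lt_trans _ _ (\int[sigma]_(v in sphere) ((M `^ m)%:E * (`|dot u v| `^ (- p))%:E))%E).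
  apply: ge0_le_integral => //.
  - apply/measurable_EFinP; apply: measurableT_comp => //.
    by apply: measurable_funTS; exact: measurable_radial_kernel.
  - apply: measurable_funTS; apply: measurable_funeM; apply/measurable_EFinP.
    exact: measurable_dot_powR.
  - move=> v v1 /=; rewrite lee_fin ger0_norm ?radial_kernel_ge0//
      /radial_kernel [leRHS]mulrC ler_wpM2l ?powR_ge0//.
    by case/andP: (radial_powR_bounds v1).
have mdot : measurable_fun sphere (fun v => (`|dot u v| `^ (- p))%:E).
  by apply: measurable_funTS; apply/measurable_EFinP; exact: measurable_dot_powR.
rewrite ge0_integralZl ?lee_fin ?powR_ge0//.
apply: (@le_lt_trans _ _ ((M `^ m)%:E * C%:E)%E); last by rewrite -EFinM ltry.
by apply: lee_wpmul2l; [rewrite lee_fin powR_ge0|exact: CP].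
Qed.

Definition sphere_kernel_integral B u : R := \int[sigma]_(v in sphere) radial_kernel B u v.

(** The radial function is pinched between [r] and [M], and the power of [|u.v|] has a spherical
    integral bounded from both sides uniformly in [u]. *)
Lemma sphere_kernel_integral_bounds : exists lo hi : R, 0 < lo /\
  forall u, sphere u -> lo <= sphere_kernel_integral A u <= hi.
Proof.
have [C C0 CP] := sphere_measure_dot_powR_le n0 Np1.
have [c c0 cP] := sphere_measure_dot_powR_ge n0 (- p).
exists (r `^ m * c), (M `^ m * C); split; first by rewrite mulr_gt0// powR_gt0.
move=> u u1; have iu := integrable_radial_kernel u1.
have iuE : (sphere_kernel_integral A u)%:E = (\int[sigma]_(v in sphere) (radial_kernel A u v)%:E)%E.
  by rewrite /sphere_kernel_integral /Rintegral fineK//; exact: integrable_fin_num.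
have mdot : measurable_fun sphere (fun v => (`|dot u v| `^ (- p))%:E).
  by apply: measurable_funTS; apply/measurable_EFinP; exact: measurable_dot_powR.
have mk : measurable_fun sphere (fun v => (radial_kernel A u v)%:E).
  by apply: measurable_funTS; apply/measurable_EFinP; exact: measurable_radial_kernel.
rewrite -!lee_fin iuE; apply/andP; split.
  apply: (@le_trans _ _ (\int[sigma]_(v in sphere) ((r `^ m)%:E * (`|dot u v| `^ (- p))%:E))%E).
    rewrite ge0_integralZl ?lee_fin ?powR_ge0// EFinM; apply: lee_wpmul2l;
        first by rewrite lee_fin powR_ge0.
    exact: cP.
  apply: ge0_le_integral => //; first by move=> v _; rewrite mule_ge0 ?lee_fin ?powR_ge0.
    exact: measurable_funeM.
  move=> v v1; rewrite -EFinM lee_fin /radial_kernel [leLHS]mulrC ler_wpM2l ?powR_ge0//.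
  by case/andP: (radial_powR_bounds v1).
apply: (@le_trans _ _ (\int[sigma]_(v in sphere) ((M `^ m)%:E * (`|dot u v| `^ (- p))%:E))%E).
  apply: ge0_le_integral => //; first by move=> v _; rewrite lee_fin radial_kernel_ge0.
    exact: measurable_funeM.
  move=> v v1; rewrite -EFinM lee_fin /radial_kernel [leRHS]mulrC ler_wpM2l ?powR_ge0//.
  by case/andP: (radial_powR_bounds v1).
rewrite ge0_integralZl ?lee_fin ?powR_ge0// EFinM; apply: lee_wpmul2l;
    first by rewrite lee_fin powR_ge0.
exact: CP.
Qed.

Lemma Ip_radialE u : sphere u ->
  Ip_radial p A u = ((1 - p) / (2 * m) * sphere_kernel_integral A u) `^ p^-1.
Proof.
move=> u1; have m0 := dimB_gt0; congr (_ `^ _).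
have mA := closed_measurable_rV (star_body_closed sA).
rewrite /Rintegral (@integral_star R n A (radial_fun A) (fun y => `|dot u y| `^ (- p)) (- p))//.
- rewrite (_ : fine _ = sphere_kernel_integral A u / m); last first.
    rewrite /sphere_kernel_integral -RintegralZr//; last exact: integrable_radial_kernel.
    by apply: eq_Rintegral => v _; rewrite /radial_kernel mulrA.
  by field; rewrite gt_eqF.
- move=> v s v1 s0.
  by rewrite (radial_funP sA (sphere_neq0 v1) (ltW s0)).
- exact: (radial_fun_ge0 sA).
- exact: measurable_dot_powR.
- by move=> s x s0; rewrite dotZr normrM powRM// gtr0_norm.
Qed.

Lemma measurable_Ip_radial : measurable_fun setT (Ip_radial p A).
Proof.
apply: (measurableT_comp (measurable_powR p^-1)); apply: measurable_funM => //.
have mA := closed_measurable_rV (star_body_closed sA).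
have mk : measurable_fun [set: 'rV[R]_n * 'rV[R]_n]
    (fun z => (\1_A z.2 * `|dot z.1 z.2| `^ (- p))%:E).
  apply/measurable_EFinP; apply: measurable_funM; last exact: measurable_dot2_powR.
  by apply: (measurableT_comp _ measurable_snd); exact: measurable_indic.
rewrite (_ : (fun x => \int[mu]_(y in A) _) =
    fine \o (fun x => \int[mu]_y (\1_A y * `|dot x y| `^ (- p))%:E)%E); last first.
  apply/funext => x /=; congr fine; rewrite integral_mkcond.
  apply: eq_integral => y _; rewrite patchE indicE.
  by case: ifP => _; rewrite ?mul1r ?mul0r.
apply: (measurableT_comp (fine_measurable measurableT)).
by apply: (@measurable_fun_fubini_tonelli_F _ _ 'rV[R]_n 'rV[R]_n R mu _ mk) => z;
    rewrite lee_fin mulr_ge0 ?powR_ge0.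
Qed.

Lemma volume_Ip : volume (Ip p A) =
  \int[sigma]_(u in sphere) (Ip_radial p A u `^ n%:R / n%:R).
Proof.
have rho0 u : 0 <= Ip_radial p A u by exact: powR_ge0.
have nR : 0 < n%:R :> R by rewrite ltr0n.
have mI := measurable_star_of_radial rho0 n0 measurable_Ip_radial.
rewrite /volume /Rintegral; congr fine.
have := @integral_star R n (Ip p A) (Ip_radial p A) (cst 1) 0 n0 mI.
have -> : (\int[mu]_(x in Ip p A) (cst 1 x)%:E = mu (Ip p A))%E.
  by rewrite -[RHS]mul1e -integral_cst.
rewrite addr0 => -> //.
- by apply: eq_integral => u _; rewrite mul1r.
- by move=> u s u1 s0; exact: star_of_radialP.
- by move=> s x _; rewrite powRr0 mul1r.
Qed.

End body.
End intersection_body.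

(** * The two differentiations *)

Section derivative_of_volume.
Context (R : realType) (n : nat) (p : R) (K : set 'rV[R]_n) (r M : R).
Context (f : 'rV[R]_n -> R) (B : R).
Hypotheses (n0 : (0 < n)%N) (p0 : p != 0) (p1 : p < 1).
Hypothesis sK : star_body K r M.
Hypothesis cK : forall x y t, 0 <= t <= 1 -> K x -> K y -> K (t *: x + (1 - t) *: y).
Hypotheses (B0 : 0 <= B) (fB : forall u, sphere u -> `|f u| <= B).
Hypothesis fc : {within sphere, continuous f}.
Local Notation sigma := (@sphere_measure R n).
Local Notation m := (n%:R - p).
Local Notation rho := (radial_fun K).
Local Notation alpha := (normal_map K).
Local Notation Kt := (log_family K f).
Local Notation A0 := (sphere_kernel_integral p K).
Local Notation At t := (sphere_kernel_integral p (Kt t)).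
Implicit Types (u v : 'rV[R]_n) (t : R).

Definition regular_directions : set 'rV[R]_n := sphere `\` gauge_singular K.
Local Notation D := regular_directions.

Let mS := @measurable_sphere R n.
Let m0 : 0 < m := dimB_gt0 n0 p1.
Let mN := measurable_gauge_singular sK cK.

Lemma measurable_regular_directions : measurable D.
Proof. exact: measurableD. Qed.

Let mD := measurable_regular_directions.

Let sKt t (t1 : `|t| <= 1) := star_body_log_family sK n0 fB t1.

Lemma Rintegral_regular (h : 'rV[R]_n -> R) : sigma.-integrable sphere (EFin \o h) ->
  \int[sigma]_(v in sphere) h v = \int[sigma]_(v in D) h v.
Proof.
move=> ih; rewrite /Rintegral (negligible_integral mN mS ih)//.
exact: (sphere_gauge_singular sK cK).
Qed.

Lemma integrable_regular (h : 'rV[R]_n -> \bar R) : sigma.-integrable sphere h ->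
  sigma.-integrable D h.
Proof. by apply: integrableS => // v []. Qed.

Lemma measurable_fun_normal : measurable_fun D (f \o alpha).
Proof.
apply: (measurable_comp mS).
- by move=> _ [v [v1 vN] <-]; exact: (sphere_normal_map sK cK v1 vN).
- by apply: measurable_fun_within_continuous => //; exact: closed_sphere.
- by apply: measurable_funTS; exact: (measurable_normal_map sK cK).
Qed.

Let y t v := radial_fun (Kt t) v / rho v.

Let rho_gt0 v : sphere v -> 0 < rho v.
Proof. by move=> v1; apply: (radial_fun_gt0 sK); exact: sphere_neq0. Qed.

Let y_gt0 t v : D v -> `|t| <= 1 -> 0 < y t v.
Proof.
move=> [v1 _] t1; rewrite divr_gt0 ?rho_gt0//.
by apply: (radial_fun_gt0 (sKt t1)); exact: sphere_neq0.
Qed.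

Let y_bound t v : D v -> `|t| <= 1 -> `|ln (y t v)| <= B * `|t|.
Proof. by move=> [v1 vN]; exact: (ln_log_family_radial_bound sK cK). Qed.

Let y_cvg v : D v -> ln (y t v) / t @[t --> 0^'] --> (f \o alpha) v.
Proof. by move=> [v1 vN]; exact: (ln_log_family_radial_cvg sK cK v1 vN n0 B0 fB fc). Qed.

Let measurable_y t : `|t| <= 1 -> measurable_fun D (y t).
Proof.
move=> t1; apply: measurable_funTS; apply: measurable_funM.
  exact: (measurable_radial_fun (sKt t1)).
exact: (measurable_gauge sK).
Qed.

Let kernel_y t u v : D v -> `|t| <= 1 ->
  radial_kernel p K u v * y t v `^ m = radial_kernel p (Kt t) u v.
Proof.
move=> Dv t1; have [v1 _] := Dv.
rewrite /radial_kernel -mulrA; congr (_ * _).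
rewrite -powRM ?(ltW (rho_gt0 v1)) ?(ltW (y_gt0 Dv t1))//.
by rewrite /y mulrC divfK// gt_eqF// rho_gt0.
Qed.

Definition kernel_variation u :=
  \int[sigma]_(v in D) (radial_kernel p K u v * (m * f (alpha v))).
Local Notation A1 := kernel_variation.

Let AtE t u : sphere u -> `|t| <= 1 ->
  At t u = \int[sigma]_(v in D) (radial_kernel p K u v * y t v `^ m).
Proof.
move=> u1 t1; rewrite /sphere_kernel_integral Rintegral_regular; last first.
  exact: (integrable_radial_kernel n0 p1 (sKt t1)).
by apply: eq_Rintegral => v /set_mem Dv; rewrite kernel_y.
Qed.

Let A0E u : sphere u -> A0 u = \int[sigma]_(v in D) radial_kernel p K u v.
Proof.
move=> u1; rewrite /sphere_kernel_integral Rintegral_regular//.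
exact: (integrable_radial_kernel n0 p1 sK).
Qed.

Let inner u : sphere u -> sigma.-integrable D
    (EFin \o (fun v => radial_kernel p K u v * (m * f (alpha v)))) /\
  (At t u - A0 u) / t @[t --> 0^'] --> A1 u.
Proof.
move=> u1; have iu := integrable_regular (integrable_radial_kernel n0 p1 sK u1).
have [iA1 h] := @deriv_integral_powR R _ _ sigma D (radial_kernel p K u) y (f \o alpha) m B
  mD iu measurable_y measurable_fun_normal B0 y_gt0 y_bound y_cvg.
split => //; move: h; apply: cvg_trans; apply: near_eq_cvg.
apply: (@dnbhs0P _ _ 1) => // t _ /ltW t1.
by rewrite (AtE u1 t1) (A0E u1).
Qed.

Lemma integrable_kernel_variation u : sphere u -> sigma.-integrable D
  (EFin \o (fun v => radial_kernel p K u v * (m * f (alpha v)))).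
Proof. by move=> /inner[]. Qed.

Let A0_gt0 u : sphere u -> 0 < A0 u.
Proof.
have [lo [hi [lo0 bnd]]] := sphere_kernel_integral_bounds n0 p1 sK.
by move=> /bnd/andP[+ _]; exact: lt_le_trans.
Qed.

Let At_gt0 t u : sphere u -> `|t| <= 1 -> 0 < At t u.
Proof.
move=> u1 t1; have [lo [hi [lo0 bnd]]] := sphere_kernel_integral_bounds n0 p1 (sKt t1).
by have /andP[+ _] := bnd u u1; exact: lt_le_trans.
Qed.

Let z t u := At t u / A0 u.

Let z_gt0 t u : sphere u -> `|t| <= 1 -> 0 < z t u.
Proof. by move=> u1 t1; apply: divr_gt0; [exact: At_gt0|exact: A0_gt0]. Qed.

(** [z t u] is the mean of [y t v ^ m] with respect to the kernel of [K], so it stays within the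
    pointwise bounds [exp(- m B |t|)] and [exp(m B |t|)] of the averaged function. *)
Let z_bound t u : sphere u -> `|t| <= 1 -> `|ln (z t u)| <= m * B * `|t|.
Proof.
move=> u1 t1; have iK := integrable_regular (integrable_radial_kernel n0 p1 sK u1).
have iKt : sigma.-integrable D (EFin \o (fun v => radial_kernel p K u v * y t v `^ m)).
  have := integrable_regular (integrable_radial_kernel n0 p1 (sKt t1) u1).
  by apply: eq_integrable => // v /set_mem Dv /=; rewrite kernel_y.
have iKc c : sigma.-integrable D (EFin \o (fun v => radial_kernel p K u v * c)).
  have := integrableZr mD c iK.
  by apply: eq_integrable => // v _ /=; rewrite EFinM.
have yexp v : D v -> expR (- (m * B * `|t|)) <= y t v `^ m <= expR (m * B * `|t|).
  move=> Dv; rewrite powR_expR ?y_gt0// !ler_expR -ler_norml normrM gtr0_norm//.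
  by rewrite -mulrA ler_pM2l// y_bound.
rewrite ler_norml; apply/andP; split.
  rewrite -[leLHS]expRK ler_ln ?posrE ?expR_gt0 ?(z_gt0 u1 t1)// ler_pdivlMr ?(A0_gt0 u1)//.
  rewrite (AtE u1 t1) (A0E u1) mulrC -RintegralZr//; apply: le_Rintegral => //.
  move=> v Dv; rewrite ler_wpM2l ?radial_kernel_ge0//.
  by case/andP: (yexp v Dv).
rewrite -[leRHS]expRK ler_ln ?posrE ?expR_gt0 ?(z_gt0 u1 t1)// ler_pdivrMr ?(A0_gt0 u1)//.
rewrite (AtE u1 t1) (A0E u1) mulrC -RintegralZr//; apply: le_Rintegral => //.
move=> v Dv; rewrite ler_wpM2l ?radial_kernel_ge0//.
by case/andP: (yexp v Dv).
Qed.

Let z_cvg u : sphere u -> ln (z t u) / t @[t --> 0^'] --> A1 u / A0 u.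
Proof.
move=> u1; apply: cvg_ln_quotient => [t t1|]; first exact: z_gt0.
have [_ h] := inner u1.
have : (At t u - A0 u) / t / A0 u @[t --> 0^'] --> A1 u / A0 u by exact: cvgMr_tmp h.
apply: cvg_trans; apply: near_eq_cvg; apply: nearW => t; rewrite /z.
move: (At t u) (A0 u) (A0_gt0 u1) => b c c_gt0.
by rewrite mulrAC mulrBl (mulfV (x := c))// gt_eqF.
Qed.

Lemma measurable_sphere_kernel_integral (A : set 'rV[R]_n) r' M' :
  star_body A r' M' -> measurable_fun setT (sphere_kernel_integral p A).
Proof.
move=> sA; have mk : measurable_fun [set: 'rV[R]_n * 'rV[R]_n]
    (fun w => (\1_(@sphere R n) w.2 * radial_kernel p A w.1 w.2)%:E).
  apply/measurable_EFinP; apply: measurable_funM.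
    by apply: (measurableT_comp _ measurable_snd); exact: measurable_indic.
  apply: measurable_funM; first exact: measurable_dot2_powR.
  apply: (measurableT_comp (measurable_powR m)).
  exact: (measurableT_comp (measurable_radial_fun sA) measurable_snd).
rewrite (_ : sphere_kernel_integral p A = fine \o
    (fun u => \int[sigma]_v (\1_(@sphere R n) v * radial_kernel p A u v)%:E)%E); last first.
  apply/funext => u /=; congr fine; rewrite integral_mkcond.
  apply: eq_integral => v _; rewrite patchE indicE.
  by case: ifP => _; rewrite ?mul1r ?mul0r.
apply: (measurableT_comp (fine_measurable measurableT)).
apply: (@measurable_fun_fubini_tonelli_F _ _ 'rV[R]_n 'rV[R]_n R sigma _ mk) => w.
by rewrite lee_fin mulr_ge0 ?radial_kernel_ge0.
Qed.

(** It is the pointwise limit of the measurable difference quotients of [A_t] along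
    [t = 1 / (k + 1)]. *)
Lemma measurable_kernel_variation : measurable_fun sphere A1.
Proof.
apply: (@measurable_fun_cvg _ _ _ _
  (fun k u => (At (k.+1%:R^-1) u - A0 u) / k.+1%:R^-1)) => [k|u u1].
  have k1 : `|k.+1%:R^-1 : R| <= 1 by rewrite ger0_norm// invf_le1// ler1n.
  apply: measurable_funTS; apply: measurable_funM => //; apply: measurable_funB.
    exact: (measurable_sphere_kernel_integral (sKt k1)).
  exact: (measurable_sphere_kernel_integral sK).
have [_ /cvgr_dnbhsP/(_ (@harmonic R))] := inner u1; apply; split.
  by move=> k; rewrite /harmonic/= invr_eq0 pnatr_eq0.
exact: cvg_harmonic.
Qed.

Let a := n%:R / p.
Let c0 := (1 - p) / (2 * m).

Let c0_gt0 : 0 < c0.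
Proof. by rewrite divr_gt0 ?mulr_gt0// subr_gt0. Qed.

(** On the sphere this is the [n]-th power of the radial function of [Ip p K]. *)
Let w u := (c0 * A0 u) `^ a.

Let powR_kernel_bounded (A : set 'rV[R]_n) r' M' b : star_body A r' M' ->
  exists2 E : R, 0 <= E & forall u, sphere u ->
    (c0 * sphere_kernel_integral p A u) `^ b <= E.
Proof.
move=> sA; have [lo [hi [lo0 bnd]]] := sphere_kernel_integral_bounds n0 p1 sA.
exists ((c0 * lo) `^ b + (c0 * hi) `^ b); first by rewrite addr_ge0 ?powR_ge0.
move=> u /bnd/andP[ulo uhi].
by apply: powR_le_add_bounds; [exact: mulr_gt0|exact: ler_wpM2l (ltW c0_gt0) _ _ ulo|
  exact: ler_wpM2l (ltW c0_gt0) _ _ uhi].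
Qed.

Let integrable_volume_density (A : set 'rV[R]_n) r' M' : star_body A r' M' ->
  sigma.-integrable sphere (EFin \o (fun u => (c0 * sphere_kernel_integral p A u) `^ a)).
Proof.
move=> sA; have [E E0 EP] := powR_kernel_bounded a sA.
apply: measurable_bounded_integrable => //.
- by rewrite -ge0_fin_numE// fin_num_measure.
- apply: measurable_funTS; apply: (measurableT_comp (measurable_powR a)).
  by apply: measurable_funM => //; exact: (measurable_sphere_kernel_integral sA).
exists E; split; first exact: num_real.
move=> F EF u u1; by apply: le_trans (ltW EF); rewrite ger0_norm ?powR_ge0// EP.
Qed.

Let integrable_w : sigma.-integrable sphere (EFin \o w).
Proof. exact: integrable_volume_density sK. Qed.

Lemma Ip_radial_powR (A : set 'rV[R]_n) r' M' u (b : R) : star_body A r' M' -> sphere u ->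
  Ip_radial p A u `^ b = (c0 * sphere_kernel_integral p A u) `^ (b / p).
Proof. by move=> sA u1; rewrite (Ip_radialE n0 p1 sA u1) -powRrM (mulrC b). Qed.

Lemma Ip_radial_powR_bounded (A : set 'rV[R]_n) r' M' b : star_body A r' M' ->
  exists2 E : R, 0 <= E & forall u, sphere u -> Ip_radial p A u `^ b <= E.
Proof.
move=> sA; have [E E0 EP] := powR_kernel_bounded (b / p) sA.
by exists E => // u u1; rewrite (Ip_radial_powR _ sA u1) EP.
Qed.

Let volume_IpE (A : set 'rV[R]_n) r' M' : star_body A r' M' -> volume (Ip p A) =
  (\int[sigma]_(u in sphere) (c0 * sphere_kernel_integral p A u) `^ a) / n%:R.
Proof.
move=> sA; rewrite (volume_Ip p n0 sA).
rewrite -(@RintegralZr _ _ _ sigma sphere _ n%:R^-1 mS (integrable_volume_density sA)).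
apply: eq_Rintegral => u /set_mem u1.
by rewrite (Ip_radial_powR n%:R sA u1).
Qed.

(** The second use of [deriv_integral_powR], with weight [w], ratio [z] and exponent [n / p]; [w]
    times [z t] to that power is the volume density of the body at time [t]. *)
Lemma cvg_volume_Ip :
  (volume (Ip p (Kt t)) - volume (Ip p K)) / t @[t --> 0^'] -->
  (\int[sigma]_(u in sphere) ((c0 * A0 u) `^ a * (a * (A1 u / A0 u)))) / n%:R.
Proof.
have nR : n%:R != 0 :> R by rewrite pnatr_eq0 -lt0n.
have mz t : `|t| <= 1 -> measurable_fun sphere (z t).
  move=> t1; apply: measurable_funTS; rewrite (_ : z t = (fun u => At t u * A0 u `^ (-1))).
    apply: measurable_funM; first exact: (measurable_sphere_kernel_integral (sKt t1)).
    apply: (measurableT_comp (measurable_powR (- 1))).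
    exact: (measurable_sphere_kernel_integral sK).
  apply/funext => u; rewrite powR_inv1//; apply: Rintegral_ge0 => v _.
  exact: radial_kernel_ge0.
have mb : measurable_fun sphere (fun u => A1 u / A0 u).
  rewrite (_ : (fun u => _) = (fun u => A1 u * A0 u `^ (-1))).
    apply: measurable_funM; first exact: measurable_kernel_variation.
    apply: measurable_funTS; apply: (measurableT_comp (measurable_powR (- 1))).
    exact: (measurable_sphere_kernel_integral sK).
  apply/funext => u; rewrite powR_inv1//; apply: Rintegral_ge0 => v _.
  exact: radial_kernel_ge0.
have mB0 : 0 <= m * B by rewrite mulr_ge0// ltW.
have [_ h] := @deriv_integral_powR R _ _ sigma sphere w z (fun u => A1 u / A0 u) a (m * B)
  mS integrable_w mz mb mB0 z_gt0 z_bound z_cvg.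
apply: cvg_trans (cvgMr_tmp (b := n%:R^-1) h); apply: near_eq_cvg.
apply: (@dnbhs0P _ _ 1) => // t _ /ltW t1.
transitivity (((\int[sigma]_(u in sphere) (c0 * At t u) `^ a) / n%:R -
    (\int[sigma]_(u in sphere) (c0 * A0 u) `^ a) / n%:R) / t); last first.
  by apply/esym; congr ((_ - _) / _); [exact: volume_IpE (sKt t1)|exact: volume_IpE sK].
rewrite -mulrBl mulrAC; congr (_ / _ / _).
congr (_ - _); apply: eq_Rintegral => u /set_mem u1.
rewrite /w /z; move: (At t u) (A0 u) (A0_gt0 u1) (At_gt0 u1 t1) => b c c_gt0 b_gt0.
rewrite -powRM ?(ltW (mulr_gt0 c0_gt0 c_gt0)) ?(ltW (divr_gt0 b_gt0 c_gt0))//.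
by congr (_ `^ _); field; rewrite gt_eqF.
Qed.

End derivative_of_volume.

(** * The curvature measure *)

Section integral_domain.
Context d (T : measurableType d) (R : realType).
Variable mu : {measure set T -> \bar R}.
Implicit Types (E N : set T) (f : T -> \bar R).
Local Open Scope ereal_scope.

(** A comparison of suprema over simple functions, hence valid for arbitrary sets; the reverse
    radial Gauss image may fail to be Borel. *)
Lemma ge0_le_integral_domain E1 E2 f : (forall x, 0 <= f x) -> E1 `<=` E2 ->
  \int[mu]_(x in E1) f x <= \int[mu]_(x in E2) f x.
Proof.
move=> f0 E12; rewrite !ge0_integralE//; apply: le_ereal_sup.
move=> _ [h /= hf <-]; exists h => // x; apply: le_trans (hf x) _.
rewrite !patchE; case: ifPn => [/set_mem/E12/mem_set ->//|_].
by case: ifP.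
Qed.

Lemma ge0_integral_null_sandwich E1 E2 N f : measurable E2 -> measurable N ->
  mu N = 0 -> measurable_fun setT f -> (forall x, 0 <= f x) ->
  E2 `<=` E1 -> E1 `<=` E2 `|` N -> \int[mu]_(x in E1) f x = \int[mu]_(x in E2) f x.
Proof.
move=> mE2 mN N0 mf f0 E21 E12; apply/eqP; rewrite eq_le; apply/andP; split; last first.
  exact: ge0_le_integral_domain.
apply: (le_trans (ge0_le_integral_domain f0 E12)).
have mU : measurable (E2 `|` N) by exact: measurableU.
rewrite (ge0_negligible_integral mN mU)//; last exact: measurable_funTS.
by apply: ge0_le_integral_domain => // x [[]].
Qed.

End integral_domain.

(** * The curvature measure as an image under the normal map *)

Section curvature_measure.
Context (R : realType) (n : nat) (p : R) (K : set 'rV[R]_n) (r M : R).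
Context (f : 'rV[R]_n -> R) (B : R).
Hypotheses (n0 : (0 < n)%N) (p0 : p != 0) (p1 : p < 1).
Hypothesis sK : star_body K r M.
Hypothesis cK : forall x y t, 0 <= t <= 1 -> K x -> K y -> K (t *: x + (1 - t) *: y).
Hypotheses (B0 : 0 <= B) (fB : forall u, sphere u -> `|f u| <= B).
Hypothesis fc : {within sphere, continuous f}.
Local Notation sigma := (@sphere_measure R n).
Local Notation m := (n%:R - p).
Local Notation rho := (radial_fun K).
Local Notation alpha := (normal_map K).
Local Notation D := (regular_directions K).
Local Notation A0 := (sphere_kernel_integral p K).
Local Notation A1 := (kernel_variation p K f).
Local Notation rhoI := (Ip_radial p K).
Implicit Types (u v : 'rV[R]_n) (t : R).

Let mS := @measurable_sphere R n.
Let m0 : 0 < m := dimB_gt0 n0 p1.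
Let mN := measurable_gauge_singular sK cK.
Let mD := measurable_regular_directions sK cK.

Let T v := cosine_transform (- p) (fun u => radial_fun (Ip p K) u `^ m) v.

Let TE v : T v = \int[sigma]_(u in sphere) (rhoI u `^ m * `|dot v u| `^ (- p)).
Proof.
apply: eq_Rintegral => u /set_mem u1; rewrite radial_star_of_radial// => w.
exact: powR_ge0.
Qed.

Let mrhoIm : measurable_fun setT (fun u => rhoI u `^ m).
Proof. exact: (measurableT_comp (measurable_powR m) (measurable_Ip_radial p sK)). Qed.

Let mrhom : measurable_fun setT (fun v => rho v `^ m).
Proof. exact: (measurableT_comp (measurable_powR m) (measurable_radial_fun sK)). Qed.

Let T_ge0 v : 0 <= T v.
Proof. by rewrite TE; apply: Rintegral_ge0 => u _; rewrite mulr_ge0 ?powR_ge0. Qed.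

Let mT : measurable_fun setT T.
Proof.
have mk : measurable_fun [set: 'rV[R]_n * 'rV[R]_n]
    (fun w => (\1_(@sphere R n) w.2 * (rhoI w.2 `^ m * `|dot w.1 w.2| `^ (- p)))%:E).
  apply/measurable_EFinP; apply: measurable_funM.
    by apply: (measurableT_comp _ measurable_snd); exact: measurable_indic.
  apply: measurable_funM; last exact: measurable_dot2_powR.
  exact: (measurableT_comp mrhoIm measurable_snd).
rewrite (_ : T = fine \o
    (fun v => \int[sigma]_u (\1_(@sphere R n) u * (rhoI u `^ m * `|dot v u| `^ (- p)))%:E)%E);
        last first.
  apply/funext => v /=; rewrite TE; congr fine; rewrite integral_mkcond.
  apply: eq_integral => u _; rewrite patchE indicE.
  by case: ifP => _; rewrite ?mul1r ?mul0r.
apply: (measurableT_comp (fine_measurable measurableT)).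
apply: (@measurable_fun_fubini_tonelli_F _ _ 'rV[R]_n 'rV[R]_n R sigma _ mk) => w.
by rewrite lee_fin !mulr_ge0 ?powR_ge0.
Qed.

Let c : R := (1 - p) / (2 * `|p|).

Let c_ge0 : 0 <= c.
Proof. by rewrite divr_ge0 ?mulr_ge0// subr_ge0 ltW. Qed.

(** The indicator removes the directions at which the value of [alpha] has no meaning. *)
Let density v := \1_D v * (c * (rho v `^ m * T v)).

Let density_ge0 v : 0 <= density v.
Proof. exact: mulr_ge0 (ler0n _ _) (mulr_ge0 c_ge0 (mulr_ge0 (powR_ge0 _ _) (T_ge0 v))). Qed.

Let mrhoT : measurable_fun setT (fun v => rho v `^ m * T v).
Proof. exact: measurable_funM. Qed.

Let mdensity : measurable_fun setT density.
Proof.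
apply: measurable_funM; first exact: measurable_indic.
exact: measurable_funM.
Qed.

Let malpha := measurable_normal_map sK cK.

(** The reverse radial Gauss image contains the regular part of the preimage of [eta] under [alpha],
    by [normal_mapP], and exceeds it only by singular directions, by [normal_map_unique]. *)
Lemma affine_dual_curvature_measureE (eta : set 'rV[R]_n) : measurable eta ->
  affine_dual_curvature_measure p K eta =
  (\int[sigma]_(v in alpha @^-1` eta) (density v)%:E)%E.
Proof.
move=> meta; have mpre : measurable (alpha @^-1` eta).
  by rewrite -[X in measurable X]setTI; exact: malpha.
have mE2 : measurable (alpha @^-1` eta `&` D) by exact: measurableI.
have mrhoTE : measurable_fun setT (fun v => (rho v `^ m * T v)%:E).
  exact/measurable_EFinP.
rewrite /affine_dual_curvature_measure.
rewrite (@ge0_integral_null_sandwich _ _ _ sigma _ (alpha @^-1` eta `&` D) (gauge_singular K))//.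
- rewrite -ge0_integralZl//; last 2 first.
  + exact: (measurable_funTS mrhoTE).
  + by move=> v _; rewrite lee_fin mulr_ge0 ?powR_ge0.
  rewrite integral_mkcondr; apply: eq_integral => v _.
  rewrite patchE /density indicE; case: ifP => _; last by rewrite mul0r.
  by rewrite mul1r -EFinM.
- exact: (sphere_gauge_singular sK cK).
- by move=> v; rewrite lee_fin mulr_ge0 ?powR_ge0.
- move=> v [va [v1 vN]]; exists (alpha v).
    by split=> //; exact: (sphere_normal_map sK cK v1 vN).
  by split => //; exact: (normal_mapP sK cK v1 vN).
- move=> v [w [etaw w1] [v1 vw]].
  have [vN|vN] := pselect (gauge_singular K v); first by right.
  left; split; last by [].
  by rewrite /= -(normal_map_unique sK v1 vN w1 vw).
Qed.

(** Extension by zero makes [f] of the normal a measurable function on the whole space, bounded by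
    [B]. *)
Let F v : R := if v \in D then f (alpha v) else 0.

Let mF : measurable_fun setT F.
Proof.
have /(measurable_restrictT _ mD) := measurable_fun_normal sK cK fc.
by congr (measurable_fun _ _).
Qed.

Lemma integral_affine_dual_curvature_measure :
  (\int[affine_dual_curvature_measure p K]_(u in sphere) (f u)%:E =
   \int[sigma]_v (c * (F v * (rho v `^ m * T v)))%:E)%E.
Proof.
have mf : measurable_fun sphere (EFin \o f).
  apply/measurable_EFinP; apply: measurable_fun_within_continuous => //.
  exact: closed_sphere.
rewrite (@integral_density_pushforward _ _ _ _ R sigma alpha density malpha mdensity density_ge0
  (affine_dual_curvature_measure p K) affine_dual_curvature_measureE sphere (EFin \o f) mS mf).
rewrite integral_mkcond; apply: eq_integral => v _; rewrite patchE /= /density /F indicE.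
have [Dv|Dv] := boolP (v \in D).
  have [v1 vN] := set_mem Dv.
  rewrite mem_set/=; last exact: (sphere_normal_map sK cK v1 vN).
  by rewrite -EFinM; congr EFin; ring.
by case: ifP => _; rewrite ?mul0r ?mulr0 ?mule0.
Qed.

Let Phi (z : 'rV[R]_n * 'rV[R]_n) : R :=
  \1_(@sphere R n) z.1 * (rhoI z.1 `^ m * (`|dot z.1 z.2| `^ (- p) * (rho z.2 `^ m * F z.2))).

Let mPhi : measurable_fun setT Phi.
Proof.
apply: measurable_funM.
  by apply: (measurableT_comp _ measurable_fst); exact: measurable_indic.
apply: measurable_funM; first exact: (measurableT_comp mrhoIm measurable_fst).
apply: measurable_funM; first exact: measurable_dot2_powR.
apply: measurable_funM; first exact: (measurableT_comp mrhom measurable_snd).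
exact: (measurableT_comp mF measurable_snd).
Qed.

Let F_le v : `|F v| <= B * \1_(@sphere R n) v.
Proof.
rewrite /F indicE; case: ifPn => [/set_mem[v1 vN]|_]; last by rewrite normr0 mulr_ge0.
rewrite (mem_set v1) mulr1; apply: fB; exact: (sphere_normal_map sK cK v1 vN).
Qed.

Let F_out v : ~ D v -> F v = 0.
Proof. by move=> Dv; rewrite /F memNset. Qed.

Let F_in v : D v -> F v = f (alpha v).
Proof. by move=> Dv; rewrite /F mem_set. Qed.

Let Phi_out u v : ~ sphere u -> Phi (u, v) = 0.
Proof. by move=> u1; rewrite /Phi indicE memNset// mul0r. Qed.

Let PhiE u v : sphere u ->
  Phi (u, v) = rhoI u `^ m * (radial_kernel p K u v * F v).
Proof. by move=> u1; rewrite /Phi indicE mem_set// mul1r /radial_kernel -[in RHS]mulrA. Qed.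

Let kernelE u : sphere u ->
  (\int[sigma]_(v in sphere) (radial_kernel p K u v)%:E = (A0 u)%:E)%E.
Proof.
move=> u1; rewrite /sphere_kernel_integral /Rintegral fineK//.
exact: integrable_fin_num (integrable_radial_kernel n0 p1 sK u1).
Qed.

(** Since [f] is signed, Fubini requires this. The power of the radial function of [Ip p K] is
    bounded by [E], [F] by [B], and the remaining kernel integrates to at most [hi] for every [u] on
    the sphere. *)
Let iPhi : (sigma \x sigma)%E.-integrable setT (EFin \o Phi).
Proof.
apply/integrable12ltyP; first exact/measurable_EFinP.
have [E E0 EP] := Ip_radial_powR_bounded n0 p1 m sK.
have [lo [hi [lo0 bnd]]] := sphere_kernel_integral_bounds n0 p1 sK.
have mabs : measurable_fun [set: 'rV[R]_n * 'rV[R]_n] (fun z => `|(Phi z)%:E|%E).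
  by apply: measurableT_comp => //; exact/measurable_EFinP.
have EB0 : 0 <= E * B by rewrite mulr_ge0.
(* The absolute value keeps the constant nonnegative for [u] off the sphere too, where [bnd] says
   nothing. *)
apply: (@le_lt_trans _ _ (\int[sigma]_(u in setT) (cst (E * B * `|hi|)%:E u))%E); last first.
  rewrite integral_cst// lte_mul_pinfty// ?lee_fin ?mulr_ge0//.
  by rewrite -ge0_fin_numE// fin_num_measure.
apply: ge0_le_integral => //.
- by move=> u _; apply: integral_ge0.
- apply: (@measurable_fun_fubini_tonelli_F _ _ 'rV[R]_n 'rV[R]_n R sigma _ mabs) => z.
  exact: abse_ge0.
move=> u _ /=.
have [u1|u1] := pselect (sphere u); last first.
  rewrite integral0_eq ?lee_fin ?mulr_ge0// => v _.
  by rewrite Phi_out// normr0.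
have mk : measurable_fun sphere (fun v => (radial_kernel p K u v)%:E).
  apply: measurable_funTS; apply/measurable_EFinP.
  exact: (measurable_radial_kernel p sK).
apply: (@le_trans _ _ (\int[sigma]_(v in sphere) ((E * B)%:E * (radial_kernel p K u v)%:E))%E).
  rewrite [leRHS]integral_mkcond; apply: ge0_le_integral => //.
  - exact: (measurableT_comp mabs (pair1_measurable u)).
  - by apply/(measurable_restrictT _ mS); exact: (measurable_funeM _ mk).
  - move=> v _; rewrite PhiE// patchE; case: ifPn => [_|vS]; last first.
      rewrite F_out ?mulr0 ?normr0//.
      by move=> [/mem_set v1 _]; rewrite v1 in vS.
    rewrite -EFinM lee_fin normrM ger0_norm ?powR_ge0//.
    rewrite normrM ger0_norm ?radial_kernel_ge0// mulrCA [leRHS]mulrC.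
    rewrite ler_wpM2l ?radial_kernel_ge0// ler_pM ?powR_ge0 ?EP//.
    by apply: (le_trans (F_le v)); rewrite -[leRHS]mulr1 ler_wpM2l// indicE.
rewrite ge0_integralZl ?lee_fin//; last first.
  by move=> v _; rewrite lee_fin radial_kernel_ge0.
rewrite kernelE// -EFinM lee_fin ler_wpM2l//.
by have /andP[_ h2] := bnd u u1; apply: le_trans h2 (ler_norm _).
Qed.

(** The integral of [Phi] over [v]; dividing by [m] undoes the factor [m] built into
    [kernel_variation]. *)
Let H u : R := \1_(@sphere R n) u * (rhoI u `^ m * A1 u / m).

Let integral_Phi1 u : (\int[sigma]_v (Phi (u, v))%:E = (H u)%:E)%E.
Proof.
rewrite /H indicE; have [u1|u1] := pselect (sphere u); last first.
  by rewrite memNset// mul0r integral0_eq// => v _; rewrite Phi_out.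
rewrite mem_set// mul1r.
have iA := integrable_kernel_variation n0 p1 sK cK B0 fB fc u1.
have AE : (A1 u)%:E = (\int[sigma]_(v in D) (radial_kernel p K u v * (m * f (alpha v)))%:E)%E.
  by rewrite /kernel_variation /Rintegral fineK//; exact: integrable_fin_num.
rewrite mulrAC EFinM AE -integralZl// integral_mkcond.
apply: eq_integral => v _; rewrite patchE; case: ifPn => [/set_mem Dv|Dv].
  rewrite PhiE// F_in// -EFinM; congr EFin; field.
  by rewrite gt_eqF.
by rewrite PhiE// F_out ?mulr0// => /mem_set Dv'; rewrite Dv' in Dv.
Qed.

(** On the sphere the power of the radial function of [Ip p K] is at most [E], and [r^m <= rho^m],
    so the integrand is at most [E / r^m] times the kernel of [K]. *)
Let integrable_T v : sphere v ->
  sigma.-integrable sphere (EFin \o (fun u => rhoI u `^ m * `|dot v u| `^ (- p))).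
Proof.
move=> v1; have [E E0 EP] := Ip_radial_powR_bounded n0 p1 m sK.
have r0 := star_body_r sK; have rm0 : 0 < r `^ m by rewrite powR_gt0.
have := integrableZl mS (E / r `^ m) (integrable_radial_kernel n0 p1 sK v1).
apply: le_integrable => //.
  apply/measurable_EFinP; apply: measurable_funTS; apply: measurable_funM => //.
  exact: measurable_dot_powR.
move=> u u1 /=; rewrite lee_fin ger0_norm ?mulr_ge0 ?powR_ge0//.
rewrite (ger0_norm (mulr_ge0 (divr_ge0 E0 (ltW rm0)) (radial_kernel_ge0 p K v u))).
rewrite /radial_kernel mulrCA mulrC ler_wpM2l ?powR_ge0//.
have /andP[rr _] := radial_powR_bounds n0 p1 sK u1.
rewrite -mulrA; apply: (le_trans (EP u u1)).
by rewrite ler_peMr// mulrC ler_pdivlMr// mul1r.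
Qed.

Let integral_Phi2 v :
  (\int[sigma]_u (Phi (u, v))%:E = (F v * (rho v `^ m * T v))%:E)%E.
Proof.
have [Dv|Dv] := pselect (D v); last first.
  rewrite F_out// mul0r integral0_eq// => u _.
  by rewrite /Phi F_out// !mulr0.
have [v1 _] := Dv; have iT := integrable_T v1.
have TEE : (T v)%:E = (\int[sigma]_(u in sphere) (rhoI u `^ m * `|dot v u| `^ (- p))%:E)%E.
  by rewrite TE /Rintegral fineK//; exact: integrable_fin_num.
rewrite mulrA EFinM TEE -integralZl// integral_mkcond.
apply: eq_integral => u _; rewrite patchE; case: ifPn => [/set_mem u1|u1].
  rewrite PhiE// /radial_kernel -EFinM dotC; congr EFin; ring.
by rewrite Phi_out// => /mem_set u1'; rewrite u1' in u1.
Qed.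

Let Phi_fubini : (\int[sigma]_v (F v * (rho v `^ m * T v))%:E = \int[sigma]_u (H u)%:E)%E.
Proof.
transitivity (\int[sigma]_v \int[sigma]_u (Phi (u, v))%:E)%E.
  by apply: eq_integral => v _; rewrite integral_Phi2.
transitivity (\int[sigma]_u \int[sigma]_v (Phi (u, v))%:E)%E.
  exact/esym/(@Fubini _ _ _ _ _ _ _ _ iPhi).
by apply: eq_integral => u _; rewrite integral_Phi1.
Qed.

Let integrable_H : sigma.-integrable setT (EFin \o H).
Proof.
have := integrable_fubini_F iPhi; apply: eq_integrable => // u _.
by rewrite /fubini_F /= integral_Phi1.
Qed.

Let integrable_G : sigma.-integrable setT (fun v => (F v * (rho v `^ m * T v))%:E).
Proof.
have mEPhi : measurable_fun setT (EFin \o Phi) by exact/measurable_EFinP.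
apply/integrableP; split.
  have := measurable_fubini_G iPhi; congr (measurable_fun _ _).
  by apply/funext => v; rewrite /fubini_G /= integral_Phi2.
apply: le_lt_trans ((integrable21ltyP sigma sigma mEPhi).1 iPhi).
have mabs : measurable_fun [set: 'rV[R]_n * 'rV[R]_n] (fun z => `|(Phi z)%:E|%E).
  by apply: measurableT_comp.
apply: ge0_le_integral => //.
- by apply: measurableT_comp => //; apply/measurable_EFinP; apply: measurable_funM => //;
    exact: measurable_funM.
- apply: (@measurable_fun_fubini_tonelli_G _ _ 'rV[R]_n 'rV[R]_n R sigma _ mabs) => z.
  exact: abse_ge0.
- move=> v _; rewrite -integral_Phi2; apply: le_abse_integral => //.
  exact: (measurableT_comp mEPhi (pair2_measurable v)).
Qed.

(** With [x = (1 - p) / (2 m) A_0], writing [x^(n/p) = x^(m/p) x] cancels [A_0]; [x^(m/p)] is the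
    [m]-th power of the radial function of [Ip p K]. The two factors [n] cancel, what remains is
    [(1 - p) / (2 p)] times [H], and [sgn p] turns [|p|] into [p]. *)
Lemma Rintegral_volume_variation :
  ((\int[sigma]_(u in sphere) (((1 - p) / (2 * m) * A0 u) `^ (n%:R / p) *
     (n%:R / p * (A1 u / A0 u))) / n%:R)%:E =
  (Num.sg p)%:E * \int[affine_dual_curvature_measure p K]_(u in sphere) (f u)%:E)%E.
Proof.
rewrite integral_affine_dual_curvature_measure.
under [X in (_ * X)%E]eq_integral do rewrite EFinM.
rewrite integralZl// Phi_fubini.
have nR : n%:R != 0 :> R by rewrite pnatr_eq0 -lt0n.
have iHS : sigma.-integrable sphere (EFin \o H) by exact: integrableS integrable_H.
have -> : (\int[sigma]_u (H u)%:E = (\int[sigma]_(u in sphere) H u)%:E)%E.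
  rewrite /Rintegral fineK; last exact: integrable_fin_num.
  rewrite [RHS]integral_mkcond; apply: eq_integral => u _; rewrite patchE.
  by case: ifPn => // u1; rewrite /H indicE (negbTE u1) mul0r.
rewrite muleA -!EFinM; congr EFin.
apply: (canLR (mulfK _)) => //.
have c2 : Num.sg p * c = (1 - p) / (2 * p).
  rewrite /c; case: (ltgtP p 0) p0 => // pp _.
    by rewrite ltr0_sg// ltr0_norm// mulrN invrN mulN1r mulrN opprK.
  by rewrite gtr0_sg// gtr0_norm// mul1r.
transitivity ((\int[sigma]_(u in sphere) H u) * ((1 - p) / (2 * p) * n%:R)); last first.
  by rewrite mulrC mulrAC; congr (_ * _ * _); rewrite c2.
rewrite -(RintegralZr _ mS iHS)//; apply: eq_Rintegral => u /set_mem u1.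
have [lo [hi [lo0 bnd]]] := sphere_kernel_integral_bounds n0 p1 sK.
have A0_gt0 : 0 < A0 u by have /andP[+ _] := bnd u u1; exact: lt_le_trans.
rewrite /H indicE mem_set// mul1r (Ip_radial_powR n0 p1 m sK u1).
have -> : n%:R / p = m / p + 1 by rewrite mulrBl divff// subrK.
have x0 : 0 < (1 - p) / (2 * m) * A0 u by rewrite mulr_gt0// divr_gt0 ?mulr_gt0// subr_gt0.
rewrite powRD; last by rewrite (gt_eqF x0) implybT.
rewrite powRr1 ?(ltW x0)//.
move: (((1 - p) / (2 * m) * A0 u) `^ (m / p)) (A0 u) (A1 u) A0_gt0 => X a0 a1 a0_gt0.
by field; rewrite p0 (gt_eqF a0_gt0) (gt_eqF m0).
Qed.

End curvature_measure.

Unset Implicit Arguments.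

Theorem theorem3 (R : realType) (n : nat) (p : R) (K : set 'rV[R]_n)
    (f : 'rV[R]_n -> R) :
  (2 <= n)%N ->
  p < 0 \/ 0 < p < 1 ->
  convex_body_o K ->
  {within sphere, continuous f} ->
  ((volume (Ip p (log_family K f t)) - volume (Ip p K)) / t)%:E
    @[t --> 0^'] -->
  ((Num.sg p)%:E *
   \int[affine_dual_curvature_measure p K]_(u in sphere) (f u)%:E)%E.
Proof.
move=> n2 hp hK fc; have n0 : (0 < n)%N by exact: ltnW.
have p0 : p != 0 by case: hp => [/lt_eqF->//|/andP[/gt_eqF->]].
have p1 : p < 1 by case: hp => [/lt_trans->//|/andP[]].
have [r [M sK]] := convex_body_star_body hK.
have cK x y t : 0 <= t <= 1 -> K x -> K y -> K (t *: x + (1 - t) *: y).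
  exact: convex_body_convex hK.1.
have [B B0 fB] := within_continuous_bounded (@compact_sphere R n) fc.
rewrite -(Rintegral_volume_variation n0 p0 p1 sK cK B0 fB fc).
apply: cvg_EFin; first exact: nearW.
exact: (cvg_volume_Ip n0 p1 sK cK B0 fB fc).
Qed.
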